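(* Let $k\ge2$, $\alpha,\beta>0$, $c_{\kappa,k}=\frac{\Gamma(k(\alpha+\beta))}{2\Gamma(\alpha+\beta)^k}$, and for $z,w\in\mathbb{C}$ set $$G(z,w)=c_{\kappa,k}\int_{T^{k-1}}\Big(e^{\langle w,\,z\sum_{j=0}^{k-1}e^{-2ij\pi/k}t_j\rangle}+e^{\langle w,\,z\sum_{j=0}^{k-1}e^{i(2j-1)\pi/k}t_j\rangle}\Big)\prod_{j=0}^{k-1}t_j^{\alpha+\beta-1}\,dt_1\cdots dt_{k-1},\quad t_0=1-\sum_{j=1}^{k-1}t_j.$$ Then there is a function $g$ on $[0,\infty)\times[-1,1]$ with $G(z,w)=g\big(|zw|,\xi_{1,1}(k\phi_1,k\phi_2)\big)$ for all $z=|z|e^{i\phi_1},w=|w|e^{i\phi_2}$, and the generalized Bessel function of $I_{2k}$ with multiplicity $(\alpha,\beta)$ is $$\mathcal J_\kappa(z,w)=\int_{-1}^1\int_{-1}^1 g\big(|zw|,\xi_{u,v}(k\phi_1,k\phi_2)\big)\,d\nu^\alpha(u)\,d\nu^\beta(v).$$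
   Context: Identify $\mathbb{R}^2$ with $\mathbb{C}$, $\langle z,w\rangle=\mathrm{Re}(z\bar w)$, $z=|z|e^{i\phi_1}$, $w=|w|e^{i\phi_2}$. The dihedral group $I_{2k}$ (order $4k$) contains the reflections $z\mapsto\bar ze^{ij\pi/k}$, $j=0,\dots,2k-1$, forming two conjugacy classes ($j$ even, containing $z\mapsto\bar z$; $j$ odd); $\kappa=(\alpha,\beta)$ is $\alpha$ on the class with $j$ even and $\beta$ on the class with $j$ odd. The Dunkl kernel $E_\kappa$ is the joint eigenfunction of the Dunkl operators normalized by $E_\kappa(0,y)=1$, and $\mathcal J_\kappa(x,y)=\frac1{|G|}\sum_{g\in G}E_\kappa(x,gy)$. $d\nu^\alpha(u)=\frac{\Gamma(\alpha+1/2)}{\sqrt\pi\Gamma(\alpha)}(1-u^2)^{\alpha-1}du$ on $[-1,1]$. $\xi_{u,v}(\theta_1,\theta_2)=v\cos\theta_1\cos\theta_2+u\sin\theta_1\sin\theta_2$. $T^{k-1}$ is the open unit simplex $\{t_j>0,\sum_{j=1}^{k-1}t_j<1\}$ in $\mathbb{R}^{k-1}$. *)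

(* Defs.v *)
From HB Require Import structures.
From mathcomp Require Import all_boot all_order all_algebra.
From mathcomp Require Import all_classical all_reals all_analysis.
Set Implicit Arguments. Unset Strict Implicit. Unset Printing Implicit Defensive.
Import Order.TTheory GRing.Theory Num.Theory.
Import numFieldNormedType.Exports.
Local Open Scope classical_set_scope.
Local Open Scope ring_scope.

Section Dihedral.
Variable R : realType.
Notation C := (R * R)%type.

Definition pmul (z w : C) : C := (z.1 * w.1 - z.2 * w.2, z.1 * w.2 + z.2 * w.1).
Definition pconj (z : C) : C := (z.1, - z.2).
Definition pexpi (t : R) : C := (cos t, sin t).
Definition pscale (r : R) (z : C) : C := (r * z.1, r * z.2).
Definition pinner (z w : C) : R := z.1 * w.1 + z.2 * w.2.
Definition pnorm (z : C) : R := Num.sqrt (pinner z z).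

(* The dihedral group I_{2k} (order 4k): rotations z |-> z e^{ij pi/k} and
   reflections z |-> conj(z) e^{ij pi/k}, j = 0..2k-1. *)
Definition rotI (k j : nat) (z : C) : C := pmul z (pexpi (j%:R * pi / k%:R)).
Definition reflI (k j : nat) (z : C) : C := pmul (pconj z) (pexpi (j%:R * pi / k%:R)).
(* a root (normal vector) of the reflection reflI k j : its mirror is the
   line of angle j pi / (2k) *)
Definition rootI (k j : nat) : C :=
  (- sin (j%:R * pi / (2 * k%:R)), cos (j%:R * pi / (2 * k%:R))).
Definition kappaI (a b : R) (j : nat) : R := if odd j then b else a.

(* Dunkl operator T_xi for I_{2k} with multiplicity (a,b), at x with
   <root_j, x> <> 0 for all j *)
Definition dunkl (k : nat) (a b : R) (xi : C) (f : C -> R) (x : C) : R :=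
  'D_xi f x + \sum_(j < 2 * k)
     kappaI a b j * pinner (rootI k j) xi * (f x - f (reflI k j x)) / pinner (rootI k j) x.

Definition is_dunkl_kernel (k : nat) (a b : R) (E : C -> C -> R) : Prop :=
  forall y : C,
    E (0, 0) y = 1 /\
    (forall x : C, differentiable (fun x' : C => E x' y) x) /\
    (forall x xi : C, (forall j : nat, (j < 2 * k)%N -> pinner (rootI k j) x != 0) ->
        dunkl k a b xi (fun x' => E x' y) x = pinner xi y * E x y).

(* generalized Bessel function J(x,y) = 1/|G| sum_{g in G} E(x, g y) *)
Definition besselJ (k : nat) (E : C -> C -> R) (x y : C) : R :=
  (4 * k%:R)^-1 * (\sum_(j < 2 * k) E x (rotI k j y) + \sum_(j < 2 * k) E x (reflI k j y)).

Definition Gamma (s : R) : R :=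
  Rintegral lebesgue_measure `]0, +oo[ (fun t => t `^ (s - 1) * expR (- t)).

Definition nu_int (a : R) (h : R -> R) : R :=
  Gamma (a + 2^-1) / (Num.sqrt pi * Gamma a) *
  Rintegral lebesgue_measure `]-1, 1[ (fun u => h u * (1 - u ^+ 2) `^ (a - 1)).

Definition xi_uv (u v th1 th2 : R) : R := v * cos th1 * cos th2 + u * sin th1 * sin th2.

(* Iterated Lebesgue integral over the open simplex
   { t in R^m | t_j > 0, sum t_j < s }, variables listed as a sequence
   [:: t_1; ...; t_m]; the integral over T^m is simplex_int m f 1. *)
Fixpoint simplex_int (m : nat) (f : seq R -> R) (s : R) : R :=
  match m with
  | 0 => f [::]
  | m'.+1 => Rintegral lebesgue_measure `]0, s[
               (fun x => simplex_int m' (fun l => f (x :: l)) (s - x))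
  end.

(* t_j for j = 0..k-1, with t = [:: t_1; ...; t_{k-1}] and t_0 = 1 - sum *)
Definition tcoord (t : seq R) (j : nat) : R :=
  if j == 0%N then 1 - \sum_(x <- t) x else nth 0 t j.-1.

Definition csum (k : nat) (t : seq R) (th : nat -> R) : C :=
  (\sum_(j < k) tcoord t j * cos (th j), \sum_(j < k) tcoord t j * sin (th j)).

Definition G_integrand (k : nat) (a b : R) (z w : C) (t : seq R) : R :=
  (expR (pinner w (pmul z (csum k t (fun j => - (2 * j%:R * pi / k%:R))))) +
   expR (pinner w (pmul z (csum k t (fun j => (2 * j%:R - 1) * pi / k%:R))))) *
  \prod_(j < k) tcoord t j `^ (a + b - 1).

Definition c_kappa (k : nat) (a b : R) : R :=
  Gamma (k%:R * (a + b)) / (2 * Gamma (a + b) ^+ k).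

Definition Gfun (k : nat) (a b : R) (z w : C) : R :=
  c_kappa k a b * simplex_int k.-1 (G_integrand k a b z w) 1.

End Dihedral.

(* Main.v *)
Require Import Defs.
From HB Require Import structures.
From mathcomp Require Import all_boot all_order all_algebra.
From mathcomp Require Import all_classical all_reals all_analysis.
From mathcomp Require Import measurable_realfun.
From mathcomp.real_closed Require Import complex.
From mathcomp Require Import ring lra zify.
Import Order.TTheory GRing.Theory Num.Theory.
Import numFieldNormedType.Exports.
Set Implicit Arguments. Unset Strict Implicit. Unset Printing Implicit Defensive.
Local Open Scope classical_set_scope.
Local Open Scope ring_scope.

(** Both sides are entire series in [|z w|], and their coefficients are compared.

    The product [\prod_(l < k) (1 - s cos (th + 2 l pi / k))] depends on [th] only
    through [xi = cos (k th)]; write it [P_xi s].  Expanding the exponentials in the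
    Dirichlet integral over the simplex gives
    [G = \sum_n |z w|^n c_n(xi) / (k (a + b))_n], where [c_n] is the part even in [xi]
    of the [s^n]-coefficient of [P_xi s ^ (-(a + b))] and [(.)_n] is the rising factorial;
    in particular [g] exists.

    For the kernel, the Dunkl equation in the radial direction becomes, on the orbit of
    a ray, a linear singular system in [r].  Its singular part is dissipative because
    reflections are involutions, so an energy estimate yields uniqueness without any
    further regularity of [E], and any formal solution of the recurrence for the Taylor
    coefficients with a uniform bound [1 / n!] (a discrete maximum principle) must be the
    expansion of [E].  Such a solution is, up to the factor [1 / (k (a + b) + 1)_n], the
    [s^n]-coefficient of
    [\int \int (1 + u) (1 + v) P'(s) P_{xi_{u,v}}(s) ^ (-(a + b) - 1) dnu^a(u) dnu^b(v)],
    with [P'] the product above deprived of the factor [l = 0]: the recurrence reduces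
    to integration by parts in [u] and [v].  Averaging over the group turns these
    coefficients into those of the double integral of [g]. *)

(** * Gamma and Beta integrals *)

(** The kernel is only assumed differentiable in its first variable, with the Dunkl equation off the
    mirrors, so no expansion of it is available beforehand. Differentiating along the point itself
    makes every quotient of root products equal to [1 / r], which isolates the orbit of one ray;
    rays on mirrors are reached at the very end, by continuity in the angle.

    The weight [(1 + u) (1 + v)] and the exponent [-(a + b) - 1] belong together. With
    [cc = cos(kA) cos(kB)], [ss = sin(kA) sin(kB)] and [xi = cc v + ss u], the product at angle
    [A - B] differs from [P_xi] by a multiple of [s^k (cc + ss - xi)], and
    [cc + ss - xi = cc (1 - v) + ss (1 - u)]. The weight completes this to [1 - v^2] and [1 - u^2],
    the factors that integration by parts needs; differentiating [P_xi ^ (-(a + b))] in [xi] lowers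
    the exponent by one. The factor removed from [P] is [1 - s cos(A - B)], which carries the
    right-hand side of the Dunkl equation.

    At each order in [s] everything is polynomial in [u] and [v], so this algebra runs on moments
    alone; analysis enters only through uniform error bounds. *)

Section AffineChange.
Variable R : realType.
Notation mu := (@lebesgue_measure R).

Lemma preimage_affine_itv (c d : R) (c0 : 0 < c) (x y : R) (b1 b2 : bool) :
  (fun t : R => c * t + d) @^-1` [set` Interval (BSide b1 x) (BSide b2 y)] =
  [set` Interval (BSide b1 ((x - d) / c)) (BSide b2 ((y - d) / c))].
Proof.
apply/seteqP; split => t /=; case: b1; case: b2; rewrite !in_itv/=;
  by rewrite !(ler_pdivrMr, ltr_pdivrMr, ler_pdivlMr, ltr_pdivlMr)//
     !(lerBlDr, ltrBlDr, lerBrDr, ltrBrDr) !(mulrC c).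
Qed.

Let measurable_affine (c d : R) : measurable_fun setT (fun x : R => c * x + d).
Proof. by apply: measurable_funD => //; exact: mulrl_measurable. Qed.

Lemma lebesgue_measure_affine (c d : R) (c0 : 0 < c) (A : set R) :
  measurable A ->
  mu A = pushforward (mscale (NngNum (ltW c0)) mu)
    (fun x : R => c * x + d : measurableTypeR R) A.
Proof.
move=> mA; apply: lebesgue_measure_unique => //=.
  exact: measurable_affine.
move=> ? _ [[x y]] _ <-.
rewrite /pushforward /= /mscale preimage_affine_itv// lebesgue_measure_itv/=.
rewrite lebesgue_measure_itv/= !lte_fin ltr_pM2r ?invr_gt0// ltrD2r; case: ifP => _; last by rewrite mule0.
by rewrite -!EFinD -EFinM; congr EFin; field; rewrite gt_eqF.
Qed.

(** Nonnegativity replaces integrability here, so that Gamma and Beta integrals can be rescaled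
    before they are known to be finite. *)
Lemma ge0_integral_affine (c d : R) (c0 : 0 < c) (D : set R) (f : R -> \bar R) :
  measurable D -> measurable_fun D f -> (forall x, D x -> (0 <= f x)%E) ->
  (\int[mu]_(y in D) f y =
   c%:E * \int[mu]_(x in (fun t : R => c * t + d)%R @^-1` D) f (c * x + d)%R)%E.
Proof.
move=> mD mf f0.
have mphi := measurable_affine c d.
transitivity (\int[pushforward (mscale (NngNum (ltW c0)) mu)
    (fun x : R => (c * x + d)%R : measurableTypeR R)]_(y in D) f y)%E.
  by apply: eq_measure_integral => A mA _; exact: lebesgue_measure_affine.
rewrite ge0_integral_pushforward//; last by move=> y; rewrite inE; exact: f0.
have mphiD : measurable ((fun x : R => c * x + d) @^-1` D).
  by rewrite -[X in measurable X]setTI; exact: mphi.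
rewrite ge0_integral_mscale//=; last by move=> x; exact: f0.
by apply: measurable_comp mf _ => //; [move=> _ [x ? <-]|exact: measurable_funS mphi].
Qed.
End AffineChange.

Section GammaBeta.
Variable R : realType.
Notation mu := (@lebesgue_measure R).

(** The cut-off power [t_+^(q-1)]. Extension by zero turns Gamma, Beta and moment integrals into
    integrals over the whole line, whose domain is unchanged by translation and scaling. *)
Definition ppow (q t : R) : R := t `^ (q - 1) * \1_(`]0, +oo[) t.

Lemma ppow_ge0 q t : 0 <= ppow q t.
Proof. by rewrite mulr_ge0 ?powR_ge0. Qed.

Lemma ppow_pos q t : 0 < t -> ppow q t = t `^ (q - 1).
Proof. by move=> t0; rewrite /ppow indicE mem_set ?mulr1//= in_itv/= t0. Qed.

Lemma ppow_npos q t : t <= 0 -> ppow q t = 0.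
Proof.
move=> t0; rewrite /ppow indicE memNset ?mulr0//= in_itv/= andbT.
by apply/negP; rewrite -leNgt.
Qed.

Lemma ppowM q c t : 0 < c -> ppow q (c * t) = c `^ (q - 1) * ppow q t.
Proof.
move=> c0; have [t0|t0] := ltP 0 t.
  by rewrite !ppow_pos ?mulr_gt0// powRM// ltW.
by rewrite !ppow_npos ?mulr0// mulr_ge0_le0// ltW.
Qed.

Lemma measurable_ppow q : measurable_fun setT (ppow q).
Proof.
apply: measurable_funM; first exact: measurable_powR.
exact: measurable_indic.
Qed.

Definition eGam (s : R) : \bar R := (\int[mu]_t (ppow s t * expR (- t))%:E)%E.

Lemma measurable_ppowexp s : measurable_fun setT (fun t => ppow s t * expR (- t)).
Proof.
apply: measurable_funM; first exact: measurable_ppow.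
by apply: measurableT_comp; [exact: measurable_expR|exact: oppr_measurable].
Qed.

Lemma eGam_ge0 s : (0 <= eGam s)%E.
Proof. by apply: integral_ge0 => t _; rewrite lee_fin mulr_ge0 ?ppow_ge0 ?expR_ge0. Qed.

Lemma eGam_itv s :
  eGam s = (\int[mu]_(t in `]0%R, +oo[) (t `^ (s - 1) * expR (- t))%:E)%E.
Proof.
rewrite [RHS]integral_mkcond; apply: eq_integral => t _.
rewrite patchE /=; case: ifPn => [|/negP].
  by rewrite inE/= in_itv/= andbT => t0; rewrite ppow_pos.
rewrite inE/= in_itv/= andbT => /negP; rewrite -leNgt => t0.
by rewrite ppow_npos// mul0r.
Qed.

Lemma GammaE s : Gamma s = fine (eGam s).
Proof. by rewrite eGam_itv. Qed.

(** Integrate [w x * (T - h x)_+^(q-1) * exp (- T)] in both orders. Integrating in [T] first gives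
    the left side by translation; integrating in [x] first gives the right side by the assumed power
    law in [T]. The Beta identity ([h x = x]) and the moments of nu ([h x = x^2]) are both
    instances. *)
Lemma Gamma_tonelli (q s : R) (w h : R -> R) (B : \bar R) :
  measurable_fun setT w -> measurable_fun setT h -> (forall x, 0 <= w x) -> (0 <= B)%E ->
  (forall T : R, (\int[mu]_x (w x * ppow q (T - h x))%:E = (ppow s T)%:E * B)%E) ->
  (eGam q * \int[mu]_x (w x * expR (- h x))%:E = eGam s * B)%E.
Proof.
move=> mw mh w0 B0 HB.
have mf : measurable_fun [set: R * R]
    (fun z : R * R => (w z.1 * ppow q (z.2 - h z.1) * expR (- z.2))%:E).
  apply/measurable_EFinP; apply: measurable_funM; [apply: measurable_funM|].
  - exact: measurableT_comp.
  - apply: measurableT_comp; first exact: measurable_ppow.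
    by apply: measurable_funB => //; exact: measurableT_comp.
  - apply: measurableT_comp; first exact: measurable_expR.
    by apply: measurableT_comp => //; exact: oppr_measurable.
have f0 (z : R * R) : (0 <= (w z.1 * ppow q (z.2 - h z.1) * expR (- z.2))%:E)%E.
  by rewrite lee_fin mulr_ge0 ?expR_ge0// mulr_ge0 ?ppow_ge0.
have := @fubini_tonelli _ _ _ _ R mu mu _ mf f0; rewrite /=.
have -> : (\int[mu]_x \int[mu]_y (w x * ppow q (y - h x) * expR (- y))%:E =
          eGam q * \int[mu]_x (w x * expR (- h x))%:E)%E.
  rewrite muleC -ge0_integralZr//; last 3 first.
  - apply/measurable_EFinP; apply: measurable_funM => //.
    apply: measurableT_comp; first exact: measurable_expR.
    by apply: measurableT_comp.
  - by move=> x _; rewrite lee_fin mulr_ge0 ?expR_ge0.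
  - exact: eGam_ge0.
  apply: eq_integral => x _.
  rewrite (@ge0_integral_affine R 1 (h x))//; last 2 first.
  - apply/measurable_EFinP; apply: measurable_funM; [apply: measurable_funM|] => //.
    + apply: measurableT_comp; first exact: measurable_ppow.
      by apply: measurable_funB.
    + by apply: measurableT_comp; first exact: measurable_expR.
  - by move=> y _; rewrite lee_fin mulr_ge0 ?expR_ge0// mulr_ge0 ?ppow_ge0.
  rewrite mul1e preimage_setT /eGam -ge0_integralZl//; last 3 first.
  - apply/measurable_EFinP; exact: measurable_ppowexp.
  - by move=> t _; rewrite lee_fin mulr_ge0 ?ppow_ge0 ?expR_ge0.
  - by rewrite lee_fin mulr_ge0 ?expR_ge0.
  apply: eq_integral => t _.
  rewrite -EFinM mul1r addrK opprD expRD; congr EFin; ring.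
move=> ->.
rewrite /eGam -ge0_integralZr//; last 2 first.
  - apply/measurable_EFinP; exact: measurable_ppowexp.
  - by move=> t _; rewrite lee_fin mulr_ge0 ?ppow_ge0 ?expR_ge0.
apply: eq_integral => y _.
transitivity (\int[mu]_x ((w x * ppow q (y - h x))%:E * (expR (- y))%:E))%E.
  by apply: eq_integral => x _; rewrite -EFinM.
rewrite ge0_integralZr//; last 2 first.
- apply/measurable_EFinP; apply: measurable_funM => //.
  apply: measurableT_comp; first exact: measurable_ppow.
  by apply: measurable_funB.
- by move=> x _; rewrite lee_fin mulr_ge0 ?ppow_ge0.
by rewrite HB EFinM muleAC.
Qed.

Definition eBeta (p q : R) : \bar R := (\int[mu]_x (ppow p x * ppow q (1 - x))%:E)%E.

Let measurable_betafun p q c :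
  measurable_fun setT (fun x : R => ppow p x * ppow q (c - x)).
Proof.
apply: measurable_funM; first exact: measurable_ppow.
apply: measurableT_comp; first exact: measurable_ppow.
by apply: measurable_funB.
Qed.

Lemma eBeta_ge0 p q : (0 <= eBeta p q)%E.
Proof. by apply: integral_ge0 => t _; rewrite lee_fin mulr_ge0 ?ppow_ge0. Qed.

Lemma ppow_conv (p q T : R) :
  (\int[mu]_x (ppow p x * ppow q (T - x))%:E = (ppow (p + q) T)%:E * eBeta p q)%E.
Proof.
have [T0|T0] := ltP 0 T; last first.
  rewrite (ppow_npos _ T0) mul0e integral0_eq// => x _.
  have [x0|x0] := leP x 0; first by rewrite ppow_npos// mul0r.
  by rewrite (@ppow_npos q) ?mulr0// subr_le0 (le_trans T0)// ltW.
rewrite (@ge0_integral_affine R T 0)//; last 2 first.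
- exact/measurable_EFinP.
- by move=> x _; rewrite lee_fin mulr_ge0 ?ppow_ge0.
rewrite preimage_setT ppow_pos// /eBeta.
have E : T `^ (p + q - 1) = T * (T `^ (p - 1) * T `^ (q - 1)).
  rewrite -{2}[T]powRr1 ?ltW// -!powRD; last 2 first.
  - by apply/implyP => _; rewrite gt_eqF.
  - by apply/implyP => _; rewrite gt_eqF.
  by congr (_ `^ _); ring.
rewrite E EFinM -muleA; congr (_ * _)%E.
rewrite -ge0_integralZl//; last 3 first.
- apply/measurable_EFinP; exact: measurable_betafun.
- by move=> x _; rewrite lee_fin mulr_ge0 ?ppow_ge0.
- by rewrite lee_fin mulr_ge0 ?powR_ge0.
apply: eq_integral => x _; rewrite -EFinM addr0 ppowM//.
rewrite (_ : T - T * x = T * (1 - x)) ?ppowM//; last by ring.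
by congr EFin; ring.
Qed.

Lemma eGam_beta p q : (eGam q * eGam p = eGam (p + q) * eBeta p q)%E.
Proof.
apply: (@Gamma_tonelli q (p + q) (ppow p) idfun).
- exact: measurable_ppow.
- exact: measurable_id.
- by move=> x; exact: ppow_ge0.
- exact: eBeta_ge0.
- exact: ppow_conv.
Qed.

(** The even moments of nu with parameter [q] before normalization: the cut-off restricts [x] to the
    interval from -1 to 1. *)
Definition eMom (q : R) (n : nat) : \bar R :=
  (\int[mu]_x (x ^+ n.*2 * ppow q (1 - x ^+ 2))%:E)%E.

Let measurable_momfun q n (c : R) :
  measurable_fun setT (fun x : R => x ^+ n.*2 * ppow q (c - x ^+ 2)).
Proof.
apply: measurable_funM; first exact: exprn_measurable.
apply: measurableT_comp; first exact: measurable_ppow.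
by apply: measurable_funB => //; exact: exprn_measurable.
Qed.

Let even_pow_ge0 n (x : R) : 0 <= x ^+ n.*2.
Proof. by rewrite exprn_even_ge0// odd_double. Qed.

Lemma eMom_ge0 q n : (0 <= eMom q n)%E.
Proof. by apply: integral_ge0 => t _; rewrite lee_fin mulr_ge0 ?ppow_ge0. Qed.

Lemma eMom_scale (q T : R) n :
  (\int[mu]_x (x ^+ n.*2 * ppow q (T - x ^+ 2))%:E =
   (ppow (q + n%:R + 2^-1) T)%:E * eMom q n)%E.
Proof.
have [T0|T0] := ltP 0 T; last first.
  rewrite (ppow_npos _ T0) mul0e integral0_eq// => x _.
  by rewrite ppow_npos ?mulr0// subr_le0 (le_trans T0)// sqr_ge0.
have sT : 0 < Num.sqrt T by rewrite sqrtr_gt0.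
rewrite (@ge0_integral_affine R (Num.sqrt T) 0)//; last 2 first.
- apply/measurable_EFinP; exact: measurable_momfun.
- by move=> x _; rewrite lee_fin mulr_ge0 ?ppow_ge0.
rewrite preimage_setT ppow_pos// /eMom.
have E : T `^ (q + n%:R + 2^-1 - 1) = Num.sqrt T * (T ^+ n * T `^ (q - 1)).
  rewrite -powR12_sqrt ?ltW// -powR_mulrn ?ltW// -!powRD; last 2 first.
  - by apply/implyP => _; rewrite gt_eqF.
  - by apply/implyP => _; rewrite gt_eqF.
  by congr (_ `^ _); ring.
rewrite E EFinM -muleA; congr (_ * _)%E.
rewrite -ge0_integralZl//; last 3 first.
- apply/measurable_EFinP; exact: measurable_momfun.
- by move=> x _; rewrite lee_fin mulr_ge0 ?ppow_ge0.
- by rewrite lee_fin mulr_ge0 ?powR_ge0// exprn_ge0// ltW.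
apply: eq_integral => x _; rewrite -EFinM addr0.
rewrite exprMn exprMn sqr_sqrtr ?ltW//.
rewrite (_ : T - T * x ^+ 2 = T * (1 - x ^+ 2)) ?ppowM//; last by ring.
by rewrite -mul2n exprM sqr_sqrtr ?ltW// mul2n; congr EFin; ring.
Qed.

Lemma eGam_moment q n :
  (eGam q * \int[mu]_x (x ^+ n.*2 * expR (- x ^+ 2))%:E =
   eGam (q + n%:R + 2^-1) * eMom q n)%E.
Proof.
apply: (@Gamma_tonelli q _ (fun x => x ^+ n.*2) (fun x => x ^+ 2)).
- exact: exprn_measurable.
- exact: exprn_measurable.
- by [].
- exact: eMom_ge0.
- by move=> T; exact: eMom_scale.
Qed.

End GammaBeta.

Section GammaFin.
Variable R : realType.
Notation mu := (@lebesgue_measure R).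

(** For [p < 1] the integrand blows up at 0, so the fundamental theorem is applied on compact
    subintervals and monotone convergence does the rest. *)
Lemma eBetap1 (p : R) : 0 < p -> eBeta p 1 = (p^-1)%:E.
Proof.
move=> p0.
have -> : eBeta p 1 = (\int[mu]_(x in `]0%R, 1%R]) (x `^ (p - 1))%:E)%E.
  rewrite -integral_itv_bndo_bndc; last first.
    by apply/measurable_EFinP; apply: measurable_funTS; exact: measurable_powR.
  rewrite [RHS]integral_mkcond; apply: eq_integral => x _.
  rewrite patchE /=; case: ifPn => [|/negP].
    rewrite inE/= in_itv/= => /andP[x0 x1].
    by rewrite !ppow_pos ?subr_gt0// subrr powRr0 mulr1.
  rewrite inE/= in_itv/= => /negP; rewrite negb_and -!leNgt => /orP[x0|x1].
    by rewrite ppow_npos// mul0r.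
  by rewrite (@ppow_npos R 1) ?mulr0// subr_le0.
(* Starting at [1 / (n + 2)] keeps every interval nondegenerate, as the fundamental theorem
   requires. *)
pose F (n : nat) := `[(n.+2%:R)^-1 : R, 1%R]%classic.
have Fu : \bigcup_n F n = `]0%R, 1%R]%classic.
  apply/seteqP; split => x /=.
    case=> n _; rewrite /F/= !in_itv/= => /andP[x0 ->].
    by rewrite andbT (lt_le_trans _ x0).
  rewrite in_itv/= => /andP[x0 x1].
  have /ltr_add_invr[n] : 0 < x by [].
  rewrite add0r => nx; exists n => //; rewrite /F /= in_itv/= x1 andbT ltW//.
  by rewrite (le_lt_trans _ nx)// lef_pV2 ?posrE// ler_nat.
have H : (\int[mu]_(x in F n) (x `^ (p - 1))%:E)%E @[n --> \oo] -->
    (\int[mu]_(x in \bigcup_n F n) (x `^ (p - 1))%:E)%E.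
  apply: ge0_nondecreasing_set_cvg_integral => //.
  - apply/nondecreasing_seqP => n; apply/subsetPset => x; rewrite /F/= !in_itv/=.
    move=> /andP[x0 ->]; rewrite andbT (le_trans _ x0)//.
    by rewrite lef_pV2 ?posrE// ler_nat.
  - by move=> i; exact: measurable_itv.
  - by move=> i; apply/measurable_EFinP; apply: measurable_funTS; exact: measurable_powR.
  - by move=> i x _; rewrite lee_fin powR_ge0.
rewrite -Fu -(cvg_lim _ H)//; apply/cvg_lim => //.
have Fn n : (\int[mu]_(x in F n) (x `^ (p - 1))%:E =
             (p^-1 - p^-1 * (n.+2%:R)^-1 `^ p)%:E)%E.
  have n0 : 0 < (n.+2%:R)^-1 :> R by [].
  have dF (x : R) : 0 < x -> is_derive x (1:R) (fun x : R => p^-1 * x `^ p) (x `^ (p - 1)).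
    move=> x0; have H1 := is_derive1_powR p x0.
    have := @is_deriveZ _ _ _ _ p^-1 _ _ _ H1.
    by rewrite /GRing.scale/= mulrA mulVf ?gt_eqF// mul1r.
  rewrite (@continuous_FTC2 R (fun x => x `^ (p - 1)) (fun x => p^-1 * x `^ p))//.
  - by rewrite powR1 mulr1 EFinB.
  - by rewrite invf_lt1// ltr1n.
  - apply: derivable_within_continuous => x; rewrite in_itv/= => /andP[x0 _].
    by apply: derivable_powR; rewrite in_itv/= andbT (lt_le_trans _ x0).
  - split.
    + move=> x; rewrite in_itv/= => /andP[x0 _].
      by have [] := dF x (lt_trans n0 x0).
    + have [H1 _] := dF _ n0.
      apply: cvg_at_right_filter.
      by move/derivable1_diffP/differentiable_continuous : H1.
    + have [H1 _] := dF _ ltr01.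
      apply: cvg_at_left_filter.
      by move/derivable1_diffP/differentiable_continuous : H1.
  - move=> x; rewrite in_itv/= => /andP[x0 _]; rewrite derive1E.
    by have [] := dF x (lt_trans n0 x0).
under eq_fun do rewrite Fn.
apply: cvg_EFin; first exact: nearW.
rewrite -[X in _ --> X]subr0 -[X in _ - X](mulr0 p^-1).
apply: cvgB; first exact: cvg_cst.
apply: cvgMl_tmp.
have := powR_cvg0 p0.
move/cvg_at_rightP; apply.
split; first by move=> n; rewrite invr_gt0.
by have := @cvg_harmonic R; rewrite -(cvg_shiftn 1); under eq_fun do rewrite addn1.
Qed.

Lemma eGam1 : eGam (1 : R) = 1%E.
Proof.
rewrite -(@integral_exponential_pdf R 1)// eGam_itv.
rewrite integral_itv_obnd_cbnd; last first.
  apply/measurable_EFinP; apply: measurable_funTS.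
  apply: measurable_funM; first exact: measurable_powR.
  by apply: measurableT_comp; [exact: measurable_expR|exact: oppr_measurable].
rewrite integral_mkcond; apply: eq_integral => x _.
rewrite /exponential_pdf !patchE; case: ifPn => // _.
by rewrite subrr powRr0 !mul1r mulN1r.
Qed.

(** This is the Beta identity with [q = 1]. It holds in the extended reals, so it can be used to
    prove finiteness rather than presuppose it. *)
Lemma eGamS (p : R) : 0 < p -> eGam (p + 1) = (p%:E * eGam p)%E.
Proof.
move=> p0; have := eGam_beta p 1; rewrite eGam1 mul1e eBetap1// => ->.
by rewrite muleCA -EFinM divff ?mule1// gt_eqF.
Qed.

(** For [p <= 1] the integrand is at most [t^(p-1)] on (0, 1) and at most [exp (- t)] beyond, which
    are the integrands of [eBeta p 1] and [eGam 1]. *)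
Let eGam_fin1 (p : R) : 0 < p -> p <= 1 -> (eGam p < +oo)%E.
Proof.
move=> p0 p1.
apply: (@le_lt_trans _ _ (eBeta p 1 + eGam 1)%E); last first.
  by rewrite eBetap1// eGam1 -EFinD ltry.
rewrite /eBeta /eGam -ge0_integralD//=; last 4 first.
- by move=> x _; rewrite lee_fin mulr_ge0 ?ppow_ge0.
- apply/measurable_EFinP; apply: measurable_funM; first exact: measurable_ppow.
  apply: measurableT_comp; first exact: measurable_ppow.
  by apply: measurable_funB.
- by move=> x _; rewrite lee_fin mulr_ge0 ?ppow_ge0 ?expR_ge0.
- by apply/measurable_EFinP; exact: measurable_ppowexp.
apply: ge0_le_integral => //=.
- by move=> x _; rewrite lee_fin mulr_ge0 ?ppow_ge0 ?expR_ge0.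
- by apply/measurable_EFinP; exact: measurable_ppowexp.
- apply/measurable_EFinP; apply: measurable_funD; last exact: measurable_ppowexp.
  apply: measurable_funM; first exact: measurable_ppow.
  apply: measurableT_comp; first exact: measurable_ppow.
  by apply: measurable_funB.
move=> x _; rewrite lee_fin.
have [x0|x0] := leP x 0; first by rewrite !(@ppow_npos R _ x)// !mul0r addr0.
have [x1|x1] := ltP x 1.
  rewrite (@ppow_pos R 1 (1 - x)) ?subr_gt0// subrr powRr0 mulr1.
  rewrite -[leLHS]addr0 lerD//; last by rewrite mulr_ge0 ?ppow_ge0 ?expR_ge0.
  by rewrite ler_piMr ?ppow_ge0// -expR0 ler_expR oppr_le0 ltW.
rewrite (@ppow_npos R 1 (1 - x)) ?subr_le0// mulr0 add0r.
rewrite ler_pM2r ?expR_gt0// !ppow_pos// subrr powRr0.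
by rewrite -[leRHS](powRr0 x) ler_powR// subr_le0.
Qed.

Lemma eGam_fin (p : R) : 0 < p -> eGam p \is a fin_num.
Proof.
move=> p0; rewrite ge0_fin_numE ?eGam_ge0//.
have [n pn] : exists n : nat, p <= n%:R.
  by exists (Num.bound p); rewrite ltW// archi_boundP// ltW.
elim: n p p0 pn => [|n IH] p p0 pn.
  by have := lt_le_trans p0 pn; rewrite ltxx.
have [p1|p1] := leP p 1; first exact: eGam_fin1.
have p10 : 0 < p - 1 by rewrite subr_gt0.
rewrite -(subrK 1 p) eGamS// lte_mul_pinfty ?lee_fin ?ltW//.
by apply: IH => //; rewrite lerBlDr natr1.
Qed.

Lemma eGam_gt0 (p : R) : (0 < eGam p)%E.
Proof.
rewrite lt0e eGam_ge0 andbT; apply/negP => /eqP E.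
have : (\int[mu]_(t in `]1%R, 2%R[) (ppow p t * expR (- t))%:E = 0)%E.
  apply/eqP; rewrite eq_le; apply/andP; split.
    rewrite -E; apply: ge0_subset_integral => //.
    - by apply/measurable_EFinP; exact: measurable_ppowexp.
    - by move=> x _; rewrite lee_fin mulr_ge0 ?ppow_ge0 ?expR_ge0.
  by apply: integral_ge0 => x _; rewrite lee_fin mulr_ge0 ?ppow_ge0 ?expR_ge0.
have : exists2 c : R, 0 < c & forall t, 1 < t < 2 -> c <= ppow p t * expR (- t).
  (* On (1, 2) the power [t^(p-1)] is monotone, so it is bounded below by its value at 1 or at 2
     according to the sign of [p - 1]. *)
  exists (Num.min 1 (2 `^ (p - 1)) * expR (- 2)).
    by rewrite mulr_gt0 ?expR_gt0// lt_min ltr01 powR_gt0.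
  move=> t /andP[t1 t2]; have t0 : 0 < t by rewrite (lt_trans _ t1).
  apply: ler_pM; rewrite ?expR_ge0//.
  - rewrite ppow_pos// ge_min; apply/orP.
    have [p1|p1] := leP 1 p; [left|right].
      by rewrite -[leLHS](powRr0 t) ler_powR ?(ltW t1)// subr_ge0.
    rewrite -[p - 1]opprB !powRN lef_pV2 ?posrE ?powR_gt0//.
    by rewrite ge0_ler_powR ?nnegrE ?subr_ge0 ?(ltW t0) ?(ltW t2) ?(ltW p1).
  - by rewrite ler_expR lerN2 ltW.
case=> c c0 Hc H.
have : (\int[mu]_(t in `]1%R, 2%R[) c%:E <= 0)%E.
  rewrite -H; apply: ge0_le_integral => //=.
  - by move=> x _; rewrite lee_fin ltW.
  - by apply/measurable_EFinP; apply: measurable_funTS; exact: measurable_ppowexp.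
rewrite integral_cst//= lebesgue_measure_itv/= lte_fin ltr1n/= -EFinD -EFinM lee_fin.
by rewrite leNgt mulr_gt0// subr_gt0 ltr1n.
Qed.

Lemma Gamma_eGam (p : R) : 0 < p -> (Gamma p)%:E = eGam p.
Proof. by move=> p0; rewrite GammaE fineK// eGam_fin. Qed.

Lemma Gamma_gt0 (p : R) : 0 < p -> 0 < Gamma p.
Proof. by move=> p0; rewrite -lte_fin Gamma_eGam// eGam_gt0. Qed.

Lemma GammaS (p : R) : 0 < p -> Gamma (p + 1) = p * Gamma p.
Proof.
by move=> p0; apply/EFin_inj; rewrite EFinM !Gamma_eGam ?eGamS ?addr_gt0.
Qed.

Lemma eBetaE (p q : R) : 0 < p -> 0 < q ->
  eBeta p q = (Gamma p * Gamma q / Gamma (p + q))%:E.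
Proof.
move=> p0 q0; have pq0 := addr_gt0 p0 q0.
have := eGam_beta p q; rewrite -!Gamma_eGam// -EFinM.
have := eBeta_ge0 p q; case: (eBeta p q) => [r _|_|//].
  rewrite -EFinM => -[H]; congr EFin.
  by rewrite [Gamma p * _]mulrC H mulrAC divff ?mul1r// gt_eqF// Gamma_gt0.
by rewrite gt0_muley// lte_fin Gamma_gt0.
Qed.

End GammaFin.

Section RealIntegrals.
Variable R : realType.
Notation mu := (@lebesgue_measure R).
Notation rint D f := (mu.-integrable D (EFin \o f)).
Implicit Types (D : set (measurableTypeR R)) (f g W : R -> R).

Lemma rint_eq D f g : measurable D -> (forall x, D x -> f x = g x) -> rint D f -> rint D g.
Proof.
move=> mD fg; apply: eq_integrable => // x; rewrite inE => Dx /=.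
by rewrite fg.
Qed.

Lemma rintD D f g : measurable D -> rint D f -> rint D g -> rint D (fun x => f x + g x).
Proof. by move=> mD f1 g1; have := integrableD mD f1 g1; apply: eq_integrable. Qed.

Lemma rintZ D f (c : R) : measurable D -> rint D f -> rint D (fun x => c * f x).
Proof. by move=> mD f1; have := integrableZl mD c f1; apply: eq_integrable. Qed.

Lemma rintB D f g : measurable D -> rint D f -> rint D g -> rint D (fun x => f x - g x).
Proof. by move=> mD f1 g1; have := integrableB mD f1 g1; apply: eq_integrable. Qed.

Lemma rint0 D : measurable D -> rint D (fun=> 0).
Proof. by move=> mD; exact: integrable0. Qed.

Lemma rint_sum D (I : Type) (s : seq I) (h : I -> R -> R) : measurable D ->
  (forall i, rint D (h i)) ->
  rint D (fun x => \sum_(i <- s) h i x) /\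
  Rintegral mu D (fun x => \sum_(i <- s) h i x) = \sum_(i <- s) Rintegral mu D (h i).
Proof.
move=> mD hi; elim: s => [|i s [IH1 IH2]].
  split; first by apply: rint_eq (rint0 mD) => // x _; rewrite big_nil.
  rewrite big_nil; under eq_Rintegral do rewrite big_nil.
  by rewrite Rintegral_cst// mul0r.
split; first by apply: rint_eq (rintD mD (hi i) IH1) => // x _; rewrite big_cons.
under eq_Rintegral do rewrite big_cons.
by rewrite RintegralD// IH2 big_cons.
Qed.

(** Dominated convergence with an explicit rate. Measurability and integrability of the limit [F]
    are conclusions, so callers need to know nothing about [F] beyond its approximations. *)
Lemma rint_unif D (F W : R -> R) (Fn : nat -> R -> R) (e : nat -> R) :
  measurable D -> (forall n, rint D (Fn n)) -> rint D W ->
  (forall n x, D x -> `|F x - Fn n x| <= e n * W x) -> e n @[n --> \oo] --> 0 ->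
  rint D F /\
  forall n, `|Rintegral mu D F - Rintegral mu D (Fn n)| <= e n * Rintegral mu D W.
Proof.
move=> mD iF iW FW e0.
have mF : measurable_fun D F.
  apply: (@measurable_fun_cvg _ _ _ _ Fn) => [n|x Dx].
    by have /measurable_int/measurable_EFinP := iF n.
  apply/cvgrPdist_le => d d0.
  have : e n * W x @[n --> \oo] --> 0 by rewrite -(mul0r (W x)); exact: cvgMr_tmp.
  move/cvgrPdist_le => /(_ d d0) [N _ HN]; exists N => // n Nn.
  apply: (le_trans (FW n x Dx)); have := HN n Nn; rewrite /= sub0r normrN.
  exact: le_trans (ler_norm _).
have iFF : rint D F.
  apply: (@le_integrable _ _ _ mu _ mD _ (EFin \o (fun x => `|Fn 0%N x| + e 0%N * W x))).
  - exact/measurable_EFinP.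
  - move=> x Dx; rewrite /= lee_fin.
    rewrite [leRHS]ger0_norm; last first.
      by rewrite addr_ge0// (le_trans _ (FW 0%N x Dx)).
    rewrite -[F x](subrK (Fn 0%N x)) addrC.
    by apply: (le_trans (ler_normD _ _)); rewrite lerD2l FW.
  - by apply: rintD => //; [exact: integrable_norm|exact: rintZ].
split=> // n; rewrite -RintegralB//.
apply: (le_trans (le_normr_Rintegral _ _)) => //; first exact: rintB.
rewrite -RintegralZl//; apply: le_Rintegral => //.
- by apply: integrable_norm; exact: rintB.
- exact: rintZ.
- by move=> x Dx; exact: FW.
Qed.

Lemma Beta_itv (p q T : R) : 0 < p -> 0 < q -> 0 < T ->
  rint `]0, T[ (fun x => x `^ (p - 1) * (T - x) `^ (q - 1)) /\
  Rintegral mu `]0, T[ (fun x => x `^ (p - 1) * (T - x) `^ (q - 1)) =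
   T `^ (p + q - 1) * (Gamma p * Gamma q / Gamma (p + q)).
Proof.
move=> p0 q0 T0.
have E : (\int[mu]_(x in `]0%R, T[) (x `^ (p - 1) * (T - x) `^ (q - 1))%:E =
   (T `^ (p + q - 1) * (Gamma p * Gamma q / Gamma (p + q)))%:E)%E.
  rewrite EFinM -eBetaE// -(ppow_pos _ T0) -ppow_conv.
  rewrite integral_mkcond; apply: eq_integral => x _.
  rewrite patchE /=; case: ifPn => [|/negP].
    rewrite inE/= in_itv/= => /andP[x0 x1].
    by rewrite !ppow_pos ?subr_gt0.
  rewrite inE/= in_itv/= => /negP; rewrite negb_and -!leNgt => /orP[x0|x1].
    by rewrite ppow_npos// mul0r.
  by rewrite (@ppow_npos R _ (T - x)) ?mulr0// subr_le0.
split; last by rewrite /Rintegral E.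
apply/integrableP; split.
  have mf : measurable_fun setT (fun x : R => x `^ (p - 1) * (T - x) `^ (q - 1)).
    apply: measurable_funM; first exact: measurable_powR.
    apply: (measurableT_comp (measurable_powR _)).
    by apply: measurable_funB.
  by apply/measurable_EFinP; exact: measurable_funS mf.
rewrite (_ : (\int[mu]_(x in _) _)%E = (T `^ (p + q - 1) * (Gamma p * Gamma q / Gamma (p + q)))%:E) ?ltry//.
rewrite -E; apply: eq_integral => x _ /=.
by rewrite ger0_norm// mulr_ge0 ?powR_ge0.
Qed.

End RealIntegrals.

(** * Moments of the measures nu *)

Section NuMoments.
Variable R : realType.
Notation mu := (@lebesgue_measure R).
Notation rint D f := (mu.-integrable D (EFin \o f)).

Let W (a u : R) : R := (1 - u ^+ 2) `^ (a - 1).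

Lemma eMom_itv (a : R) n :
  eMom a n = (\int[mu]_(u in `](-1)%R, 1%R[) (u ^+ n.*2 * W a u)%:E)%E.
Proof.
rewrite [RHS]integral_mkcond; apply: eq_integral => x _.
have x1 : (x \in `](-1)%R, 1%R[) = (0 < 1 - x ^+ 2).
  rewrite subr_gt0 in_itv/= -ltr_norml -(@expr_lt1 _ 2)//.
  by rewrite real_normK ?num_real.
rewrite patchE /= mem_setE x1; case: ifPn => [x0|].
  by rewrite ppow_pos.
by rewrite -leNgt => x0; rewrite ppow_npos// mulr0.
Qed.

(** For parameter 1 the weight is constant. Together with [eGam_moment] this gives the Gaussian
    moments, and from these the moments for every parameter. *)
Lemma eMom1 n : eMom (1 : R) n = ((n%:R + 2^-1)^-1)%:E.
Proof.
rewrite eMom_itv.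
transitivity (\int[mu]_(u in `[(-1)%R, 1%R]) (u ^+ n.*2)%:E)%E.
  rewrite (@integral_itv_bndoo R (-1) 1 _ true false); last first.
    by apply/measurable_EFinP; apply: measurable_funTS; exact: exprn_measurable.
  by apply: eq_integral => x _; rewrite /W subrr powRr0 mulr1.
pose F (x : R) := (n.*2.+1%:R)^-1 * x ^+ n.*2.+1.
have dF (x : R) : is_derive x (1 : R) F (x ^+ n.*2).
  have := @is_deriveX _ _ _ n.*2.+1 x 1 _ (is_derive_id x (1 : R)).
  rewrite exprfctE => H; have := @is_deriveZ _ _ _ _ (n.*2.+1%:R)^-1 _ _ _ H.
  by rewrite /GRing.scale/= mulr1 mulKf.
have cF : continuous F.
  move=> x; apply: differentiable_continuous; apply/derivable1_diffP.
  by have [] := dF x.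
rewrite (@continuous_FTC2 R (fun x => x ^+ n.*2) F)//.
- rewrite /F expr1n -signr_odd /= odd_double/= expr1 mulr1 mulrN1.
  rewrite -EFinB; congr EFin; rewrite -mul2n -addn1 natrD natrM.
  by field; rewrite -natrM natr1 !pnatr_eq0.
- by apply: continuous_subspaceT => x; exact: exprn_continuous.
- split.
  + by move=> x _; have [] := dF x.
  + by apply: cvg_at_right_filter; exact: cF.
  + by apply: cvg_at_left_filter; exact: cF.
- by move=> x _; rewrite derive1E; have [] := dF x.
Qed.


Let gm n : \bar R := (\int[mu]_x (x ^+ n.*2 * expR (- x ^+ 2))%:E)%E.

Let gmE n : gm n = (Gamma (n%:R + 2^-1 : R))%:E.
Proof.
have h0 : 0 < n%:R + 2^-1 :> R by rewrite ltr_wpDl.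
have := eGam_moment (1 : R) n; rewrite eGam1 mul1e eMom1 -/(gm n) => ->.
rewrite (_ : 1 + n%:R + 2^-1 = (n%:R + 2^-1) + 1); last by ring.
rewrite -Gamma_eGam ?(addr_gt0 h0)// GammaS// -EFinM mulrAC divff ?mul1r//.
Qed.

Lemma Gamma_half : Gamma (2^-1 : R) = Num.sqrt pi.
Proof.
apply: EFin_inj; rewrite -integralT_gauss.
have := gmE 0%N; rewrite mulr0n add0r => <-.
by apply: eq_integral => x _; rewrite /gauss_fun expr0 mul1r.
Qed.

Lemma eMomE (a : R) n : 0 < a ->
  eMom a n = (Gamma a * Gamma (n%:R + 2^-1) / Gamma (a + n%:R + 2^-1))%:E.
Proof.
move=> a0.
have b0 : 0 < a + n%:R + 2^-1 by rewrite -addrA addr_gt0// ltr_wpDl.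
have := eGam_moment a n; rewrite -/(gm n) gmE -!Gamma_eGam// -EFinM.
have := eMom_ge0 a n; case: (eMom a n) => [r _|_|//].
  rewrite -EFinM => -[H]; congr EFin.
  by rewrite H mulrAC divff ?mul1r// gt_eqF// Gamma_gt0.
by rewrite gt0_muley// lte_fin Gamma_gt0.
Qed.

Let mW (a : R) n : measurable_fun setT (fun u : R => u ^+ n * W a u).
Proof.
apply: measurable_funM; first exact: exprn_measurable.
apply: (measurableT_comp (measurable_powR _)).
by apply: measurable_funB => //; exact: exprn_measurable.
Qed.

Let rint_even (a : R) n : 0 < a -> rint `]-1, 1[ (fun u => u ^+ n.*2 * W a u).
Proof.
move=> a0; apply/integrableP; split.
  by apply/measurable_EFinP; exact: measurable_funS (mW a n.*2).
have := ltry (Gamma a * Gamma (n%:R + 2^-1) / Gamma (a + n%:R + 2^-1)).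
rewrite -eMomE// eMom_itv; apply: le_lt_trans.
rewrite le_eqVlt; apply/orP; left; apply/eqP; apply: eq_integral => u _ /=.
by rewrite ger0_norm// mulr_ge0 ?powR_ge0// exprn_even_ge0// odd_double.
Qed.

Lemma rint_mono (a : R) n : 0 < a -> rint `]-1, 1[ (fun u => u ^+ n * W a u).
Proof.
move=> a0.
apply: (@le_integrable _ _ _ mu _ _ _ (EFin \o (fun u => u ^+ 0.*2 * W a u))) => //.
- by apply/measurable_EFinP; exact: measurable_funS (mW a n).
- move=> u /=; rewrite in_itv/= => /andP[u1 u2]; rewrite lee_fin expr0 mul1r normrM.
  rewrite ler_piMl// normrX exprn_ile1// ler_norml !ltW//.
- exact: rint_even.
Qed.

Lemma rint_poly (a : R) (p : {poly R}) : 0 < a -> rint `]-1, 1[ (fun u => p.[u] * W a u).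
Proof.
move=> a0.
have mD : measurable (`]-1, 1[%classic : set (measurableTypeR R)) by [].
have [H _] := @rint_sum R _ _ (index_enum 'I_(size p))
  (fun i u => p`_i * (u ^+ i * W a u)) mD
  (fun i => rintZ p`_i mD (rint_mono i a0)).
apply: rint_eq H => // u _; rewrite horner_coef mulr_suml.
by apply: eq_bigr => i _; rewrite mulrA.
Qed.

Definition nmom (a : R) (n : nat) : R := nu_int a (fun u => u ^+ n).

Let Gamma_neq0 (p : R) : 0 < p -> Gamma p != 0.
Proof. by move=> p0; rewrite gt_eqF// Gamma_gt0. Qed.

Let sqrtpi_neq0 : Num.sqrt pi != 0 :> R.
Proof. by rewrite gt_eqF// sqrtr_gt0 pi_gt0. Qed.

Lemma nu_norm_even (a : R) n : 0 < a ->
  nmom a n.*2 = Gamma (a + 2^-1) / Num.sqrt pi *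
    (Gamma (n%:R + 2^-1) / Gamma (a + n%:R + 2^-1)).
Proof.
move=> a0; rewrite /nmom /nu_int /Rintegral -/(W a) -eMom_itv eMomE//=.
have := Gamma_neq0 a0; move: (Gamma a) => ga ga0.
by rewrite invfM -!mulrA; congr (_ * (_ * _)); rewrite mulKf.
Qed.

Lemma nmom0 (a : R) : 0 < a -> nmom a 0 = 1.
Proof.
move=> a0; have := nu_norm_even 0 a0; rewrite mulr0n add0r addr0 Gamma_half => ->.
by rewrite mulrA divfK// divff// Gamma_neq0// addr_gt0.
Qed.

Lemma nmom_even (a : R) n : 0 < a ->
  (a + n%:R + 2^-1) * nmom a n.+1.*2 = (n%:R + 2^-1) * nmom a n.*2.
Proof.
move=> a0; rewrite (nu_norm_even n a0) (nu_norm_even n.+1 a0).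
have b0 : 0 < a + n%:R + 2^-1 by rewrite -addrA addr_gt0// ltr_wpDl.
have h0 : 0 < n%:R + 2^-1 :> R by rewrite ltr_wpDl.
rewrite -(natr1 n) (_ : n%:R + 1 + 2^-1 = (n%:R + 2^-1) + 1); last by ring.
rewrite (_ : a + (n%:R + 1) + 2^-1 = (a + n%:R + 2^-1) + 1); last by ring.
rewrite !GammaS// mulrCA [RHS]mulrCA; congr (_ * _).
have := Gamma_neq0 b0; move: (Gamma (a + _ + _)) (Gamma (n%:R + _)) => x y x0.
have : a + n%:R + 2^-1 != 0 by rewrite gt_eqF.
move: (a + _ + _) (n%:R + _) => B h B0.
by field; rewrite x0 B0.
Qed.

End NuMoments.

Section NuOdd.
Variable R : realType.
Notation mu := (@lebesgue_measure R).

Let sym_ge0 (f : R -> \bar R) : measurable_fun setT f ->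
  (forall x, 0 <= f x)%E ->
  (\int[mu]_(x in `](-1)%R, 1%R[) f (- x)%R = \int[mu]_(x in `](-1)%R, 1%R[) f x)%E.
Proof.
move=> mf f0; apply/esym.
transitivity (\int[pushforward mu (-%R : _ -> measurableTypeR R)]_(x in `](-1)%R, 1%R[) f x)%E.
  by apply: eq_measure_integral => //= A mA AS; exact/esym/lebesgue_measureN.
rewrite ge0_integral_pushforward//=; last exact: measurable_funS mf.
rewrite (_ : _ @^-1` _ = `](-1)%R, 1%R[%classic)//.
by apply/seteqP; split => x /=; rewrite !in_itv/= ltrN2 ltrNl andbC.
Qed.

Lemma nmom_odd (a : R) n : 0 < a -> odd n -> nmom a n = 0.
Proof.
move=> a0 on.
pose f (u : R) : \bar R := (u ^+ n * (1 - u ^+ 2) `^ (a - 1))%:E.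
have mf : measurable_fun setT f.
  apply/measurable_EFinP; apply: measurable_funM; first exact: exprn_measurable.
  apply: (measurableT_comp (measurable_powR _)).
  by apply: measurable_funB => //; exact: exprn_measurable.
have fN u : f (- u)%R = (- f u)%E.
  by rewrite /f sqrrN exprNn -signr_odd on expr1 mulN1r mulNr.
(* The integral equals its own opposite. The change of sign is available for nonnegative integrands,
   so it is applied to the positive and negative parts separately. *)
have : (\int[mu]_(x in `](-1)%R, 1%R[) f x = - \int[mu]_(x in `](-1)%R, 1%R[) f x)%E.
  have H1 : (\int[mu]_(x in `](-1)%R, 1%R[) f^\+ (- x)%R =
             \int[mu]_(x in `](-1)%R, 1%R[) f^\+ x)%E.
    by apply: sym_ge0; [exact: measurable_funepos|move=> x; exact: funepos_ge0].
  have H2 : (\int[mu]_(x in `](-1)%R, 1%R[) f^\- (- x)%R =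
             \int[mu]_(x in `](-1)%R, 1%R[) f^\- x)%E.
    by apply: sym_ge0; [exact: measurable_funeneg|move=> x; exact: funeneg_ge0].
  rewrite [in LHS]integralE -H1 -H2.
  rewrite [in RHS]integralE fin_num_oppeB; last first.
    by apply: integrable_neg_fin_num => //; exact: (rint_mono n a0).
  rewrite addeC; congr (_ + _)%E.
  - congr (- _)%E; apply: eq_integral => x _.
    by rewrite funenegE funeposE fN oppeK.
  - by apply: eq_integral => x _; rewrite funenegE funeposE fN.
rewrite /nmom /nu_int /Rintegral -/f.
case: (\int[mu]_(x in _) _)%E => [r||]//=; rewrite ?mulr0//.
move=> -[]; move: (_ / _) => c H.
by rewrite (_ : r = 0) ?mulr0//; lra.
Qed.

End NuOdd.

(** * Integration of polynomials as a linear functional of the moments *)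

Section MomentFunctional.
Variable R : realType.
Variable m : nat -> R.

Definition momL (p : {poly R}) : R := \sum_(i < size p) p`_i * m i.

Lemma momL_widen n (p : {poly R}) : (size p <= n)%N -> momL p = \sum_(i < n) p`_i * m i.
Proof.
move=> pn; rewrite /momL (big_ord_widen _ (fun i => p`_i * m i) pn) big_mkcond/=.
apply: eq_bigr => i _; case: ltnP => // ip.
by rewrite nth_default// mul0r.
Qed.

Fact momL_is_linear : linear_for *%R momL.
Proof.
move=> c p q; set n := maxn (size p) (size q).
have pn : (size p <= n)%N by exact: leq_maxl.
have qn : (size q <= n)%N by exact: leq_maxr.
have sn : (size (c *: p + q)%R <= n)%N.
  by rewrite (leq_trans (size_polyD _ _))// geq_max qn (leq_trans (size_scale_leq _ _)).
rewrite (momL_widen pn) (momL_widen qn) (momL_widen sn) mulr_sumr -big_split/=.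
by apply: eq_bigr => i _; rewrite coefD coefZ mulrDl mulrA.
Qed.

HB.instance Definition _ :=
  GRing.isLinear.Build R {poly R} R *%R momL momL_is_linear.

Lemma momLZ (c : R) p : momL (c *: p) = c * momL p.
Proof. by have := momL_is_linear c p 0; rewrite !addr0 raddf0 addr0. Qed.

Lemma momLXn n : momL 'X^n = m n.
Proof.
rewrite /momL size_polyXn (bigD1 ord_max)//= coefXn eqxx mul1r big1 ?addr0// => i.
by rewrite coefXn -val_eqE/= => /negPf->; rewrite mul0r.
Qed.

(* Integration by parts against (1 - u^2)^(a-1), read off on monomials. *)
Lemma momL_parts (a : R) :
  (forall n, n%:R * (m n.-1 - m n.+1) = 2 * a * m n.+1) ->
  forall p, momL (p^`() * (1 - 'X^2)) = 2 * a * momL ('X * p).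
Proof.
move=> Hm p; rewrite -(coefK p) poly_def.
rewrite (raddf_sum (@deriv R)) mulr_suml (raddf_sum momL)/=.
rewrite (mulr_sumr _ _ _ 'X) (raddf_sum momL)/= mulr_sumr.
apply: eq_bigr => i _; rewrite derivZ derivXn -scalerAl momLZ.
rewrite -scalerAr momLZ -exprS momLXn mulrCA -Hm; congr (_ * _).
rewrite mulrBr mulr1; case: (nat_of_ord i) => [|j] /=.
  by rewrite !mulr0n !mul0r oppr0 addr0 raddf0.
rewrite [_ *+ _ * 'X^2]mulrnAl -exprD -mulrnBl raddfMn/= raddfB/= !momLXn addn2.
by rewrite mulr_natl.
Qed.

Lemma momL_sym : (forall n, odd n -> m n = 0) ->
  forall p, momL (p \Po (- 'X)) = momL p.
Proof.
move=> Hm p; rewrite -{2}(coefK p) poly_def comp_polyE !(raddf_sum momL)/=.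
apply: eq_bigr => i _; rewrite !momLZ exprNn -signr_odd.
case: (boolP (odd i)) => oi; last by rewrite mul1r.
by rewrite expr1 mulN1r raddfN/= !momLXn Hm// oppr0.
Qed.

End MomentFunctional.

Section NuPoly.
Variable R : realType.
Notation mu := (@lebesgue_measure R).

(** Integration by parts against [(1 - u^2)^(a-1)] on the monomial [u^n], obtained from the Gamma
    quotients instead of a limit at the endpoints. At [n = 0] the truncated predecessor is harmless
    because its factor is 0; for even [n] all moments involved are odd and vanish. *)
Lemma nmom_rec (a : R) n : 0 < a ->
  n%:R * (nmom a n.-1 - nmom a n.+1) = 2 * a * nmom a n.+1.
Proof.
move=> a0; case: n => [|n]; first by rewrite mulr0n mul0r nmom_odd// mulr0.
case: (boolP (odd n)) => on.
  by rewrite /= !nmom_odd//= ?on// subrr !mulr0.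
have := nmom_even n./2 a0; rewrite doubleS (even_halfK on) => H.
have E : (n./2)%:R = n%:R / 2 :> R.
  by rewrite -{2}(even_halfK on) -mul2n natrM mulrAC divff ?mul1r.
move: H; rewrite E -(natr1 n) /=; move: (nmom a n) (nmom a n.+2) (n%:R : R) => x y z H.
apply/eqP; rewrite -subr_eq0.
rewrite (_ : _ - _ = 2 * ((z / 2 + 2^-1) * x - (a + z / 2 + 2^-1) * y)); last by field.
by rewrite H subrr mulr0.
Qed.

Lemma nu_int_poly (a : R) (p : {poly R}) : 0 < a ->
  nu_int a (fun u => p.[u]) = momL (nmom a) p.
Proof.
move=> a0.
have mD : measurable (`]-1, 1[%classic : set (measurableTypeR R)) by [].
have [_ H] := @rint_sum R _ _ (index_enum 'I_(size p))
  (fun i u => p`_i * (u ^+ i * (1 - u ^+ 2) `^ (a - 1))) mD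
  (fun i => rintZ p`_i mD (rint_mono i a0)).
rewrite /nu_int /momL.
transitivity (Gamma (a + 2^-1) / (Num.sqrt pi * Gamma a) *
  \sum_(i < size p) Rintegral mu `]-1, 1[ (fun u => p`_i * (u ^+ i * (1 - u ^+ 2) `^ (a - 1)))).
  congr (_ * _); rewrite -H; apply: eq_Rintegral => u _.
  by rewrite horner_coef mulr_suml; apply: eq_bigr => i _; rewrite mulrA.
rewrite mulr_sumr; apply: eq_bigr => i _.
by rewrite RintegralZl//; [rewrite /nmom /nu_int mulrCA|exact: rint_mono].
Qed.

(* Polynomials in [u] and [v] live in [{poly {poly R}}]: [v] is the outer variable and [u]
   the inner one. *)
Definition mom2 (a b : R) (p : {poly {poly R}}) : R :=
  momL (nmom b) (map_poly (momL (nmom a)) p).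

Lemma nu_int_poly2 (a b : R) (p : {poly {poly R}}) : 0 < a -> 0 < b ->
  (forall v, nu_int a (fun u => p.[v%:P].[u]) = (map_poly (momL (nmom a)) p).[v]) /\
  nu_int b (fun v => nu_int a (fun u => p.[v%:P].[u])) = mom2 a b p.
Proof.
move=> a0 b0; rewrite /mom2 -nu_int_poly//.
suff H v : nu_int a (fun u => p.[v%:P].[u]) = (map_poly (momL (nmom a)) p).[v].
  by split=> //; congr nu_int; apply/funext.
rewrite nu_int_poly// horner_coef raddf_sum/=.
rewrite (@horner_coef_wide _ (size p)); last exact: size_poly.
by apply: eq_bigr => i _; rewrite coef_map/= -rmorphXn/= mulrC mul_polyC momLZ mulrC.
Qed.

End NuPoly.

Section Mom2.
Variable R : realType.
Variables a b : R.
Hypotheses (a0 : 0 < a) (b0 : 0 < b).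
Local Notation A2 := {poly {poly R}}.
Local Notation LL := (mom2 a b).

Fact mom2_is_additive : zmod_morphism LL.
Proof. by move=> p q; rewrite /mom2 !raddfB. Qed.

HB.instance Definition _ := GRing.isZmodMorphism.Build A2 R LL mom2_is_additive.

Lemma mom2C (c : R) p : LL (c%:P%:P * p) = c * LL p.
Proof.
rewrite /mom2 -momLZ; congr momL; apply/polyP => i.
by rewrite coefZ !coef_map/= coefCM mul_polyC momLZ.
Qed.

Let mapX (p : A2) : map_poly (momL (nmom a)) ('X * p) = 'X * map_poly (momL (nmom a)) p.
Proof.
by apply/polyP => i; rewrite coef_map/= !coefXM coef_map; case: eqP => //= _; rewrite raddf0.
Qed.

Lemma mom2_parts_v (p : A2) : LL (p^`() * (1 - 'X^2)) = 2 * b * LL ('X * p).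
Proof.
rewrite /mom2 mapX -(momL_parts (fun n => nmom_rec n b0)); congr momL.
have -> : (map_poly (momL (nmom a)) p)^`() = map_poly (momL (nmom a)) p^`().
  by apply/polyP => i; rewrite coef_deriv !coef_map/= coef_deriv raddfMn.
rewrite ![_ * (1 - _)]mulrC !mulrBl !mul1r raddfB/= !expr2 -!mulrA.
by rewrite !mapX.
Qed.

Lemma mom2_parts_u (p : A2) :
  LL (map_poly deriv p * (1 - 'X^2)%:P) = 2 * a * LL ('X%:P * p).
Proof.
rewrite /mom2 -momLZ; congr momL; apply/polyP => i.
by rewrite coefZ !coef_map/= coefMC coefCM coef_map/= (momL_parts (fun n => nmom_rec n a0)).
Qed.

Lemma mom2_sym_v (p : A2) : LL (p \Po (- 'X)) = LL p.
Proof.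
rewrite /mom2 -[RHS](momL_sym (fun n => @nmom_odd R b n b0)); congr momL; apply/polyP => i.
have E (S : nzRingType) (q : {poly S}) : (q \Po - 'X)`_i = (-1) ^+ i * q`_i.
  elim/poly_ind: q i => [|q c IH] i; first by rewrite comp_poly0 !coef0 mulr0.
  rewrite comp_poly_MXaddC mulrN !coefD !coefN coefMX coefMX !coefC.
  case: i => [|i] /=; first by rewrite oppr0 !add0r expr0 mul1r.
  by rewrite !addr0 IH exprS mulN1r mulNr.
rewrite coef_map/= !E coef_map/= -[in LHS]signr_odd -[in RHS]signr_odd.
by case: (odd i); rewrite /= ?expr0 ?expr1 ?mul1r// !mulN1r raddfN.
Qed.

Lemma mom2_sym_u (p : A2) : LL (map_poly (comp_poly (- 'X)) p) = LL p.
Proof.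
rewrite /mom2; congr momL; apply/polyP => i.
by rewrite !coef_map/= (momL_sym (fun n => @nmom_odd R a n a0)).
Qed.

End Mom2.

(** * Powers of formal power series *)

(** A record rather than a bare function type, so that multiplication is the Cauchy product and not
    a pointwise one. *)
Record fps (A : Type) := Fps { fc : nat -> A }.
Arguments fc {A} f n : rename.

Section FpsRing.
Variable A : comNzRingType.
Implicit Types f g h : fps A.

Lemma fpsP f g : (forall n, fc f n = fc g n) -> f = g.
Proof. by case: f g => [f] [g] /= fg; congr Fps; apply/funext. Qed.

HB.instance Definition _ := gen_eqMixin (fps A).
HB.instance Definition _ := gen_choiceMixin (fps A).

Definition fps0 : fps A := Fps (fun=> 0).
Definition fps1 : fps A := Fps (fun n => (n == 0%N)%:R).
Definition fpsD f g := Fps (fun n => fc f n + fc g n).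
Definition fpsN f := Fps (fun n => - fc f n).
Definition fpsM f g := Fps (fun n => \sum_(i < n.+1) fc f i * fc g (n - i)%N).

Fact fpsDA : associative fpsD. Proof. by move=> f g h; apply: fpsP => n /=; rewrite addrA. Qed.
Fact fpsDC : commutative fpsD. Proof. by move=> f g; apply: fpsP => n /=; rewrite addrC. Qed.
Fact fps0D : left_id fps0 fpsD. Proof. by move=> f; apply: fpsP => n /=; rewrite add0r. Qed.
Fact fpsND : left_inverse fps0 fpsN fpsD.
Proof. by move=> f; apply: fpsP => n /=; rewrite addNr. Qed.

HB.instance Definition _ := GRing.isZmodule.Build (fps A) fpsDA fpsDC fps0D fpsND.

(** Coefficients up to [n] of a product depend only on truncations at [n], so commutativity and
    associativity are inherited from polynomials. *)
Let tr n f : {poly A} := \poly_(i < n.+1) fc f i.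

Let tr_coef n f i : (i <= n)%N -> (tr n f)`_i = fc f i.
Proof. by move=> iN; rewrite coef_poly ltnS iN. Qed.

Let fpsM_tr n f g i : (i <= n)%N -> fc (fpsM f g) i = (tr n f * tr n g)`_i.
Proof.
move=> iN; rewrite coefM; apply: eq_bigr => -[j /= ji] _.
by rewrite !tr_coef// ?(leq_trans (leq_subr _ _))// (leq_trans _ iN).
Qed.

Fact fpsMC : commutative fpsM.
Proof. by move=> f g; apply: fpsP => n; rewrite !(@fpsM_tr n)// mulrC. Qed.

Fact fpsMA : associative fpsM.
Proof.
move=> f g h; apply: fpsP => n /=.
transitivity ((tr n f * (tr n g * tr n h))`_n).
  rewrite coefM; apply: eq_bigr => -[j /= ji] _.
  by rewrite tr_coef// -fpsM_tr// leq_subr.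
rewrite mulrA coefM; apply: eq_bigr => -[j /= ji] _.
by rewrite tr_coef// ?leq_subr// -fpsM_tr.
Qed.

Fact fps1M : left_id fps1 fpsM.
Proof.
move=> f; apply: fpsP => n /=; rewrite big_ord_recl/= subn0 mul1r big1 ?addr0// => i _.
by rewrite mul0r.
Qed.

Fact fpsMDl : left_distributive fpsM fpsD.
Proof.
move=> f g h; apply: fpsP => n /=; rewrite -big_split/=.
by apply: eq_bigr => i _; rewrite mulrDl.
Qed.

Fact fps1_neq0 : fps1 != 0.
Proof. by apply/eqP => /(congr1 (fc^~ 0%N)) /= /eqP; rewrite oner_eq0. Qed.

HB.instance Definition _ :=
  GRing.Zmodule_isComNzRing.Build (fps A) fpsMA fpsMC fps1M fpsMDl fps1_neq0.

Lemma fcD f g n : fc (f + g) n = fc f n + fc g n. Proof. by []. Qed.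
Lemma fcN f n : fc (- f) n = - fc f n. Proof. by []. Qed.
Lemma fc0 n : fc (0 : fps A) n = 0. Proof. by []. Qed.
Lemma fcM f g n : fc (f * g) n = \sum_(i < n.+1) fc f i * fc g (n - i)%N.
Proof. by []. Qed.
Lemma fc1 n : fc (1 : fps A) n = (n == 0%N)%:R. Proof. by []. Qed.

Definition fpsC (c : A) : fps A := Fps (fun n => if n == 0%N then c else 0).

Lemma fcCM c f n : fc (fpsC c * f) n = c * fc f n.
Proof.
by rewrite fcM big_ord_recl/= subn0 big1 ?addr0// => i _; rewrite mul0r.
Qed.

Definition fpsp (p : {poly A}) : fps A := Fps (fun n => p`_n).

Lemma fpspM p q : fpsp (p * q) = fpsp p * fpsp q.
Proof. by apply: fpsP => n; rewrite fcM /= coefM. Qed.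
Lemma fpspD p q : fpsp (p + q) = fpsp p + fpsp q.
Proof. by apply: fpsP => n; rewrite fcD /= coefD. Qed.
Lemma fpspN p : fpsp (- p) = - fpsp p.
Proof. by apply: fpsP => n; rewrite fcN /= coefN. Qed.
Lemma fpspB p q : fpsp (p - q) = fpsp p - fpsp q.
Proof. by rewrite fpspD fpspN. Qed.
Lemma fpsp1 : fpsp 1 = 1.
Proof. by apply: fpsP => n; rewrite fc1 /= coef1. Qed.
Lemma fpsp_sum (I : Type) (s : seq I) (F : I -> {poly A}) :
  fpsp (\sum_(i <- s) F i) = \sum_(i <- s) fpsp (F i).
Proof.
elim/big_ind2: _ => // [|p f q g <- <-]; last by rewrite fpspD.
by apply: fpsP => n /=; rewrite coef0.
Qed.

Lemma fc_sum (I : Type) (s : seq I) (F : I -> fps A) n :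
  fc (\sum_(i <- s) F i) n = \sum_(i <- s) fc (F i) n.
Proof. by elim/big_ind2: _ => // p f q g <- <-. Qed.

(* the Euler operator s d/ds *)
Definition theta f : fps A := Fps (fun n => fc f n *+ n).

Lemma thetaD f g : theta (f + g) = theta f + theta g.
Proof. by apply: fpsP => n /=; rewrite mulrnDl. Qed.
Lemma thetaN f : theta (- f) = - theta f.
Proof. by apply: fpsP => n /=; rewrite mulNrn. Qed.
Lemma thetaM f g : theta (f * g) = theta f * g + f * theta g.
Proof.
apply: fpsP => n; rewrite fcD !fcM /= -big_split/= -sumrMnl.
apply: eq_bigr => -[i /= iN] _; rewrite mulrnAl mulrnAr -mulrnDr subnKC//.
Qed.
Lemma thetaC c : theta (fpsC c) = 0.
Proof. by apply: fpsP => -[|n] /=; rewrite ?mulr0n// mul0rn. Qed.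
Lemma theta1 : theta 1 = 0.
Proof. by apply: fpsP => -[|n] /=; rewrite ?mulr0n// mul0rn. Qed.

Definition dmap (d : A -> A) f : fps A := Fps (fun n => d (fc f n)).

Lemma dmapM (d : A -> A) f g : {morph d : x y / x + y} -> d 0 = 0 ->
  (forall x y, d (x * y) = d x * y + x * d y) ->
  dmap d (f * g) = dmap d f * g + f * dmap d g.
Proof.
move=> dD d0 dM; apply: fpsP => n; rewrite fcD /= -big_split/=.
by rewrite (big_morph d dD d0); apply: eq_bigr => i _; rewrite dM.
Qed.

Lemma dmap_theta (d : A -> A) f : {morph d : x y / x + y} -> d 0 = 0 ->
  dmap d (theta f) = theta (dmap d f).
Proof.
move=> dD d0; apply: fpsP => n /=; elim: n (fc f n) => [|n IH] x.
  by rewrite !mulr0n.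
by rewrite !mulrS dD IH.
Qed.

End FpsRing.

Section FpsMap.
Variables (A B : comNzRingType) (phi : {rmorphism A -> B}).
Definition fmap (f : fps A) : fps B := Fps (fun n => phi (fc f n)).

Lemma fmapM f g : fmap (f * g) = fmap f * fmap g.
Proof.
by apply: fpsP => n /=; rewrite rmorph_sum; apply: eq_bigr => i _; rewrite rmorphM.
Qed.
Lemma fmapN f : fmap (- f) = - fmap f.
Proof. by apply: fpsP => n /=; rewrite rmorphN. Qed.
Lemma fmap_theta f : fmap (theta f) = theta (fmap f).
Proof. by apply: fpsP => n /=; rewrite rmorphMn. Qed.
Lemma fmapC c : fmap (fpsC c) = fpsC (phi c).
Proof. by apply: fpsP => -[|n] //=; rewrite rmorph0. Qed.
End FpsMap.

(** * Negative powers of a series, through their Euler equation *)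

Section FpsPow.
Variable A : comUnitRingType.
Hypothesis unitn : forall n, (n.+1%:R : A) \is a GRing.unit.
Implicit Types (P Z D : fps A) (m : A).

(* [Z] is the power [P ^ (- m)], characterized by its Euler equation. *)
Definition isPow m P Z := fc Z 0 = 1 /\ P * theta Z = - (fpsC m * theta P * Z).

(** Since [theta P] has no constant term and [P] has constant term 1, coefficient [n + 1] of the
    equation reads [(n + 1) D_(n+1) = 0] once the earlier coefficients vanish. *)
Lemma pow_linear_unique m P D : fc P 0 = 1 -> fc D 0 = 0 ->
  P * theta D + fpsC m * theta P * D = 0 -> D = 0.
Proof.
move=> P0 D0 H; apply: fpsP => n; rewrite fc0.
elim/ltn_ind: n => -[//|n] IH.
have := congr1 (fc^~ n.+1) H; rewrite fcD -mulrA fcCM !fcM /=.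
rewrite big_ord_recl/= subn0 P0 mul1r big1 ?addr0; last first.
  by move=> i _; rewrite IH ?mul0rn ?mulr0// subSS ltnS leq_subr.
rewrite big_ord_recl/= mulr0n mul0r add0r big1 ?mulr0 ?addr0; last first.
  by move=> i _; rewrite IH ?mulr0// subSS ltnS leq_subr.
move=> E; have := congr1 (fun x => n.+1%:R^-1 * x) E.
by rewrite /= mulr0 -[fc D _ *+ _]mulr_natl mulKr.
Qed.

(** The Euler equation solved for its highest coefficient. All earlier coefficients are needed at
    each step, so the recursion carries their list. *)
Fixpoint pow_seq m P (n : nat) : seq A :=
  match n with
  | 0 => [:: 1]
  | n.+1 => rcons (pow_seq m P n)
      (- (n.+1%:R^-1 * \sum_(i < n.+1)
          fc P i.+1 * ((n - i)%:R + m * i.+1%:R) * nth 0 (pow_seq m P n) (n - i)))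
  end.

Definition fpow m P : fps A := Fps (fun n => nth 0 (pow_seq m P n) n).

Let size_pow_seq m P n : size (pow_seq m P n) = n.+1.
Proof. by elim: n => //= n IH; rewrite size_rcons IH. Qed.

Let nth_pow_seq m P n i : (i <= n)%N -> nth 0 (pow_seq m P n) i = fc (fpow m P) i.
Proof.
elim: n => [|n IH]; first by rewrite leqn0 => /eqP ->.
rewrite leq_eqVlt => /predU1P[-> //|]; rewrite ltnS => iN.
by rewrite /= nth_rcons size_pow_seq ltnS iN IH.
Qed.

Lemma fpow_rec m P n : n.+1%:R * fc (fpow m P) n.+1 =
  - \sum_(i < n.+1) fc P i.+1 * ((n - i)%:R + m * i.+1%:R) * fc (fpow m P) (n - i)%N.
Proof.
rewrite {1}/fpow /= nth_rcons size_pow_seq ltnn eqxx mulrN mulVKr//.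
by congr (- _); apply: eq_bigr => i _; rewrite nth_pow_seq// leq_subr.
Qed.

Lemma fpowP m P : fc P 0 = 1 -> isPow m P (fpow m P).
Proof.
move=> P0; split=> //; have := fpow_rec m P; move: (fpow m P) => Z HZ.
apply: fpsP => -[|n].
  rewrite fcN -mulrA fcCM !fcM !big_ord1 /= P0 mulr0n mul1r.
  by rewrite mul0r mulr0 oppr0.
rewrite fcN -mulrA fcCM !fcM /=.
rewrite big_ord_recl/= subn0 P0 mul1r -[fc Z _ *+ _]mulr_natl HZ.
rewrite [X in _ = - (_ * X)]big_ord_recl/= mulr0n mul0r add0r.
set S1 := (X in - X + _ = _); set S2 := (X in _ + X = _).
set S3 := (X in _ = - (_ * X)).
suff -> : S1 = S2 + m * S3 by ring.
rewrite /S3 mulr_sumr -big_split/=; apply: eq_bigr => i _.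
rewrite /bump/= add1n subSS -[fc Z _ *+ _]mulr_natl -[fc P _ *+ _]mulr_natl.
ring.
Qed.

Lemma pow_unique m P Z Z' : fc P 0 = 1 -> isPow m P Z -> isPow m P Z' -> Z = Z'.
Proof.
move=> P0 [Z0 HZ] [Z0' HZ']; apply/eqP; rewrite -subr_eq0; apply/eqP.
apply: (@pow_linear_unique m P) => //; first by rewrite fcD fcN Z0 Z0' subrr.
rewrite thetaD thetaN mulrDr mulrN HZ HZ'; ring.
Qed.

Let fpsCD1 m : fpsC (m + 1) = fpsC m + 1 :> fps A.
Proof. by apply: fpsP => -[|n]; rewrite fcD/= ?addr0. Qed.

Section PowLaws.
Variables (P : fps A) (P0 : fc P 0 = 1).

(** The product satisfies the Euler equation of exponent [- m], and such a solution is unique. *)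
Lemma pow_mulP m : P * fpow (m + 1) P = fpow m P.
Proof.
apply: (@pow_unique m P) => //; last exact: fpowP.
have [Z0 H] := fpowP (m + 1) P0; split.
  by rewrite fcM big_ord1 /= P0 mul1r.
rewrite thetaM [P * theta _]H; move: (theta P) (fpow _ _) => t Z.
rewrite fpsCD1.
ring.
Qed.

Lemma pow_theta m : theta (fpow m P) = - (fpsC m * theta P * fpow (m + 1) P).
Proof.
have [Z0 H] := fpowP (m + 1) P0.
rewrite -pow_mulP thetaM H.
rewrite fpsCD1.
ring.
Qed.

(** Applying [d] to the Euler equation shows that the difference of the two sides solves the
    homogeneous equation. Its constant term is 0 because [d 1 = 0], so it vanishes by
    [pow_linear_unique]. *)
Lemma pow_deriv (d : A -> A) m : {morph d : x y / x + y} ->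
  (forall x y, d (x * y) = d x * y + x * d y) -> d m = 0 ->
  dmap d (fpow m P) = - (fpsC m * dmap d P * fpow (m + 1) P).
Proof.
move=> dD dM dm.
have d0 : d 0 = 0 by apply: (@addrI _ (d 0)); rewrite -dD !addr0.
have d1 : d 1 = 0.
  by have := dM 1 1; rewrite !mulr1 mul1r => E; apply: (@addrI _ (d 1)); rewrite -E addr0.
have dN x : d (- x) = - d x.
  by apply/eqP; rewrite -addr_eq0 -dD addNr d0.
have [Z0 H] := fpowP m P0.
have [Z0' H'] := fpowP (m + 1) P0.
apply/eqP; rewrite -subr_eq0 opprK; apply/eqP.
apply: (@pow_linear_unique m P) => //.
  by rewrite fcD -mulrA fcCM fcM big_ord1 /= P0 d1 mul0r mulr0 addr0.
have E : dmap d P * theta (fpow m P) + P * theta (dmap d (fpow m P)) =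
   - (fpsC m * theta (dmap d P) * fpow m P + fpsC m * theta P * dmap d (fpow m P)).
  rewrite -dmap_theta// -dmapM// H.
  have -> : dmap d (- (fpsC m * theta P * fpow m P)) = - dmap d (fpsC m * theta P * fpow m P).
    by apply: fpsP => n /=; rewrite dN.
  rewrite !dmapM// dmap_theta//.
  have -> : dmap d (fpsC m) = 0 by apply: fpsP => -[|n] /=.
  by rewrite mul0r add0r.
have {}E : P * theta (dmap d (fpow m P)) + fpsC m * theta P * dmap d (fpow m P)
   = - (fpsC m * theta (dmap d P) * fpow m P) - dmap d P * theta (fpow m P).
  by apply/eqP; rewrite -subr_eq0; move/eqP: E; rewrite -subr_eq0 => /eqP E;
     apply/eqP; rewrite -[RHS]E; ring.
rewrite thetaD mulrDr mulrDr addrACA E thetaM (thetaM (fpsC m)) thetaC mul0r add0r.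
rewrite pow_theta -(pow_mulP m).
have -> : P * (fpsC m * theta (dmap d P) * fpow (m + 1) P +
   fpsC m * dmap d P * theta (fpow (m + 1) P)) =
   P * (fpsC m * theta (dmap d P) * fpow (m + 1) P) +
   fpsC m * dmap d P * (P * theta (fpow (m + 1) P)) by ring.
rewrite H'.
rewrite fpsCD1.
ring.
Qed.
End PowLaws.

Lemma isPowM m P Q Z Y : isPow m P Z -> isPow m Q Y -> isPow m (P * Q) (Z * Y).
Proof.
move=> [Z0 HZ] [Y0 HY]; split; first by rewrite fcM big_ord1 /= Z0 Y0 mulr1.
rewrite !thetaM.
have -> : P * Q * (theta Z * Y + Z * theta Y) = P * theta Z * Q * Y + Q * theta Y * P * Z by ring.
by rewrite HZ HY; ring.
Qed.

End FpsPow.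

(** * The product of the factors 1 - s cos (th + 2 l pi / k) *)

Section TrigProduct.
Variable R : realType.
Local Open Scope complex_scope.
Notation C := (R[i]).

Let cis (t : R) : C := cos t +i* sin t.

Let cisD s t : cis (s + t) = cis s * cis t.
Proof. by rewrite /cis cosD sinD; apply/eqP; rewrite eq_complex /= addrC eqxx /=; apply/eqP; ring. Qed.

Let cis0 : cis 0 = 1. Proof. by rewrite /cis cos0 sin0. Qed.

Let cisX t n : cis t ^+ n = cis (n%:R * t).
Proof.
elim: n => [|n IH]; first by rewrite expr0 mulr0n mul0r cis0.
by rewrite exprSr IH -cisD -(natr1 n) mulrDl mul1r.
Qed.

Let cisN t : cis t * cis (- t) = 1. Proof. by rewrite -cisD subrr cis0. Qed.

Let cis_neq0 t : cis t != 0.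
Proof. by apply/eqP => E; have := cisN t; rewrite E mul0r => /eqP; rewrite eq_sym oner_eq0. Qed.

Let cisDN t : cis t + cis (- t) = (2 * cos t)%:C.
Proof.
rewrite /cis cosN sinN; apply/eqP; rewrite eq_complex/= subrr eqxx andbT.
by apply/eqP; ring.
Qed.

(** If the order [m] were smaller than [k], then [cos (2 t) = 1] with [t = m pi / k] strictly
    between 0 and pi, which forces [sin t = 0]. *)
Let prim_cis k : (0 < k)%N -> k.-primitive_root (cis (2 * pi / k%:R)).
Proof.
move=> k0; have kR : 0 < k%:R :> R by rewrite ltr0n.
have c1 : cis (2 * pi / k%:R) ^+ k = 1.
  rewrite cisX mulrCA divff ?gt_eqF// mulr1 mulr_natl.
  by rewrite /cis cos2pi sin2pi.
have [m pm mk] := prim_order_exists k0 c1.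
have m0 := prim_order_gt0 pm.
suff E : m = k by rewrite -{1}E.
apply/eqP; rewrite eqn_leq (dvdn_leq k0 mk) /= leqNgt; apply/negP => lmk.
have := prim_expr_order pm; rewrite cisX => /eqP; rewrite eq_complex/= => /andP[/eqP + _].
pose t : R := m%:R * pi / k%:R.
rewrite (_ : m%:R * _ = t *+ 2); last by rewrite /t -mulr_natl; ring.
rewrite cos_mulr2n -(cos2Dsin2 t) => /eqP.
rewrite -subr_eq0 (_ : _ - _ = - 2 * sin t ^+ 2); last by rewrite cos2sin2 -mulr_natl; ring.
rewrite mulf_eq0 oppr_eq0 pnatr_eq0/= sqrf_eq0 => /eqP s0.
have : 0 < sin t.
  apply: sin_gt0_pi; rewrite /t divr_gt0 ?mulr_gt0 ?pi_gt0 ?ltr0n//=.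
  by rewrite ltr_pdivrMr// mulrC ltr_pM2l ?pi_gt0// ltr_nat.
by rewrite s0 ltxx.
Qed.

Let expr_prod (S : comNzRingType) (c : S) k : c ^+ k = \prod_(l < k) c.
Proof. by rewrite prodr_const card_ord. Qed.

Let prod_cis k (x y : C) (w : C) : (0 < k)%N -> k.-primitive_root w -> x != 0 ->
  \prod_(l < k) (y - x * w ^+ l) = y ^+ k - x ^+ k.
Proof.
move=> k0 pw x0; have := congr1 (horner^~ (y / x)) (factor_Xn_sub_1 pw).
rewrite /= !hornerE horner_prod big_mkord => H.
transitivity (x ^+ k * \prod_(l < k) (y / x - w ^+ l)).
  rewrite (expr_prod x) -big_split/=; apply: eq_bigr => l _.
  by rewrite mulrBr mulrCA divff// mulr1.
rewrite (eq_bigr (fun i : 'I_k => ('X - (w ^+ i)%:P).[y / x])) ?H; last first.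
  by move=> i _; rewrite hornerXsubC.
by rewrite mulrBr mulr1 exprMn exprVn mulrCA divff ?mulr1// expf_neq0.
Qed.

Definition angle k (th : R) (l : nat) : R := th + 2 * l%:R * pi / k%:R.

(** Write [2 X = y + 1 / y] with [y] complex. Each factor then splits as
    [(y - e^(i t)) (y - e^(- i t)) / y] up to a factor 2, and the roots of unity collapse the
    product to [y^k + y^(-k) - 2 cos (k th)]. Comparison with [th = 0] eliminates [y]. *)
Lemma prod_sub_cos k (X th : R) : (0 < k)%N ->
  \prod_(l < k) (X - cos (angle k th l)) =
  \prod_(l < k) (X - cos (angle k 0 l)) + 2^-1 ^+ k.-1 * (1 - cos (k%:R * th)).
Proof.
move=> k0.
pose y : C := X%:C + sqrtC ((X ^+ 2 - 1)%:C).
pose y' : C := X%:C - sqrtC ((X ^+ 2 - 1)%:C).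
have yy' : y * y' = 1.
  rewrite /y /y' mulrC -subr_sqr sqrtCK -rmorphXn -rmorphB/=.
  by rewrite (_ : _ - _ = 1 :> R)//; ring.
have yD : y + y' = (2 * X)%:C.
  by rewrite /y /y' addrACA subrr addr0 -rmorphD/=; congr (_ %:C); ring.
have y0 : y != 0 by apply/eqP => E; move: yy'; rewrite E mul0r => /eqP; rewrite eq_sym oner_eq0.
have y'E : y' = y^-1 by rewrite -[LHS](mulKf y0) yy' mulr1.
have key t : ((2 ^+ k * \prod_(l < k) (X - cos (angle k t l)))%:C : C) =
    y ^+ k + y' ^+ k - (2 * cos (k%:R * t))%:C.
  transitivity (\prod_(l < k) (y - cis (angle k t l)) *
                \prod_(l < k) (y - cis (- angle k t l)) * y' ^+ k).
    rewrite (expr_prod y') (expr_prod 2) -!big_split/= rmorph_prod.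
    apply: eq_bigr => l _.
    transitivity (y * y' * y - (cis (angle k t l) + cis (- angle k t l)) * (y * y')
                  + (cis (angle k t l) * cis (- angle k t l)) * y'); last by ring.
    rewrite yy' cisN cisDN !mul1r mulr1 addrAC yD -rmorphB/=; congr (_ %:C); ring.
  have -> : \prod_(l < k) (y - cis (angle k t l)) = y ^+ k - cis (k%:R * t).
    rewrite -cisX -(prod_cis y k0 (prim_cis k0) (cis_neq0 t)).
    apply: eq_bigr => l _; rewrite cisX -cisD /angle; congr (_ - cis _).
    by ring.
  have -> : \prod_(l < k) (y - cis (- angle k t l)) = y ^+ k - cis (- (k%:R * t)).
    rewrite -mulrN -cisX.
    have pw : k.-primitive_root (cis (- (2 * pi / k%:R))).
      have -> : cis (- (2 * pi / k%:R)) = conjc (cis (2 * pi / k%:R)).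
        by rewrite /cis cosN sinN.
      by rewrite (fmorph_primitive_root (@conjc R)) prim_cis.
    rewrite -(prod_cis y k0 pw (cis_neq0 _)).
    by apply: eq_bigr => l _; rewrite cisX -cisD /angle; congr (_ - cis _); ring.
  rewrite -cisDN.
  transitivity ((y * y') ^+ k * y ^+ k
    - (cis (k%:R * t) + cis (- (k%:R * t))) * (y * y') ^+ k
    + cis (k%:R * t) * cis (- (k%:R * t)) * y' ^+ k).
    by rewrite exprMn; ring.
  by rewrite yy' expr1n cisN !mul1r mulr1; ring.
have E := key th; have E0 := key 0.
have : ((2 ^+ k * \prod_(l < k) (X - cos (angle k th l)))%:C : C) =
   (2 ^+ k * \prod_(l < k) (X - cos (angle k 0 l)) + 2 * (1 - cos (k%:R * th)))%:C.
  rewrite rmorphD/= E E0 mulr0 cos0 mulr1 mulrBr mulr1 rmorphB/=; ring.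
move=> /complexI H.
have k2 : 2 ^+ k != 0 :> R by rewrite expf_neq0.
apply: (mulfI k2); rewrite /= H [RHS]mulrDr; congr (_ + _); rewrite mulrA; congr (_ * _).
by rewrite -{1}(prednK k0) exprSr mulrAC -exprMn divff// expr1n mul1r.
Qed.

End TrigProduct.

Section ChebPoly.
Variable R : realType.
Implicit Types (k : nat) (th : R).

Lemma poly_eq_away0 (p q : {poly R}) : (forall s, s != 0 -> p.[s] = q.[s]) -> p = q.
Proof.
move=> H; apply/eqP; rewrite -subr_eq0; apply/negPn/negP => nz.
pose rs : seq R := [seq i.+1%:R | i <- iota 0 (size (p - q))].
have : (size rs < size (p - q)%R)%N.
  apply: max_poly_roots => //.
    apply/allP => _ /mapP[i _ ->]; rewrite /root hornerD hornerN.
    by rewrite H ?subrr ?pnatr_eq0.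
  rewrite map_inj_uniq ?iota_uniq// => i j /eqP.
  by rewrite eqr_nat eqSS => /eqP.
by rewrite size_map size_iota ltnn.
Qed.

Definition cpoly k th : {poly R} := \prod_(l < k) (1 - cos (angle k th l) *: 'X).

Definition ctau k : R := 2^-1 ^+ k.-1.
(** The part of [cpoly k th] independent of [th], namely [2^(1-k) s^k T_k(1/s)] with [T_k] the
    Chebyshev polynomial: adding [ctau k *: 'X^k] cancels the term that [cos 0 = 1] contributes. *)
Definition cbase k : {poly R} := cpoly k 0 + ctau k *: 'X^k.

Lemma cpolyE k th : (0 < k)%N ->
  cpoly k th = cbase k - (ctau k * cos (k%:R * th)) *: 'X^k.
Proof.
move=> k0; apply: poly_eq_away0 => s s0.
have key t : (cpoly k t).[s] = s ^+ k * \prod_(l < k) (s^-1 - cos (angle k t l)).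
  rewrite /cpoly horner_prod.
  have -> : s ^+ k = \prod_(l < k) s by rewrite prodr_const card_ord.
  rewrite -big_split/=; apply: eq_bigr => l _.
  by rewrite !hornerE mulrBr divff// [s * cos _]mulrC.
rewrite /cbase !hornerE !key (prod_sub_cos _ th k0) /ctau.
by rewrite ?hornerXn; ring.
Qed.

Lemma cos_angle k th l : (0 < k)%N -> cos (k%:R * angle k th l) = cos (k%:R * th).
Proof.
move=> k0; rewrite /angle mulrDr.
have -> : k%:R * (2 * l%:R * pi / k%:R) = (pi *+ 2) *+ l :> R.
  by rewrite -mulr_natl -[pi *+ 2]mulr_natl; field; rewrite pnatr_eq0 -lt0n.
by rewrite (periodicn (@cosD2pi R)).
Qed.

Lemma cpoly_angle k th l : (0 < k)%N -> cpoly k (angle k th l) = cpoly k th.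
Proof. by move=> k0; rewrite !cpolyE// cos_angle. Qed.

Definition cpoly' k th : {poly R} := \prod_(l < k.-1) (1 - cos (angle k th l.+1) *: 'X).

Lemma cpoly'M k th : (0 < k)%N -> (1 - cos th *: 'X) * cpoly' k th = cpoly k th.
Proof.
case: k => // k _; rewrite /cpoly /cpoly' big_ord_recl/=; congr (_ * _).
by rewrite /angle mulr0 !mul0r addr0.
Qed.

(** The operator [n - X d/dX] acts on the product factor by factor, and [f - X f' = 1] for
    [f = 1 - c X]. *)
Lemma deriv_prod_lin (c : nat -> R) n :
  n%:R * (\prod_(l < n) (1 - c l *: 'X)) - 'X * (\prod_(l < n) (1 - c l *: 'X))^`() =
  \sum_(l < n) \prod_(m < n | m != l) (1 - c m *: 'X) :> {poly R}.
Proof.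
elim: n => [|n IH]; first by rewrite !big_ord0 mulr0n mul0r derivC mulr0 subrr.
rewrite big_ord_recr/= derivM [RHS]big_ord_recr/=.
have -> : \prod_(m < n.+1 | m != ord_max) (1 - c m *: 'X) = \prod_(m < n) (1 - c m *: 'X).
  rewrite big_mkcond big_ord_recr/= eqxx mulr1; apply: eq_bigr => i _.
  by rewrite -val_eqE/= neq_ltn ltn_ord.
have -> : \sum_(l < n) \prod_(m < n.+1 | m != widen_ord (leqnSn n) l) (1 - c m *: 'X) =
   (\sum_(l < n) \prod_(m < n | m != l) (1 - c m *: 'X)) * (1 - c n *: 'X).
  rewrite mulr_suml; apply: eq_bigr => l _.
  rewrite big_mkcond big_ord_recr/= -val_eqE/= neq_ltn ltn_ord orbT; congr (_ * _).
  by rewrite [RHS]big_mkcond.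
rewrite -IH derivB derivC derivZ derivX sub0r -natr1 -!mul_polyC; ring.
Qed.

Lemma sum_cpoly' k th : (0 < k)%N ->
  \sum_(l < k) cpoly' k (angle k th l) = k%:R * cpoly k th - 'X * (cpoly k th)^`().
Proof.
move=> k0; rewrite /cpoly (deriv_prod_lin (fun l => cos (angle k th l))).
apply: eq_bigr => l _.
have nz : 1 - cos (angle k th l) *: 'X != 0 :> {poly R}.
  apply/eqP => /(congr1 (horner^~ 0)) /= /eqP.
  by rewrite !(hornerE, mulr0, subr0) oner_eq0.
apply: (mulfI nz); rewrite cpoly'M// cpoly_angle// /cpoly.
by rewrite (bigD1 l).
Qed.

End ChebPoly.

(** * Taylor coefficients of the Dunkl kernel *)

Section Ell.
Variable R : realType.
Variables a b : R.
Hypotheses (a0 : 0 < a) (b0 : 0 < b).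
Local Notation A2 := {poly {poly R}}.
Local Notation LL := (mom2 a b).
Local Notation U := ('X%:P : A2).
Local Notation V := ('X : A2).

Definition comp2 (q : {poly R}) (x : A2) : A2 := (map_poly (fun c : R => c%:P%:P) q).[x].

Let iota2 : {rmorphism R -> A2} := GRing.RMorphism.clone _ _ (polyC \o polyC) _.

Let comp2E q x : comp2 q x = (map_poly iota2 q).[x]. Proof. by []. Qed.

Lemma comp2D p q x : comp2 (p + q) x = comp2 p x + comp2 q x.
Proof. by rewrite !comp2E rmorphD hornerD. Qed.
Lemma comp2N p x : comp2 (- p) x = - comp2 p x.
Proof. by rewrite !comp2E rmorphN hornerN. Qed.
Lemma comp2M p q x : comp2 (p * q) x = comp2 p x * comp2 q x.
Proof. by rewrite !comp2E rmorphM hornerM. Qed.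
Lemma comp2C c x : comp2 c%:P x = c%:P%:P.
Proof. by rewrite comp2E map_polyC hornerC. Qed.
Lemma comp2X x : comp2 'X x = x.
Proof. by rewrite comp2E map_polyX hornerX. Qed.
Lemma comp2Z c p x : comp2 (c *: p) x = c%:P%:P * comp2 p x.
Proof. by rewrite -mul_polyC comp2M comp2C. Qed.

Lemma comp2_deriv (d : A2 -> A2) q x : {morph d : p r / p + r} ->
  (forall p r, d (p * r) = d p * r + p * d r) -> (forall c : R, d c%:P%:P = 0) ->
  d (comp2 q x) = comp2 q^`() x * d x.
Proof.
move=> dD dM dC; elim/poly_ind: q => [|q c IH].
  by rewrite deriv0 comp2E rmorph0 horner0 mul0r -[0]/((0 : R)%:P%:P) dC.
rewrite derivD derivM derivX derivC addr0 mulr1.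
rewrite !comp2D !comp2M comp2C comp2X dD dM dC addr0 IH; ring.
Qed.

Lemma comp2_morph (f : {rmorphism A2 -> A2}) q x : (forall c : R, f c%:P%:P = c%:P%:P) ->
  f (comp2 q x) = comp2 q (f x).
Proof.
move=> fC; elim/poly_ind: q => [|q c IH]; first by rewrite !comp2E !rmorph0 !horner0 rmorph0.
by rewrite !comp2D !comp2M !comp2C !comp2X rmorphD rmorphM /= IH fC.
Qed.

Definition xip (cc ss : R) : A2 := cc%:P%:P * V + ss%:P%:P * U.

Lemma comp2_eval q cc ss u v :
  (comp2 q (xip cc ss)).[v%:P].[u] = q.[v * cc + u * ss].
Proof.
elim/poly_ind: q => [|q c IH]; first by rewrite comp2E rmorph0 !horner0.
rewrite comp2D comp2M comp2C comp2X /xip !hornerE IH.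
by rewrite ![_ * cc]mulrC ![_ * ss]mulrC.
Qed.

Let du : A2 -> A2 := map_poly deriv.

Let duM p q : du (p * q) = du p * q + p * du q.
Proof.
apply/polyP => i; rewrite coefD !coefM coef_map/= coefM raddf_sum -big_split/=.
by apply: eq_bigr => j _; rewrite !coef_map/= derivM.
Qed.

(** Changing the sign of [cc] or [ss] amounts to [v -> - v] or [u -> - u]. The values at
    [(+-cc, +-ss)], which the group elements produce, are therefore integrals of one polynomial
    against the four weights [(1 +- u) (1 +- v)]. *)
Definition ell (cc ss : R) (q : {poly R}) : R :=
  LL (comp2 q (xip cc ss) * ((1 + U) * (1 + V))).

Lemma ellD cc ss p q : ell cc ss (p + q) = ell cc ss p + ell cc ss q.
Proof. by rewrite /ell comp2D mulrDl raddfD. Qed.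
Lemma ellN cc ss p : ell cc ss (- p) = - ell cc ss p.
Proof. by rewrite /ell comp2N mulNr raddfN. Qed.
Lemma ellZ cc ss (c : R) p : ell cc ss (c *: p) = c * ell cc ss p.
Proof. by rewrite /ell comp2Z -mulrA mom2C. Qed.
Lemma ell0 cc ss : ell cc ss 0 = 0.
Proof. by rewrite -(scale0r 0) ellZ mul0r. Qed.
Lemma ell_sum cc ss (I : Type) (s : seq I) (F : I -> {poly R}) :
  ell cc ss (\sum_(i <- s) F i) = \sum_(i <- s) ell cc ss (F i).
Proof.
elim: s => [|i s IH]; first by rewrite !big_nil ell0.
by rewrite !big_cons ellD IH.
Qed.

Let su : {rmorphism A2 -> A2} := GRing.RMorphism.clone _ _ (map_poly (comp_poly (- 'X))) _.
Let sv : {rmorphism A2 -> A2} := GRing.RMorphism.clone _ _ (comp_poly (- 'X)) _.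

Let suE (p : A2) : su p = map_poly (comp_poly (- 'X)) p. Proof. by []. Qed.
Let svE (p : A2) : sv p = p \Po (- 'X). Proof. by []. Qed.

Let LLsu p : LL (su p) = LL p. Proof. by rewrite suE mom2_sym_u. Qed.
Let LLsv p : LL (sv p) = LL p. Proof. by rewrite svE mom2_sym_v. Qed.

Let suC (c : R) : su c%:P%:P = c%:P%:P.
Proof. by rewrite suE map_polyC/= comp_polyC. Qed.
Let svC (c : R) : sv c%:P%:P = c%:P%:P.
Proof. by rewrite svE comp_polyC. Qed.
Let suU : su U = - U. Proof. by rewrite suE map_polyC/= comp_polyX polyCN. Qed.
Let suV : su V = V. Proof. by rewrite suE map_polyX. Qed.
Let svU : sv U = U. Proof. by rewrite svE comp_polyC. Qed.
Let svV : sv V = - V. Proof. by rewrite svE comp_polyX. Qed.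

Let su_xip cc ss : su (xip cc ss) = xip cc (- ss).
Proof. by rewrite /xip rmorphD !rmorphM /= !suC suU suV !polyCN mulrN mulNr. Qed.
Let sv_xip cc ss : sv (xip cc ss) = xip (- cc) ss.
Proof. by rewrite /xip rmorphD !rmorphM /= !svC svU svV !polyCN mulrN mulNr. Qed.

Lemma ell_su cc ss q :
  ell cc (- ss) q = LL (comp2 q (xip cc ss) * ((1 - U) * (1 + V))).
Proof.
rewrite /ell -LLsu !rmorphM !rmorphD !rmorph1 suU suV.
by rewrite comp2_morph// su_xip opprK.
Qed.

Lemma ell_sv cc ss q :
  ell (- cc) ss q = LL (comp2 q (xip cc ss) * ((1 + U) * (1 - V))).
Proof.
rewrite /ell -LLsv !rmorphM !rmorphD !rmorph1 svU svV.
by rewrite comp2_morph// sv_xip opprK.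
Qed.

Lemma ell_suv cc ss q :
  ell (- cc) (- ss) q = LL (comp2 q (xip cc ss) * ((1 - U) * (1 - V))).
Proof.
rewrite ell_su -LLsv !rmorphM !rmorphD !rmorphN !rmorph1 svU svV.
by rewrite comp2_morph// sv_xip opprK.
Qed.

(** Changing the signs of [u] and [v] together negates [xi]. Hence the double integral sees only the
    part of [q] even in [xi]. *)
Lemma LL_neg cc ss q : LL (comp2 (q \Po (- 'X)) (xip cc ss)) = LL (comp2 q (xip cc ss)).
Proof.
rewrite -[RHS]LLsu -LLsv !comp2_morph// su_xip sv_xip.
congr (mom2 a b _); elim/poly_ind: q => [|q c IH]; first by rewrite comp_poly0 !comp2E !rmorph0 !horner0.
rewrite comp_poly_MXaddC !comp2D !comp2M !comp2C comp2X comp2N comp2X IH; congr (_ * _ + _).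
by rewrite /xip !polyCN !mulNr opprD opprK.
Qed.

Lemma ell_total cc ss q :
  ell cc ss q + ell (- cc) (- ss) q + (ell cc (- ss) q + ell (- cc) ss q) =
  4 * LL (comp2 q (xip cc ss)).
Proof.
rewrite ell_suv ell_su (ell_sv cc ss) -!raddfD /= -mom2C; congr (mom2 a b _).
have -> : (4 : R)%:P%:P = 4 :> A2 by rewrite !(polyCMn, polyC1).
ring.
Qed.

(** With the weight, [cc + ss - xi] becomes [cc (1 - v^2) (1 + u) + ss (1 - u^2) (1 + v)], while
    [cc q'(xi)] and [ss q'(xi)] are the derivatives of [q(xi)] in [v] and [u]. Integration by parts
    leaves [2 b v (1 + u) + 2 a u (1 + v)], which is the combination of the weights on the right. *)
Lemma ell_parts cc ss q :
  ell cc ss (((cc + ss)%:P - 'X) * q^`()) =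
  (a + b) * ell cc ss q - (a * ell cc (- ss) q + b * ell (- cc) ss q).
Proof.
rewrite ell_su (ell_sv cc ss) /ell -!mom2C -!raddfD -raddfB /=.
set W := comp2 q (xip cc ss).
transitivity (LL (2%:P%:P * (b%:P%:P * (V * (W * (1 + U)))) +
                  2%:P%:P * (a%:P%:P * (U * (W * (1 + V)))))); last first.
  by congr (mom2 a b _); rewrite !polyCD; ring.
rewrite [RHS](raddfD (mom2 a b)) /= !mom2C [2 * (b * _)]mulrA [2 * (a * _)]mulrA -(mom2_parts_v _ b0) -(mom2_parts_u _ a0) -raddfD/=.
congr (mom2 a b _).
have dV : W^`() = comp2 q^`() (xip cc ss) * cc%:P%:P.
  rewrite /W (@comp2_deriv deriv)//; last 3 first.
  - by move=> p r; rewrite derivD.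
  - by move=> p r; rewrite derivM.
  - by move=> c; rewrite derivC.
  congr (_ * _); rewrite /xip derivD !derivM !derivC derivX !mul0r mulr0 mulr1.
  by rewrite !addr0 add0r.
have dU : du W = comp2 q^`() (xip cc ss) * ss%:P%:P.
  rewrite /W (@comp2_deriv du)//; last 2 first.
  - by move=> p r; rewrite /du raddfD.
  - by move=> c; rewrite /du map_polyC/= derivC.
  congr (_ * _); rewrite /xip {1}/du raddfD /= -/du -!/(du _) !duM.
  rewrite /du !map_polyC/= !derivC derivX.
  have -> : map_poly deriv V = 0.
    by apply/polyP => i; rewrite coef_map/= coefX coef0; case: (i == 1%N); rewrite derivC.
  by rewrite !mul0r mulr0 !add0r mulr1.
rewrite -/du duM dU.
have -> : du (1 + V) = 0.
  apply/polyP => i; rewrite coef_map/= coefD coef1 coefX coef0 derivD.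
  by case: (i == 0%N); case: (i == 1%N); rewrite !derivC addr0.
rewrite mulr0 addr0 derivM dV derivD !derivC addr0 mulr0 addr0.
rewrite comp2M comp2D comp2N comp2C comp2X /xip.
rewrite !(polyCD, polyCN, polyC_exp, polyC1); ring.
Qed.

Lemma ell1 cc ss : ell cc ss 1 = 1.
Proof.
rewrite /ell comp2E rmorph1 hornerC mul1r /mom2.
have -> : map_poly (momL (nmom a)) ((1 + U) * (1 + V)) = 1 + 'X.
  have -> : (1 + U) * (1 + V) = (1 + 'X)%:P * (1 + V) by rewrite polyCD polyC1.
  apply/polyP => i; rewrite coef_map/= coefCM coefD coef1 coefX coefD coef1 coefX.
  have H : momL (nmom a) (1 + 'X) = 1.
    by rewrite raddfD/= -{1}['X]expr1 -{1}[1](expr0 'X) !momLXn nmom0// nmom_odd// addr0.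
  case: i => [|[|i]] /=; rewrite ?addr0 ?add0r ?mulr1 ?mulr0 ?H ?raddf0//.
by rewrite raddfD/= -{1}['X]expr1 -{1}[1](expr0 'X) !momLXn nmom0// nmom_odd// addr0.
Qed.

End Ell.

(** * Generating series of the kernel coefficients and their recurrence *)

Section KernelCoefs.
Variable R : realType.
Variables (k : nat) (a b : R).
Hypotheses (k0 : (0 < k)%N) (a0 : 0 < a) (b0 : 0 < b).
Let lam := a + b.
Let gam := k%:R * lam.
Let lam0 : 0 < lam. Proof. exact: addr_gt0. Qed.
Let gam0 : 0 < gam. Proof. by rewrite mulr_gt0// ltr0n. Qed.

Lemma unit_natpoly n : (n.+1%:R : {poly R}) \is a GRing.unit.
Proof.
have -> : n.+1%:R = (n.+1%:R : R)%:P by rewrite polyCMn polyC1.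
by rewrite poly_unitE size_polyC coefC/= unitfE pnatr_eq0.
Qed.

(* [cbase k - tau xi s^k] as a series in s whose coefficients are polynomials in xi *)
Definition gpoly : fps {poly R} :=
  Fps (fun n => ((cbase R k)`_n)%:P - (if n == k then ctau R k *: 'X else 0)).

Let cbase0 : (cbase R k)`_0 = 1.
Proof.
rewrite -horner_coef0 /cbase /cpoly !hornerE horner_prod expr0n (gtn_eqF k0) mulr0 addr0.
by rewrite big1// => i _; rewrite !(hornerE, mulr0, subr0).
Qed.

Lemma gpoly0 : fc gpoly 0 = 1.
Proof.
by rewrite /= cbase0 eq_sym (gtn_eqF k0) subr0.
Qed.

Definition zeta (m : R) : fps {poly R} := fpow m%:P gpoly.

Lemma zetaS m : gpoly * zeta (m + 1) = zeta m.
Proof. by rewrite /zeta polyCD polyC1 pow_mulP// ?gpoly0//; exact: unit_natpoly. Qed.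

Lemma zeta_theta m : theta (zeta m) = - (fpsC m%:P * theta gpoly * zeta (m + 1)).
Proof. by rewrite /zeta polyCD polyC1 pow_theta// ?gpoly0//; exact: unit_natpoly. Qed.

Lemma zeta_deriv m : dmap deriv (zeta m) = - (fpsC m%:P * dmap deriv gpoly * zeta (m + 1)).
Proof.
rewrite /zeta polyCD polyC1 pow_deriv// ?gpoly0//.
- exact: unit_natpoly.
- by move=> p q; rewrite derivD.
- by move=> p q; rewrite derivM.
- by rewrite derivC.
Qed.

Lemma zeta_eval m th :
  isPow m (fpsp (cpoly k th)) (fmap (horner_eval (cos (k%:R * th))) (zeta m)).
Proof.
have [Z0 HZ] := fpowP unit_natpoly m%:P gpoly0.
have E : fmap (horner_eval (cos (k%:R * th))) gpoly = fpsp (cpoly k th).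
  apply: fpsP => n /=; rewrite cpolyE// coefB coefZ coefXn /horner_eval !hornerE.
  by case: eqP => _; rewrite !hornerE ?mulr1 ?mulr0.
split; first by rewrite /= /horner_eval hornerC.
have := congr1 (fmap (horner_eval (cos (k%:R * th)))) HZ.
rewrite fmapN !fmapM !fmap_theta fmapC E => ->.
by rewrite /= /horner_eval hornerC.
Qed.

Definition serM (cc ss : R) : fps R := Fps (fun n => ell a b cc ss (fc (zeta (lam + 1)) n)).

Let polyM_ser (p : {poly R}) cc ss n :
  fc (fpsp p * serM cc ss) n =
  ell a b cc ss (fc (fpsp (map_poly polyC p) * zeta (lam + 1)) n).
Proof.
rewrite !fcM ell_sum; apply: eq_bigr => i _ /=.
by rewrite coef_map mul_polyC ellZ.
Qed.

(** The product at the actual angle is [gpoly] corrected by [cc + ss - xi] times its derivative in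
    [xi]. The main part lowers [lam + 1] to [lam]; the correction is a derivative of [zeta lam], to
    which [ell_parts] applies, leaving only the reflected terms. *)
Lemma cpoly_ser th cc ss n : cos (k%:R * th) = cc + ss ->
  lam * fc (fpsp (cpoly k th) * serM cc ss) n =
  a * ell a b cc (- ss) (fc (zeta lam) n) + b * ell a b (- cc) ss (fc (zeta lam) n).
Proof.
move=> hC; rewrite polyM_ser -ellZ.
have -> : fpsp (map_poly polyC (cpoly k th)) =
    gpoly + fpsC ((cc + ss)%:P - 'X) * dmap deriv gpoly.
  apply: fpsP => i; rewrite fcD fcCM /= coef_map/= cpolyE// hC coefB coefZ coefXn.
  rewrite derivB derivC sub0r.
  case: eqP => _; last by rewrite /= mulr0 deriv0 !subr0 oppr0 mulr0 addr0.
  by rewrite derivZ derivX -!mul_polyC polyCB polyCD !polyCM !polyCD polyC1; ring.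
rewrite mulrDl zetaS fcD scalerDr.
have -> : lam *: fc (fpsC ((cc + ss)%:P - 'X) * dmap deriv gpoly * zeta (lam + 1)) n =
   - (((cc + ss)%:P - 'X) * (fc (zeta lam) n)^`()).
  rewrite -[_^`()]/(fc (dmap deriv (zeta lam)) n) zeta_deriv -!mulrA !fcCM fcN fcCM.
  rewrite -mul_polyC; move: (fc _ n) (_ - 'X) lam%:P => x y z; ring.
rewrite ellD ellZ ellN ell_parts// -/lam; ring.
Qed.

(** In [k P - s P'] the [s^k] terms cancel, so this series does not depend on [th] and may be
    computed with [gpoly] inside the integral. There it acts on the power as [k + theta / lam]. *)
Lemma euler_ser th cc ss n :
  lam * fc (fpsp (k%:R * cpoly k th - 'X * (cpoly k th)^`()) * serM cc ss) n =
  (gam + n%:R) * ell a b cc ss (fc (zeta lam) n).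
Proof.
rewrite polyM_ser -!ellZ; congr (ell a b cc ss _).
have -> : fpsp (map_poly polyC (k%:R * cpoly k th - 'X * (cpoly k th)^`())) =
    fpsC k%:R * gpoly - theta gpoly.
  apply: fpsP => i; rewrite fcD fcN fcCM /= coef_map/= coefB mulr_natl coefMn.
  have -> : ('X * (cpoly k th)^`())`_i = (cpoly k th)`_i *+ i.
    by rewrite coefXM coef_deriv; case: i => // i; rewrite mulr0n.
  rewrite mulr_natl polyCB !polyCMn cpolyE// coefB coefZ coefXn.
  case: eqP => [->|_]; first by rewrite !subrr.
  by rewrite mulr0 !subr0.
rewrite mulrBl -mulrA zetaS fcD fcN fcCM scalerBr.
have H : fc (theta (zeta lam)) n = - (lam *: fc (theta gpoly * zeta (lam + 1)) n).
  by rewrite zeta_theta fcN -mulrA fcCM mul_polyC.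
rewrite -H [fc (theta _) n]/(fc (zeta lam) n *+ n) scalerDl scaler_nat; congr (_ + _).
by rewrite mulr_natl -scaler_nat scalerA mulrC.
Qed.

Let fcXM (c : R) f n : fc (fpsp (c *: 'X) * f) n.+1 = c * fc f n.
Proof.
rewrite fcM (bigD1 (lift ord0 ord0))//= big1 ?addr0.
  by rewrite coefZ coefX/= mulr1 subSS subn0.
move=> i i1; rewrite coefZ coefX; case: eqP => [E|_]; last by rewrite mulr0 mul0r.
by move: i1; rewrite -val_eqE/= E.
Qed.

Definition serY (A B : R) : fps R :=
  fpsp (cpoly' k (A - B)) *
  serM (cos (k%:R * A) * cos (k%:R * B)) (sin (k%:R * A) * sin (k%:R * B)).

Lemma serY_rec A B n :
  lam * (fc (serY A B) n.+1 - cos (A - B) * fc (serY A B) n) =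
  a * ell a b (cos (k%:R * A) * cos (k%:R * B)) (- (sin (k%:R * A) * sin (k%:R * B)))
       (fc (zeta lam) n.+1) +
  b * ell a b (- (cos (k%:R * A) * cos (k%:R * B))) (sin (k%:R * A) * sin (k%:R * B))
       (fc (zeta lam) n.+1).
Proof.
rewrite -(@cpoly_ser (A - B)); last by rewrite mulrBr cosB.
rewrite -cpoly'M// fpspM -mulrA -/(serY A B); congr (_ * _).
rewrite fpspB fpsp1 mulrBl mul1r fcD fcN; congr (_ - _).
by rewrite fcXM.
Qed.

Lemma serY0 A B : fc (serY A B) 0 = 1.
Proof.
rewrite fcM big_ord1 /= -horner_coef0 /cpoly' horner_prod big1 ?mul1r; last first.
  by move=> i _; rewrite !(hornerE, mulr0, subr0).
by rewrite ell1.
Qed.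

Let kpik : k%:R * (pi / k%:R) = pi :> R.
Proof. by rewrite mulrCA divff ?mulr1// pnatr_eq0 -lt0n. Qed.

Lemma serY_class A B n :
  lam * (\sum_(l < k) fc (serY (angle k A l) B) n) =
  (gam + n%:R) * ell a b (cos (k%:R * A) * cos (k%:R * B)) (sin (k%:R * A) * sin (k%:R * B))
       (fc (zeta lam) n).
Proof.
rewrite -(euler_ser (A - B)) -sum_cpoly'// fpsp_sum mulr_suml fc_sum.
congr (_ * _); apply: eq_bigr => l _.
rewrite /serY (cos_angle A l k0).
have -> : sin (k%:R * angle k A l) = sin (k%:R * A).
  rewrite /angle mulrDr.
  have -> : k%:R * (2 * l%:R * pi / k%:R) = (pi *+ 2) *+ l :> R.
    by rewrite -mulr_natl -[pi *+ 2]mulr_natl; field; rewrite pnatr_eq0 -lt0n.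
  by rewrite (periodicn (@sinD2pi R)).
by rewrite (_ : angle k A l - B = angle k (A - B) l)// /angle addrAC.
Qed.

Lemma cpoly'N (th : R) : cpoly' k (- th) = cpoly' k th.
Proof.
have nz : 1 - cos th *: 'X != 0 :> {poly R}.
  apply/eqP => /(congr1 (horner^~ 0)) /= /eqP.
  by rewrite !(hornerE, mulr0, subr0) oner_eq0.
apply: (mulfI nz); rewrite cpoly'M// -{1}(cosN th) cpoly'M// !cpolyE//.
by rewrite mulrN cosN.
Qed.

Lemma serYC A B : serY A B = serY B A.
Proof. by rewrite /serY -cpoly'N opprB [cos _ * _]mulrC [sin _ * _]mulrC. Qed.

Let sum_parity (F : nat -> R) n :
  \sum_(i < 2 * n) F i = \sum_(l < n) F l.*2 + \sum_(l < n) F l.*2.+1.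
Proof.
elim: n => [|n IH]; first by rewrite !big_ord0 addr0.
rewrite mulnS !addSn add0n !big_ord_recr/= IH mul2n -!addrA; congr (_ + _).
by rewrite addrCA.
Qed.

Definition pang (e : bool) (A : R) (i : nat) : R := (if e then - A else A) + i%:R * pi / k%:R.

Let pang_even e A l : pang e A l.*2 = angle k (if e then - A else A) l.
Proof. by rewrite /pang /angle -mul2n natrM. Qed.
Let pang_odd e A l : pang e A l.*2.+1 = angle k ((if e then - A else A) + pi / k%:R) l.
Proof. by rewrite /pang /angle -(natr1 l.*2) -mul2n natrM; ring. Qed.

(** An odd index adds pi to [k A] up to full turns and flips both [cc] and [ss]; a reflection flips
    [ss] alone. The indices of each parity form one class of rotated angles, summed by
    [serY_class]. *)
Lemma serY_orbit e A B (x y : R) n :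
  let s : R := if e then -1 else 1 in
  lam * (\sum_(i < 2 * k) (if odd i then y else x) * fc (serY (pang e A i) B) n) =
  (gam + n%:R) *
  (x * ell a b (cos (k%:R * A) * cos (k%:R * B)) (s * (sin (k%:R * A) * sin (k%:R * B)))
        (fc (zeta lam) n) +
   y * ell a b (- (cos (k%:R * A) * cos (k%:R * B))) (- s * (sin (k%:R * A) * sin (k%:R * B)))
        (fc (zeta lam) n)).
Proof.
move=> s.
rewrite (sum_parity (fun i => (if odd i then y else x) * fc (serY (pang e A i) B) n)).
under eq_bigr do rewrite odd_double pang_even.
under [X in _ + X]eq_bigr do rewrite /= odd_double pang_odd /=.
rewrite -!mulr_sumr mulrDr !(mulrCA lam) !serY_class.
rewrite [k%:R * (_ + pi / _)]mulrDr kpik sinDpi cosDpi /s.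
clear s; case: e; rewrite ?mulrN ?cosN ?sinN ?opprK ?mulN1r ?mulNr ?mul1r ?opprK; ring.
Qed.

Definition poch (s : R) (n : nat) : R := \prod_(i < n) (s + i%:R).

Lemma poch_gt0 s n : 0 < s -> 0 < poch s n.
Proof. by move=> s0; apply: prodr_gt0 => i _; rewrite ltr_pwDl. Qed.

Lemma pochS s n : poch s n.+1 = poch s n * (s + n%:R).
Proof. by rewrite /poch big_ord_recr. Qed.

Lemma poch_shift s n : s * poch (s + 1) n = poch s n * (s + n%:R).
Proof.
elim: n => [|n IH]; first by rewrite /poch !big_ord0 mulr1 mul1r mulr0n addr0.
by rewrite !pochS mulrA IH -(natr1 n); ring.
Qed.

(* The expansion of the kernel is [E (r e^(iA)) (rho e^(iB)) = \sum_n Phi n A B (rho r)^n]. *)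
Definition Phi (n : nat) (A B : R) : R := fc (serY A B) n / poch (gam + 1) n.

Lemma Phi0 A B : Phi 0 A B = 1.
Proof. by rewrite /Phi serY0 /poch big_ord0 divr1. Qed.

#[local] Arguments fc : simpl never.

(** This is the radial Dunkl equation at order [n + 1]. [serY_rec] and [serY_orbit] with [x = a],
    [y = b] have the same reflected terms; eliminating them leaves the factor [gam + n + 1], which
    the rising factorial of [gam + 1] absorbs. *)
Lemma Phi_rec n A B :
  (n.+1%:R + gam) * Phi n.+1 A B
  - \sum_(i < 2 * k) kappaI a b i * Phi n.+1 (pang true A i) B = cos (A - B) * Phi n A B.
Proof.
have p0 : poch (gam + 1) n.+1 != 0 by rewrite gt_eqF// poch_gt0// addr_gt0.
have p1 : poch (gam + 1) n != 0 by rewrite gt_eqF// poch_gt0// addr_gt0.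
have g1 : gam + n.+1%:R != 0 by rewrite gt_eqF// addr_gt0.
have l1 : lam != 0 by rewrite gt_eqF.
have := serY_orbit true A B a b n.+1; have := serY_rec A B n.
rewrite /= mulN1r opprK mul1r => <-.
rewrite mulrCA => /(mulfI l1) E.
rewrite /Phi; under eq_bigr do rewrite mulrA.
rewrite -mulr_suml [X in _ - X / _ = _]E pochS.
rewrite (_ : gam + 1 + n%:R = gam + n.+1%:R); last by rewrite -(natr1 n); ring.
rewrite [n.+1%:R + gam]addrC; move: (gam + n.+1%:R) (poch _ n) g1 p1 => g p g1 p1.
move: (fc _ n.+1) (fc _ n) (cos _) => y1 y0 c.
by field; rewrite p1.
Qed.

(** With equal class weights the four sign patterns occur equally often, and their weights add up to
    4 by [ell_total]. The remaining factor [gam + n] turns the rising factorial of [gam + 1] into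
    that of [gam], by [poch_shift]. *)
Lemma Phi_total n A B :
  (4 * k%:R)^-1 * (\sum_(i < 2 * k) Phi n A (pang false B i) +
                   \sum_(i < 2 * k) Phi n A (pang true B i)) =
  mom2 a b (comp2 (fc (zeta lam) n)
    (xip (cos (k%:R * A) * cos (k%:R * B)) (sin (k%:R * A) * sin (k%:R * B)))) / poch gam n.
Proof.
have p0 : poch gam n != 0 by rewrite gt_eqF// poch_gt0.
have p1 : poch (gam + 1) n != 0 by rewrite gt_eqF// poch_gt0// addr_gt0.
have l1 : lam != 0 by rewrite gt_eqF.
have k1 : k%:R != 0 :> R by rewrite pnatr_eq0 -lt0n.
have H e : lam * (\sum_(i < 2 * k) Phi n A (pang e B i)) * poch (gam + 1) n =
  lam * (\sum_(i < 2 * k) (if odd i then 1 else 1) * fc (serY (pang e B i) A) n).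
  rewrite -mulrA; congr (_ * _); rewrite mulr_suml; apply: eq_bigr => i _.
  by rewrite if_same [RHS]mul1r /Phi (divfK p1) serYC.
have E : lam * (\sum_(i < 2 * k) Phi n A (pang false B i) +
               \sum_(i < 2 * k) Phi n A (pang true B i)) * poch (gam + 1) n =
  (gam + n%:R) * (4 * mom2 a b (comp2 (fc (zeta lam) n)
    (xip (cos (k%:R * A) * cos (k%:R * B)) (sin (k%:R * A) * sin (k%:R * B))))).
  rewrite mulrDr mulrDl (H false) (H true) !serY_orbit -mulrDr; congr (_ * _).
  rewrite !mul1r !mulN1r opprK ![cos (_ * B) * _]mulrC ![sin (_ * B) * _]mulrC.
  by rewrite -ell_total// mul1r.
have := poch_shift gam n.
have g1 : gam + n%:R != 0 by rewrite gt_eqF// ltr_pwDl.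
move: E; move: (\sum_(i < 2 * k) _ + _) (mom2 _ _ _) => S M E Q.
apply: (mulfI l1); apply: (mulIf p1).
have -> : lam * ((4 * k%:R)^-1 * S) * poch (gam + 1) n =
   (4 * k%:R)^-1 * (lam * S * poch (gam + 1) n) by ring.
rewrite E; apply: (mulfI k1).
have -> : k%:R * (lam * (M / poch gam n) * poch (gam + 1) n) =
   M / poch gam n * (gam * poch (gam + 1) n) by rewrite /gam; ring.
rewrite Q; move: (poch gam n) (gam + n%:R) p0 => p g p0.
by field; rewrite p0.
Qed.

End KernelCoefs.

(** * Estimates on orbits and along rays *)

Section OrbIndex.
Variable k : nat.

Lemma orb_sub_proof (i j : 'I_(2 * k)) :
  ((if (j <= i)%N then i - j else i + (2 * k) - j) < 2 * k)%N.
Proof. by have := ltn_ord i; have := ltn_ord j; case: ifP => ? ? ?; lia. Qed.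

(** Composition with reflection [i], on indices modulo [2 k]: angle [t] goes to [i pi / k - t], so
    [j] becomes [i - j]. Indexing the orbit by group elements rather than points makes stabilizers
    irrelevant. *)
Definition orb_refl (i : 'I_(2 * k)) (g : bool * 'I_(2 * k)) : bool * 'I_(2 * k) :=
  (~~ g.1, Ordinal (orb_sub_proof i g.2)).

Lemma orb_reflK i : involutive (orb_refl i).
Proof.
case=> e j; rewrite /orb_refl /= negbK; congr (_, _); apply: val_inj => /=.
by have := ltn_ord i; have := ltn_ord j; do 2 case: ifP; move=> ? ? ? ?; lia.
Qed.

End OrbIndex.

Section Orbits.
Variable R : realType.
Variables (k : nat) (a b : R).
Hypotheses (k0 : (0 < k)%N) (a0 : 0 < a) (b0 : 0 < b).
Let kR : (k%:R : R) != 0. Proof. by rewrite pnatr_eq0 -lt0n. Qed.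

Lemma kappa_ge0 i : 0 <= kappaI a b i.
Proof. by rewrite /kappaI; case: ifP; rewrite ltW. Qed.

Lemma sum_kappa : \sum_(i < 2 * k) kappaI a b i = k%:R * (a + b).
Proof.
elim: k => [|n IH]; first by rewrite big_ord0 mulr0n mul0r.
rewrite mulnS !addSn add0n !big_ord_recr/= IH /kappaI /= mul2n odd_double/= -(natr1 n).
by ring.
Qed.

Let orb := (bool * 'I_(2 * k))%type.

Definition orb_ang (A : R) (g : bool * 'I_(2 * k)) : R := pang k g.1 A g.2.

Lemma orb_ang_refl (f : R -> R) A (i : 'I_(2 * k)) g : (forall t, f (t + pi *+ 2) = f t) ->
  f (pang k true (orb_ang A g) i) = f (orb_ang A (orb_refl i g)).
Proof.
move=> fp; case: g => e j; rewrite /orb_ang /orb_refl /=.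
have jk := ltnW (ltn_ord j).
case: ifP => ji.
  congr f; rewrite /pang natrB//; case: e => /=; field; exact: kR.
rewrite -fp; congr f; rewrite /pang natrB; last by rewrite (leq_trans jk)// leq_addl.
rewrite natrD natrM -[pi *+ 2]mulr_natl; case: e => /=; field; exact: kR.
Qed.

Lemma orb_ang_id A : exists g : orb, orb_ang A g = A.
Proof.
have k2 : (0 < 2 * k)%N by rewrite muln_gt0.
by exists (false, Ordinal k2); rewrite /orb_ang /pang /= !mul0r addr0.
Qed.

(* At a point of the orbit where [`|f|] is maximal the reflection sum is at most
   [k (a + b) `|f|]. *)
Lemma max_principle (f g c : R -> R) (n : nat) (M : R) :
  (forall t, f (t + pi *+ 2) = f t) -> (forall t, `|c t| <= 1) -> (forall t, `|g t| <= M) ->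
  (forall t, (n.+1%:R + k%:R * (a + b)) * f t
     - \sum_(i < 2 * k) kappaI a b i * f (pang k true t i) = c t * g t) ->
  forall A, `|f A| <= M / n.+1%:R.
Proof.
move=> fp c1 gM H A.
have [g0 Eg0] := orb_ang_id A.
pose s : orb := [arg max_(g > g0) `|f (orb_ang A g)| ]%O.
have smax h : `|f (orb_ang A h)| <= `|f (orb_ang A s)|.
  by rewrite /s; case: arg_maxP => //= i _; exact.
rewrite -{1}Eg0; apply: (le_trans (smax g0)).
rewrite ler_pdivlMr ?ltr0n// mulrC.
set m := `|_| in smax *.
have gam0 : 0 <= k%:R * (a + b) by rewrite mulr_ge0// ltW// addr_gt0.
have : (n.+1%:R + k%:R * (a + b)) * m <= M + k%:R * (a + b) * m.
  rewrite -[n.+1%:R + _]ger0_norm; last by rewrite addr_ge0.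
  rewrite /m -normrM.
  have /eqP := H (orb_ang A s); rewrite subr_eq => /eqP ->.
  apply: (le_trans (ler_normD _ _)); apply: lerD.
    by rewrite normrM -[leRHS]mul1r ler_pM.
  apply: (le_trans (ler_norm_sum _ _ _)).
  rewrite -sum_kappa mulr_suml; apply: ler_sum => i _.
  rewrite normrM (ger0_norm (kappa_ge0 i)) ler_wpM2l ?kappa_ge0//.
  by rewrite orb_ang_refl.
by rewrite mulrDl lerD2r.
Qed.

Lemma Phi_periodic n A B : Phi k a b n (A + pi *+ 2) B = Phi k a b n A B.
Proof.
rewrite /Phi /serY.
have -> : cpoly' k (A + pi *+ 2 - B) = cpoly' k (A - B).
  apply: eq_bigr => l _; congr (1 - _ *: 'X).
  rewrite (_ : angle k _ _ = angle k (A - B) l.+1 + pi *+ 2) ?cosD2pi//.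
  by rewrite /angle; ring.
have E : k%:R * (A + pi *+ 2) = k%:R * A + (pi *+ 2) *+ k by rewrite mulrDr [k%:R * (pi *+ 2)]mulr_natl.
by rewrite E (periodicn (@cosD2pi R)) (periodicn (@sinD2pi R)).
Qed.

Lemma Phi_bound n A B : `|Phi k a b n A B| <= n`!%:R^-1.
Proof.
elim: n A => [|n IH] A; first by rewrite Phi0// normr1 invr1.
have := @max_principle (fun t => Phi k a b n.+1 t B) (fun t => Phi k a b n t B)
  (fun t => cos (t - B)) n (n`!%:R^-1) _ _ IH _ A.
move=> H; rewrite factS natrM invfM mulrC; apply: H.
- by move=> t; exact: Phi_periodic.
- by move=> t; exact: cos_max.
- by move=> t; exact: Phi_rec.
Qed.

(* Each reflection is an involution of the orbit, so the sum is half a sum of squares; hence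
   the term singular at [r = 0] of the radial equation only decreases the energy. *)
Lemma orb_dissipative (D : bool * 'I_(2 * k) -> R) :
  0 <= \sum_g D g * \sum_(i < 2 * k) kappaI a b i * (D g - D (orb_refl i g)).
Proof.
under eq_bigr do rewrite mulr_sumr.
rewrite exchange_big/=; apply: sumr_ge0 => i _.
under eq_bigr do rewrite mulrCA.
rewrite -mulr_sumr mulr_ge0 ?kappa_ge0//.
have E : \sum_g D g * (D g - D (orb_refl i g)) =
         \sum_g D (orb_refl i g) * (D (orb_refl i g) - D g).
  rewrite (reindex_inj (inv_inj (orb_reflK i)))/=.
  by apply: eq_bigr => g _; rewrite orb_reflK.
rewrite -[leRHS](@mulfK _ 2)// mulr_ge0// mulr_natr mulr2n {1}E -big_split/=.
apply: sumr_ge0 => g _.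
by rewrite (_ : _ + _ = (D g - D (orb_refl i g)) ^+ 2) ?sqr_ge0//; ring.
Qed.

End Orbits.

(** * Energy estimate for the singular radial system *)

Section Energy.
Variable R : realType.

Lemma is_derive_bigsum (I : Type) (s : seq I) (F : I -> R -> R) (dF : I -> R) (x : R) :
  (forall i, is_derive x (1 : R) (F i) (dF i)) ->
  is_derive x (1 : R) (fun x => \sum_(i <- s) F i x) (\sum_(i <- s) dF i).
Proof.
move=> H; elim: s => [|i s IH].
  rewrite big_nil (_ : (fun _ => _) = cst 0); first exact: is_derive_cst.
  by apply/funext => y; rewrite big_nil.
rewrite big_cons (_ : (fun _ => _) = F i + (fun x => \sum_(i <- s) F i x)).
  exact: is_deriveD.
by apply/funext => y; rewrite big_cons.
Qed.

Lemma is_derive_continuous (f : R -> R) (x df : R) :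
  is_derive x (1 : R) f df -> {for x, continuous f}.
Proof.
by move=> [H _]; apply: differentiable_continuous; exact/derivable1_diffP.
Qed.

Lemma continuous_bigsum (I : Type) (s : seq I) (F : I -> R -> R) :
  (forall i, continuous (F i)) -> continuous (fun x => \sum_(i <- s) F i x).
Proof.
move=> H; elim: s => [|i s IH] x.
  rewrite (_ : (fun _ => _) = cst 0); first exact: cst_continuous.
  by apply/funext => y; rewrite big_nil.
rewrite (_ : (fun _ => _) = F i + (fun x => \sum_(i <- s) F i x)).
  by apply: continuousD; [exact: H|exact: IH].
by apply/funext => y; rewrite big_cons.
Qed.

Variables (k : nat) (a b : R).
Hypotheses (k0 : (0 < k)%N) (a0 : 0 < a) (b0 : 0 < b).
Let orb := (bool * 'I_(2 * k))%type.

(** A Gronwall argument for the sum of squares over the orbit. The equation is used only for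
    [r > 0]; at the singular point, continuity and the zero initial value suffice. *)
Lemma energy_estimate (D e : bool * 'I_(2 * k) -> R -> R) (c : bool * 'I_(2 * k) -> R)
    (rho r0 dl : R) :
  0 < r0 -> 0 <= rho -> (forall g, continuous (D g)) -> (forall g, D g 0 = 0) ->
  (forall g, `|c g| <= 1) -> (forall g r, 0 < r < r0 -> `|e g r| <= dl) ->
  (forall g r, 0 < r < r0 -> is_derive r (1 : R) (D g)
     (rho * c g * D g r
      - r^-1 * \sum_(i < 2 * k) kappaI a b i * (D g r - D (orb_refl i g) r) + e g r)) ->
  forall g, D g r0 ^+ 2 <= expR ((2 * rho + 1) * r0) * (4 * k%:R * dl ^+ 2).
Proof.
move=> r00 rho0 cD D0 c1 edl dD.
pose u r := \sum_g D g r ^+ 2.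
(* [K0] counts [dl ^+ 2] once for each of the [4 k] group elements. In [L], the term [2 rho] comes
   from the drift and the 1 from [2 D e <= D^2 + e^2]; as [L >= 1], [exp (- L r) (u + K0)] is
   nonincreasing. *)
pose K0 : R := 4 * k%:R * dl ^+ 2.
pose L := 2 * rho + 1.
have K00 : 0 <= K0 by rewrite /K0 mulr_ge0 ?sqr_ge0// mulr_ge0.
have L1 : 1 <= L by rewrite /L lerDr mulr_ge0.
pose v r := expR (- L * r) * (u r + K0).
pose du r := \sum_g (2 * D g r * (rho * c g * D g r
      - r^-1 * \sum_(i < 2 * k) kappaI a b i * (D g r - D (orb_refl i g) r) + e g r)).
have hu r : 0 < r < r0 -> is_derive r (1 : R) u (du r).
  move=> hr; apply: is_derive_bigsum => g.
  have := @is_deriveX _ _ _ 2 r 1 _ (dD g r hr); rewrite exprfctE/=.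
  by rewrite /GRing.scale/= expr1.
have hexp r : is_derive r (1 : R) (fun r => expR (- L * r)) (expR (- L * r) * - L).
  have H1 : is_derive r (1 : R) (fun r => - L * r) (- L).
    have := @is_deriveZ _ _ _ id (- L) r 1 1 (is_derive_id _ _).
    by rewrite /GRing.scale/= mulr1.
  have := @is_derive1_comp _ expR (fun r => - L * r) r _ _ (is_derive_expR _) H1.
  exact.
have hv r : 0 < r < r0 ->
    is_derive r (1 : R) v (expR (- L * r) * (du r - L * (u r + K0))).
  move=> hr.
  have H1 : is_derive r (1 : R) (fun r => u r + K0) (du r).
    have := @is_deriveD _ _ _ u (cst K0) r 1 _ _ (hu r hr) (is_derive_cst _ _ _).
    by rewrite addr0.
  have := @is_deriveM _ _ (fun r => expR (- L * r)) (fun r => u r + K0) r 1 _ _ (hexp r) H1.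
  by rewrite /GRing.scale/= => H; apply: (is_derive_eq H); ring.
have dule r : 0 < r < r0 -> du r <= L * u r + K0.
  move=> hr; have r1 : 0 < r by case/andP: hr.
  have -> : du r = \sum_g 2 * rho * c g * D g r ^+ 2
     - 2 * r^-1 * (\sum_g D g r * \sum_(i < 2 * k) kappaI a b i * (D g r - D (orb_refl i g) r))
     + \sum_g 2 * D g r * e g r.
    rewrite mulr_sumr -sumrB -big_split/=; apply: eq_bigr => g _.
    by move: (\sum_(i < _) _) => S; ring.
  apply: (@le_trans _ _ (\sum_g 2 * rho * D g r ^+ 2 + \sum_g (D g r ^+ 2 + dl ^+ 2))).
    apply: lerD.
      rewrite -[leRHS]subr0; apply: lerB.
        apply: ler_sum => g _; rewrite ler_wpM2r ?sqr_ge0//.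
        by rewrite -[leRHS]mulr1 ler_wpM2l ?mulr_ge0// (le_trans (ler_norm _)).
      by rewrite mulr_ge0 ?orb_dissipative// mulr_ge0// invr_ge0 ltW.
    apply: ler_sum => g _.
    apply: (@le_trans _ _ (D g r ^+ 2 + e g r ^+ 2)).
      rewrite -subr_ge0 (_ : _ - _ = (D g r - e g r) ^+ 2) ?sqr_ge0//; ring.
    rewrite lerD2l -[leLHS]real_normK ?num_real// lerXn2r ?nnegrE//; last exact: edl.
    by rewrite (le_trans _ (edl g r hr)).
  rewrite big_split/= -mulr_sumr sumr_const -/(u r) card_prod card_bool card_ord.
  rewrite /L /K0 -[dl ^+ 2 *+ _]mulr_natl addrA.
  have -> : (2 * (2 * k))%:R = 4 * k%:R :> R by rewrite mulnA natrM.
  by rewrite [(2 * rho + 1) * _]mulrDl mul1r.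
have cu : continuous u.
  apply: continuous_bigsum => g x.
  rewrite (_ : (fun _ => _) = (fun y => y ^+ 2) \o D g)//.
  by apply: continuous_comp; [exact: cD|exact: exprn_continuous].
have cv : continuous v.
  move=> x; apply: (@continuousM _ _ (fun r => expR (- L * r)) (fun r => u r + K0)).
    exact: is_derive_continuous (hexp x).
  by apply: (@continuousD _ _ _ u (cst K0)); [exact: cu|exact: cst_continuous].
have : v r0 <= v 0.
  apply: (@ler0_derive1_nincr R v 0 r0 _ _ _ 0 r0 (lexx 0) (ltW r00) (lexx r0)).
  - by move=> x; rewrite in_itv/= => hx; have [] := hv x hx.
  - move=> x; rewrite in_itv/= => hx; rewrite derive1E.
    have [_ ->] := hv x hx; rewrite mulr_ge0_le0 ?expR_ge0// subr_le0.
    apply: (le_trans (dule x hx)); rewrite mulrDr lerD2l.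
    by rewrite -[leLHS]mul1r ler_wpM2r.
  - by apply: continuous_subspaceT => x; exact: cv.
rewrite /v mulr0 expR0 mul1r.
have -> : u 0 = 0 by rewrite /u big1// => g _; rewrite D0 expr0n.
rewrite add0r mulNr expRN ler_pdivrMl ?expR_gt0// => H g.
apply: (@le_trans _ _ (u r0)).
  rewrite /u (bigD1 g)//= lerDl; apply: sumr_ge0 => h _; exact: sqr_ge0.
by apply: (le_trans _ H); rewrite lerDl.
Qed.

End Energy.

Section KernelExpansion.
Variable R : realType.
Variables (k : nat) (a b : R) (E : R * R -> R * R -> R).
Hypotheses (k0 : (0 < k)%N) (a0 : 0 < a) (b0 : 0 < b) (HE : is_dunkl_kernel k a b E).
Let kR : (k%:R : R) != 0. Proof. by rewrite pnatr_eq0 -lt0n. Qed.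

Lemma sin_mul_eq0 (t : R) n : sin t = 0 -> sin (n%:R * t) = 0.
Proof.
move=> t0; elim: n => [|n IH]; first by rewrite mulr0n mul0r sin0.
by rewrite -(natr1 n) mulrDl mul1r sinD IH t0 mul0r mulr0 addr0.
Qed.

(** The mirrors are the lines at angles [j pi / (2 k)], which are exactly the zeros of
    [sin (2 k t)]. *)
Definition regular (t : R) := sin ((2 * k)%:R * t) != 0.

Lemma regular_root t j : regular t -> sin (t - j%:R * pi / (2 * k%:R)) != 0.
Proof.
apply: contra_neq => /(@sin_mul_eq0 _ (2 * k)).
rewrite mulrBr (_ : (2 * k)%:R * (j%:R * pi / (2 * k%:R)) = pi *+ j); last first.
  by rewrite natrM -mulr_natl; field; exact: kR.
move=> H; rewrite -[_ * t](subrK (pi *+ j)) (alternatingn (@sinDpi R)) H.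
by rewrite mulr0.
Qed.

Lemma regular_pang e t j : regular t -> regular (pang k e t j).
Proof.
rewrite /regular /pang mulrDr (_ : (2 * k)%:R * (j%:R * pi / k%:R) = (pi *+ 2) *+ j); last first.
  by rewrite natrM -[RHS]mulr_natl -[pi *+ 2]mulr_natl; field; exact: kR.
rewrite (periodicn (@sinD2pi R)); case: e => //.
by rewrite mulrN sinN oppr_eq0.
Qed.

Definition pt (r t : R) : R * R := pscale r (pexpi t).

Lemma reflI_pt i r t : reflI k i (pt r t) = pt r (pang k true t i).
Proof.
rewrite /reflI /pt /pmul /pconj /pscale /pexpi /pang /= cosD sinD cosN sinN.
by congr (_, _); ring.
Qed.

Lemma root_pt j r t : pinner (rootI R k j) (pt r t) = r * sin (t - j%:R * pi / (2 * k%:R)).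
Proof. by rewrite /pinner /rootI /pt /pscale /pexpi /= sinB; ring. Qed.

(** The direction [pexpi t] is parallel to the point, so the two root products have quotient [1 / r]
    for every root and only the multiplicities remain. *)
Lemma ray_derive (w : R * R) (r t : R) : 0 < r -> regular t ->
  is_derive r (1 : R) (fun r => E (pt r t) w)
    (pinner (pexpi t) w * E (pt r t) w
     - r^-1 * \sum_(i < 2 * k) kappaI a b i * (E (pt r t) w - E (pt r (pang k true t i)) w)).
Proof.
move=> r0 rt; have [_ [dE Heq]] := HE w.
have reg j : pinner (rootI R k j) (pt r t) != 0.
  by rewrite root_pt; apply: mulf_neq0; [rewrite gt_eqF|exact: regular_root].
have := Heq (pt r t) (pexpi t) (fun j _ => reg j); rewrite /dunkl.
have -> : \sum_(j < 2 * k) kappaI a b j * pinner (rootI R k j) (pexpi t) *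
     (E (pt r t) w - E (reflI k j (pt r t)) w) / pinner (rootI R k j) (pt r t) =
   r^-1 * \sum_(i < 2 * k) kappaI a b i * (E (pt r t) w - E (pt r (pang k true t i)) w).
  rewrite mulr_sumr; apply: eq_bigr => j _; rewrite reflI_pt.
  have -> : pinner (rootI R k j) (pexpi t) = pinner (rootI R k j) (pt r t) / r.
    have <- : pt 1 t = pexpi t by rewrite /pt /pscale /= !mul1r.
    by rewrite !root_pt mul1r [r * sin _ / r]mulrAC divff ?mul1r// gt_eqF.
  have := reg j; move: (pinner _ _) (E _ _) (E _ _) => p x y p0.
  by field; rewrite p0 gt_eqF.
move=> H; rewrite -H addrK.
have eqf : (fun h : R => h^-1 *: (((fun r => E (pt r t) w) \o shift r) (h *: (1 : R)) - E (pt r t) w)) =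
           (fun h : R => h^-1 *: (((fun x => E x w) \o shift (pt r t)) (h *: pexpi t) - E (pt r t) w)).
  apply/funext => h /=; congr (_ *: (E _ w - _)).
  have -> : h *: (1 : R) = h by rewrite /GRing.scale/= mulr1.
  apply: injective_projections => /=.
    by rewrite mulrDl.
  by rewrite mulrDl.
have dv : derivable (fun x => E x w) (pt r t) (pexpi t) by exact: diff_derivable.
by split; [rewrite /derivable eqf|rewrite /derive eqf].
Qed.


Lemma continuous_ray w t : continuous (fun r => E (pt r t) w).
Proof.
move=> r; have [_ [dE _]] := HE w.
apply: (@continuous_comp _ _ _ (fun r => pt r t) (fun x => E x w)).
  have H1 : (fun r : R => r * cos t) x @[x --> r] --> r * cos t by exact: cvgMr_tmp.
  have H2 : (fun r : R => r * sin t) x @[x --> r] --> r * sin t by exact: cvgMr_tmp.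
  exact: (cvg_pair H1 H2).
exact: differentiable_continuous.
Qed.

Lemma continuous_circle w r : continuous (fun t => E (pt r t) w).
Proof.
move=> t; have [_ [dE _]] := HE w.
apply: (@continuous_comp _ _ _ (fun t => pt r t) (fun x => E x w)).
  have H1 : (fun t : R => r * cos t) x @[x --> t] --> r * cos t.
    by apply: cvgMl_tmp; exact: continuous_cos.
  have H2 : (fun t : R => r * sin t) x @[x --> t] --> r * sin t.
    by apply: cvgMl_tmp; exact: continuous_sin.
  exact: (cvg_pair H1 H2).
exact: differentiable_continuous.
Qed.

Lemma pt_periodic r t : pt r (t + pi *+ 2) = pt r t.
Proof. by rewrite /pt /pexpi cosD2pi sinD2pi. Qed.

Section RadialSeries.
Variables (ph : nat -> R -> R) (B : R).
Hypotheses (ph0 : forall t, ph 0 t = 1)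
  (ph_rec : forall n t, (n.+1%:R + k%:R * (a + b)) * ph n.+1 t
     - \sum_(i < 2 * k) kappaI a b i * ph n.+1 (pang k true t i) = cos (t - B) * ph n t)
  (ph_periodic : forall n t, ph n (t + pi *+ 2) = ph n t)
  (ph_bound : forall n t, `|ph n t| <= n`!%:R^-1).

Definition ptaylor (rho : R) N t : {poly R} := \poly_(i < N.+1) (ph i t * rho ^+ i).

Lemma ptaylorE rho N t r :
  (ptaylor rho N t).[r] = \sum_(n < N.+1) ph n t * (rho * r) ^+ n.
Proof.
by rewrite horner_poly; apply: eq_bigr => i _; rewrite exprMn mulrA.
Qed.

Lemma ptaylor_deriv rho N t r :
  r * (ptaylor rho N t)^`().[r] = \sum_(n < N.+1) n%:R * ph n t * (rho * r) ^+ n.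
Proof.
have -> : r * (ptaylor rho N t)^`().[r] = ('X * (ptaylor rho N t)^`()).[r].
  by rewrite !hornerE.
rewrite (@horner_coef_wide _ N.+1); last first.
  have [->|nz] := eqVneq (ptaylor rho N t)^`() 0; first by rewrite mulr0 size_poly0.
  rewrite mulrC size_mulX// (leq_trans (lt_size_deriv _)) ?size_poly//.
  by apply: contra_neq nz => ->; rewrite deriv0.
apply: eq_bigr => -[n nN] _ /=; rewrite coefXM coef_deriv.
case: n nN => [|n] nN /=; first by rewrite mulr0n !mul0r.
by rewrite coef_poly nN -mulr_natl exprMn; ring.
Qed.

#[local] Opaque ptaylor.

Lemma ptaylor_radial rho N t r :
  r * (ptaylor rho N t)^`().[r]
  + \sum_(i < 2 * k) kappaI a b i * ((ptaylor rho N t).[r] - (ptaylor rho N (pang k true t i)).[r])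
  = rho * r * cos (t - B) * ((ptaylor rho N t).[r] - ph N t * (rho * r) ^+ N).
Proof.
have -> : \sum_(i < 2 * k) kappaI a b i * ((ptaylor rho N t).[r] - (ptaylor rho N (pang k true t i)).[r])
   = \sum_(n < N.+1) (k%:R * (a + b) * ph n t
       - \sum_(i < 2 * k) kappaI a b i * ph n (pang k true t i)) * (rho * r) ^+ n.
  transitivity (\sum_(i < 2 * k) \sum_(n < N.+1)
      kappaI a b i * (ph n t - ph n (pang k true t i)) * (rho * r) ^+ n).
    apply: eq_bigr => i _; rewrite !ptaylorE -sumrB mulr_sumr.
    by apply: eq_bigr => n _; rewrite -mulrBl mulrA.
  rewrite exchange_big/=; apply: eq_bigr => n _; rewrite -mulr_suml; congr (_ * _).
  by rewrite -sum_kappa mulr_suml -sumrB; apply: eq_bigr => i _; rewrite mulrBr.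
rewrite ptaylor_deriv -big_split/= ptaylorE big_ord_recl/= big_ord_recr/= addrK mulr_sumr.
rewrite ph0 expr0 !mulr1 mulr0n add0r.
have -> : \sum_(i < 2 * k) kappaI a b i * ph 0 (pang k true t i) = k%:R * (a + b).
  by rewrite -sum_kappa; apply: eq_bigr => i _; rewrite ph0 mulr1.
rewrite subrr add0r; apply: eq_bigr => n _.
by rewrite -mulrDl /bump/= add1n exprS addrA -mulrDl ph_rec; ring.
Qed.

(** The energy estimate is applied to the kernel minus the partial sum on the whole orbit: both
    equal 1 at the origin, and the truncation error is at most [rho (rho r)^N / N!]. *)
Lemma kernel_estimate_regular (rho r t : R) N : 0 < r -> 0 <= rho -> regular t ->
  (E (pt r t) (pt rho B) - \sum_(n < N.+1) ph n t * (rho * r) ^+ n) ^+ 2 <=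
  expR ((2 * rho + 1) * r) * (4 * k%:R * (rho * ((rho * r) ^+ N / N`!%:R)) ^+ 2).
Proof.
move=> r0 rho0 rt; set w := pt rho B.
have [g Eg] := orb_ang_id k0 t.
pose D (g : bool * 'I_(2 * k)) (r : R) :=
  E (pt r (orb_ang t g)) w - (ptaylor rho N (orb_ang t g)).[r].
pose c (g : bool * 'I_(2 * k)) := cos (orb_ang t g - B).
pose e (g : bool * 'I_(2 * k)) (r : R) := rho * c g * (ph N (orb_ang t g) * (rho * r) ^+ N).
suff /(_ g) : forall g, D g r ^+ 2 <= expR ((2 * rho + 1) * r) *
    (4 * k%:R * (rho * ((rho * r) ^+ N / N`!%:R)) ^+ 2).
  by rewrite {1}/D Eg ptaylorE.
apply: (@energy_estimate R k a b a0 b0 D e c) => //.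
- move=> h x; apply: (@continuousB _ _ _ (fun r => E (pt r (orb_ang t h)) w)
     (fun r => (ptaylor rho N (orb_ang t h)).[r])).
    exact: continuous_ray.
  exact: continuous_horner.
- move=> h; rewrite /D ptaylorE big_ord_recl/= ph0 expr0 mulr1 big1 ?addr0; last first.
    by move=> i _; rewrite mulr0 expr0n mulr0.
  by have [E1 _] := HE w; rewrite /pt /pscale !mul0r E1 subrr.
- by move=> h; exact: cos_max.
- move=> h s /andP[s0 sr]; rewrite /e normrM [`|rho * _|]normrM (ger0_norm rho0).
  rewrite -mulrA ler_wpM2l// [`|_ * (rho * s) ^+ N|]normrM.
  rewrite -[leRHS]mul1r ler_pM ?mulr_ge0 ?cos_max// [leRHS]mulrC ler_pM//.
  rewrite normrX ger0_norm ?mulr_ge0 ?(ltW s0)//.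
  by rewrite lerXn2r ?nnegrE ?mulr_ge0 ?(ltW s0) ?(ltW r0)// ler_wpM2l// ltW.
- move=> h s /andP[s0 sr].
  have rh : regular (orb_ang t h) by exact: regular_pang.
  have H1 := @ray_derive w s (orb_ang t h) s0 rh.
  have H2 := is_derive_poly (ptaylor rho N (orb_ang t h)) s.
  have H := @is_deriveB _ _ _ _ _ s 1 _ _ H1 H2.
  apply: (is_derive_eq H) => {H H1 H2}.
  have -> : pinner (pexpi (orb_ang t h)) w = rho * c h.
    by rewrite /w /pinner /pexpi /pt /pscale /= /c cosB; ring.
  have -> : \sum_(i < 2 * k) kappaI a b i * (D h s - D (orb_refl i h) s) =
     \sum_(i < 2 * k) kappaI a b i * (E (pt s (orb_ang t h)) w - E (pt s (pang k true (orb_ang t h) i)) w)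
     - \sum_(i < 2 * k) kappaI a b i * ((ptaylor rho N (orb_ang t h)).[s] -
          (ptaylor rho N (pang k true (orb_ang t h) i)).[s]).
    rewrite -sumrB; apply: eq_bigr => i _; rewrite /D.
    rewrite -(@orb_ang_refl R k k0 (fun x => E (pt s x) w)); last by move=> x; rewrite pt_periodic.
    rewrite -(@orb_ang_refl R k k0 (fun x => (ptaylor rho N x).[s])); last first.
      by move=> x; rewrite !ptaylorE; apply: eq_bigr => j _; rewrite ph_periodic.
    by rewrite -mulrBr; congr (_ * _); rewrite !opprB; ring.
  have := ptaylor_radial rho N (orb_ang t h) s.
  have s1 : s != 0 by rewrite gt_eqF.
  rewrite /e /D -/(c h).
  set S1 := \sum_(i < 2 * k) kappaI a b i * ((ptaylor _ _ _).[s] - _).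
  set S2 := \sum_(i < 2 * k) _.
  set p := (ptaylor _ _ _).[s]; set p' := (ptaylor _ _ _)^`().[s] => P.
  have -> : p' = s^-1 * (rho * s * c h * (p - ph N (orb_ang t h) * (rho * s) ^+ N) - S1).
    by rewrite -P addrK mulKf.
  move: (ph N _) ((rho * s) ^+ N) (c h) (E _ _) p S1 S2 {P p'} => ph' q cc x p S1 S2.
  by field.
Qed.

End RadialSeries.

End KernelExpansion.

(** * Dirichlet integrals over the simplex *)

Section Simplex.
Variable R : realType.
Notation mu := (@lebesgue_measure R).
Notation rint D f := (mu.-integrable D (EFin \o f)).
Implicit Types (f g : seq R -> R) (s x : R) (m : nat).

(** Linearity of the iterated integral needs integrability at each level, on every slice, so all of
    it is recorded. *)
Fixpoint simplex_integrable m f s : Prop :=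
  match m with
  | 0 => True
  | m'.+1 => (forall x, 0 < x < s -> simplex_integrable m' (fun l => f (x :: l)) (s - x)) /\
      rint `]0, s[ (fun x => simplex_int m' (fun l => f (x :: l)) (s - x))
  end.

Fixpoint in_simplex m s (l : seq R) : Prop :=
  match m, l with
  | 0, [::] => 0 < s
  | m'.+1, x :: l' => 0 < x < s /\ in_simplex m' (s - x) l'
  | _, _ => False
  end.

Let itvP x s : (`]0, s[%classic : set R) x -> 0 < x < s.
Proof. by rewrite /= in_itv. Qed.

Let mitv s : measurable (`]0, s[%classic : set (measurableTypeR R)).
Proof. by []. Qed.

Lemma eq_simplex m f g s : 0 < s -> (forall l, in_simplex m s l -> f l = g l) ->
  simplex_int m f s = simplex_int m g s /\ (simplex_integrable m f s -> simplex_integrable m g s).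
Proof.
elim: m f g s => [|m IH] f g s s0 fg; first by split=> //=; exact: fg.
have fgx x : 0 < x < s -> simplex_int m (fun l => f (x :: l)) (s - x) =
    simplex_int m (fun l => g (x :: l)) (s - x) /\
    (simplex_integrable m (fun l => f (x :: l)) (s - x) -> simplex_integrable m (fun l => g (x :: l)) (s - x)).
  move=> xs; apply: IH; first by rewrite subr_gt0; case/andP: xs.
  by move=> l hl; apply: fg.
split=> /=.
  by apply: eq_Rintegral => x; rewrite inE => /itvP /fgx[].
move=> [H1 H2]; split=> [x xs|]; first by have [_] := fgx x xs; apply; exact: H1.
by apply: rint_eq H2 => // x /itvP /fgx[].
Qed.

Lemma simplexD m f g s : simplex_integrable m f s -> simplex_integrable m g s ->
  simplex_int m (fun l => f l + g l) s = simplex_int m f s + simplex_int m g s /\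
  simplex_integrable m (fun l => f l + g l) s.
Proof.
elim: m f g s => [|m IH] f g s //= [f1 f2] [g1 g2].
have H x : 0 < x < s -> _ := fun xs => IH _ _ _ (f1 x xs) (g1 x xs).
split.
  rewrite -RintegralD//; apply: eq_Rintegral => x; rewrite inE => /itvP xs.
  by have [-> _] := H x xs.
split=> [x xs|]; first by have [_] := H x xs.
apply: rint_eq (rintD (mitv s) f2 g2) => // x /itvP xs.
by have [-> _] := H x xs.
Qed.

Lemma simplexZ m f (c : R) s : simplex_integrable m f s ->
  simplex_int m (fun l => c * f l) s = c * simplex_int m f s /\
  simplex_integrable m (fun l => c * f l) s.
Proof.
elim: m f s => [|m IH] f s //= [f1 f2].
have H x : 0 < x < s -> _ := fun xs => IH _ _ (f1 x xs).
split.
  rewrite -RintegralZl//; apply: eq_Rintegral => x; rewrite inE => /itvP xs.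
  by have [-> _] := H x xs.
split=> [x xs|]; first by have [_] := H x xs.
apply: rint_eq (rintZ c (mitv s) f2) => // x /itvP xs.
by have [-> _] := H x xs.
Qed.

Lemma simplex0 m s : 0 < s -> simplex_integrable m (fun=> 0) s /\ simplex_int m (fun=> 0) s = 0.
Proof.
elim: m s => [|m IH] s s0 //=.
have H x : 0 < x < s -> _ := fun xs => IH (s - x) (ltac:(by rewrite subr_gt0; case/andP: xs)).
split.
  split=> [x xs|]; first by have [] := H x xs.
  by apply: rint_eq (rint0 (mitv s)) => // x /itvP xs; have [_ ->] := H x xs.
transitivity (Rintegral mu `]0, s[ (fun=> 0)); last by rewrite Rintegral_cst// mul0r.
by apply: eq_Rintegral => x; rewrite inE => /itvP xs; have [_ ->] := H x xs.
Qed.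

Lemma simplex_sum m (I : Type) (r : seq I) (F : I -> seq R -> R) s : 0 < s ->
  (forall i, simplex_integrable m (F i) s) ->
  simplex_int m (fun l => \sum_(i <- r) F i l) s = \sum_(i <- r) simplex_int m (F i) s /\
  simplex_integrable m (fun l => \sum_(i <- r) F i l) s.
Proof.
move=> s0 HF; elim: r => [|i r [IH1 IH2]].
  have [H1 H2] := simplex0 m s0.
  have E : (fun l : seq R => \sum_(i <- [::]) F i l) = (fun=> 0).
    by apply/funext => l; rewrite big_nil.
  by rewrite E big_nil.
have E : (fun l : seq R => \sum_(i <- i :: r) F i l) = (fun l => F i l + \sum_(i <- r) F i l).
  by apply/funext => l; rewrite big_cons.
by rewrite E big_cons -IH1; exact: simplexD.
Qed.

(** [rint_unif] is applied level by level; the integral of [W] over a slice is the dominating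
    function at the next level. *)
Lemma simplex_unif m (F W : seq R -> R) (Fn : nat -> seq R -> R) (e : nat -> R) s :
  0 < s -> (forall n, simplex_integrable m (Fn n) s) -> simplex_integrable m W s ->
  (forall n l, in_simplex m s l -> `|F l - Fn n l| <= e n * W l) -> e n @[n --> \oo] --> 0 ->
  simplex_integrable m F s /\
  forall n, `|simplex_int m F s - simplex_int m (Fn n) s| <= e n * simplex_int m W s.
Proof.
elim: m F W Fn s => [|m IH] F W Fn s s0 gF gW FW e0.
  by split=> // n /=; exact: FW.
have H x : 0 < x < s -> _ := fun xs => IH (fun l => F (x :: l)) (fun l => W (x :: l))
   (fun n l => Fn n (x :: l)) (s - x) (ltac:(by rewrite subr_gt0; case/andP: xs))
   (fun n => (gF n).1 x xs) (gW.1 x xs) (fun n l hl => FW n (x :: l) (conj xs hl)) e0.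
have := @rint_unif R `]0, s[ (fun x => simplex_int m (fun l => F (x :: l)) (s - x))
  (fun x => simplex_int m (fun l => W (x :: l)) (s - x))
  (fun n x => simplex_int m (fun l => Fn n (x :: l)) (s - x)) e (mitv s)
  (fun n => (gF n).2) gW.2.
case=> // [n x /itvP xs|H1 H2]; first by have [_] := H x xs.
by split=> //=; split=> // x xs; have [] := H x xs.
Qed.

Section Dirichlet.
Variable lam : R.
Hypothesis lam0 : 0 < lam.

Definition lincomb (cs l : seq R) : R := \sum_(p <- zip cs l) p.1 * p.2.
Definition dform (cs : seq R) (c0 s : R) (l : seq R) : R :=
  lincomb cs l + c0 * (s - \sum_(x <- l) x).
Definition dweight (s : R) (l : seq R) : R :=
  (\prod_(x <- l) x `^ (lam - 1)) * (s - \sum_(x <- l) x) `^ (lam - 1).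

(** The binomial series of [(1 - c s) ^ (- lam)]. *)
Definition bser (c : R) : fps R := Fps (fun n => c ^+ n * poch lam n / n`!%:R).

Lemma Gamma_poch n : Gamma (lam + n%:R) = poch lam n * Gamma lam.
Proof.
elim: n => [|n IH]; first by rewrite mulr0n addr0 /poch big_ord0 mul1r.
have lamn : 0 < lam + n%:R by rewrite ltr_pwDl.
by rewrite -(natr1 n) addrA (GammaS lamn) IH pochS mulrA [(lam + _) * _]mulrC.
Qed.

Definition dser (cs : seq R) (c0 : R) : fps R := \prod_(c <- cs) bser c * bser c0.

(** Induction on the number of variables: slicing at the first one leaves a simplex of size [s - x],
    whose moments are powers of [s - x], and each remaining integral is a Beta integral. Division by
    [n!] turns the binomial expansion into a Cauchy product. *)
Lemma dirichlet_moment (cs : seq R) (c0 : R) n s : 0 < s ->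
  simplex_integrable (size cs) (fun l => dform cs c0 s l ^+ n / n`!%:R * dweight s l) s /\
  simplex_int (size cs) (fun l => dform cs c0 s l ^+ n / n`!%:R * dweight s l) s =
   Gamma lam ^+ (size cs).+1 * fc (dser cs c0) n
   * s `^ ((size cs).+1%:R * lam + n%:R - 1) / Gamma ((size cs).+1%:R * lam + n%:R).
Proof.
elim: cs n s => [|c cs IH] n s s0.
  split=> //; rewrite /dser big_nil mul1r /= /dform /dweight /lincomb !big_nil.
  rewrite add0r subr0 !mul1r expr1 Gamma_poch exprMn.
  have -> : s `^ (lam + n%:R - 1) = s ^+ n * s `^ (lam - 1).
    rewrite -powR_mulrn ?ltW// -powRD; last by apply/implyP => _; rewrite gt_eqF.
    by congr (_ `^ _); ring.
  have : poch lam n != 0 by rewrite gt_eqF// poch_gt0.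
  have : Gamma lam != 0 by rewrite gt_eqF// Gamma_gt0.
  have : n`!%:R != 0 :> R by rewrite pnatr_eq0 -lt0n fact_gt0.
  move: (n`!%:R : R) (Gamma lam) (poch lam n) (_ `^ _) => F G p q F0 G0 p0.
  by field; rewrite F0 G0 p0.
set m := size cs in IH *.
pose q (i : nat) : R := m.+1%:R * lam + (n - i)%:R.
have q0 i : 0 < q i by rewrite /q ltr_pwDl// mulr_gt0.
pose K (i : nat) : R := c ^+ i / i`!%:R * (Gamma lam ^+ m.+1 * fc (dser cs c0) (n - i) / Gamma (q i)).
have sec x : 0 < x < s ->
  simplex_int m (fun l => dform (c :: cs) c0 s (x :: l) ^+ n / n`!%:R * dweight s (x :: l)) (s - x)
   = \sum_(i < n.+1) K i * (x `^ (lam + i%:R - 1) * (s - x) `^ (q i - 1)) /\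
  simplex_integrable m (fun l => dform (c :: cs) c0 s (x :: l) ^+ n / n`!%:R * dweight s (x :: l)) (s - x).
  move=> /andP[x0 xs]; have sx0 : 0 < s - x by rewrite subr_gt0.
  have Es l : dform (c :: cs) c0 s (x :: l) ^+ n / n`!%:R * dweight s (x :: l) =
    \sum_(i < n.+1) (c ^+ i / i`!%:R * x `^ (lam + i%:R - 1)) *
       (dform cs c0 (s - x) l ^+ (n - i) / (n - i)`!%:R * dweight (s - x) l).
    have -> : dform (c :: cs) c0 s (x :: l) = dform cs c0 (s - x) l + c * x.
      by rewrite /dform /lincomb /= !big_cons /=; ring.
    have -> : dweight s (x :: l) = x `^ (lam - 1) * dweight (s - x) l.
      by rewrite /dweight !big_cons opprD addrA mulrA.
    rewrite exprDn !mulr_suml; apply: eq_bigr => -[i /= iN] _.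
    have -> : x `^ (lam + i%:R - 1) = x ^+ i * x `^ (lam - 1).
      rewrite -powR_mulrn ?(ltW x0)// -powRD; last by apply/implyP => _; rewrite gt_eqF.
      by congr (_ `^ _); ring.
    have bf := @bin_fact n i iN.
    have -> : n`!%:R = 'C(n, i)%:R * (i`!%:R * (n - i)`!%:R) :> R.
      by rewrite -!natrM bf.
    have : 'C(n, i)%:R != 0 :> R by rewrite pnatr_eq0 -lt0n bin_gt0.
    have : i`!%:R != 0 :> R by rewrite pnatr_eq0 -lt0n fact_gt0.
    have : (n - i)`!%:R != 0 :> R by rewrite pnatr_eq0 -lt0n fact_gt0.
    rewrite -[(_ * _) *+ 'C(n, i)]mulr_natl exprMn.
    move: (i`!%:R : R) ((n - i)`!%:R : R) ('C(n, i)%:R : R) => F G H F0 G0 H0.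
    by field; rewrite F0 G0 H0.
  have -> : (fun l => dform (c :: cs) c0 s (x :: l) ^+ n / n`!%:R * dweight s (x :: l)) =
    (fun l => \sum_(i < n.+1) (c ^+ i / i`!%:R * x `^ (lam + i%:R - 1)) *
       (dform cs c0 (s - x) l ^+ (n - i) / (n - i)`!%:R * dweight (s - x) l)).
    exact/funext.
  have T (i : 'I_n.+1) := simplexZ (c ^+ i / i`!%:R * x `^ (lam + i%:R - 1)) (IH (n - i)%N (s - x) sx0).1.
  have [E1 E2] := @simplex_sum m _ (index_enum 'I_n.+1)
     (fun i l => (c ^+ i / i`!%:R * x `^ (lam + i%:R - 1)) *
       (dform cs c0 (s - x) l ^+ (n - i) / (n - i)`!%:R * dweight (s - x) l)) _ sx0 (fun i => (T i).2).
  split=> //; rewrite E1; apply: eq_bigr => i _; rewrite (T i).1 (IH (n - i)%N (s - x) sx0).2.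
  by rewrite /K /q; ring.
have BI (i : nat) := @Beta_itv R (lam + i%:R) (q i) s (ltr_pwDl lam0 (ler0n _ _)) (q0 i) s0.
have [S1 S2] := @rint_sum R `]0, s[ _ (index_enum 'I_n.+1)
   (fun i x => K i * (x `^ (lam + i%:R - 1) * (s - x) `^ (q i - 1))) (mitv s)
   (fun i => rintZ (K i) (mitv s) (BI i).1).
split.
  split=> [x xs|]; first by have [] := sec x xs.
  by apply: rint_eq S1 => // x /itvP xs; have [H _] := sec x xs; rewrite -[LHS]H.
transitivity (Rintegral mu `]0, s[ (fun x => \sum_(i < n.+1) K i * (x `^ (lam + i%:R - 1) * (s - x) `^ (q i - 1)))).
  apply: eq_Rintegral => x; rewrite inE => /itvP xs; have [H _] := sec x xs.
  exact: H.
have -> : dser (c :: cs) c0 = bser c * dser cs c0 by rewrite /dser big_cons mulrA.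
rewrite S2 fcM mulr_sumr !mulr_suml.
apply: eq_bigr => -[i iN] _; rewrite [nat_of_ord _]/=; rewrite RintegralZl ?(BI i).2//; last exact: (BI i).1.
have -> : lam + i%:R + q i = m.+2%:R * lam + n%:R.
  by rewrite /q natrB// -(natr1 m.+1); ring.
rewrite /K Gamma_poch [Gamma lam ^+ m.+2]exprS [fc (bser c) i]/=.
have : Gamma (q i) != 0 by rewrite gt_eqF// Gamma_gt0.
have : Gamma (m.+2%:R * lam + n%:R) != 0.
  by rewrite gt_eqF// Gamma_gt0// ltr_pwDl// mulr_gt0.
have : i`!%:R != 0 :> R by rewrite pnatr_eq0 -lt0n fact_gt0.
move: (i`!%:R : R) (Gamma (_ * _ + _)) (Gamma (q i)) (fc (dser _ _) _) (s `^ _) => F G H X Y F0 G0 H0.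
by field; rewrite F0 G0 H0.
Qed.

End Dirichlet.
End Simplex.

Section ExpTail.
Variable R : realType.

Definition exp_trunc (N : nat) (x : R) : R := \sum_(n < N.+1) x ^+ n / n`!%:R.
Definition exp_tail (N : nat) (x : R) : R := expR x - exp_trunc N x.

Let series_trunc N x : series (exp_coeff x) N.+1 = exp_trunc N x.
Proof. by rewrite /series /= big_mkord. Qed.

Let cvg_expR (x : R) : series (exp_coeff x) @ \oo --> expR x.
Proof. exact: is_cvg_series_exp_coeff. Qed.

Lemma exp_tail_cvg x : exp_tail n x @[n --> \oo] --> 0.
Proof.
rewrite -(subrr (expR x)); apply: cvgB; first exact: cvg_cst.
have := @cvg_expR x; rewrite -(cvg_shiftn 1); under eq_fun do rewrite addn1 series_trunc.
exact.
Qed.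

Lemma exp_tail_norm N (x r : R) : `|x| <= r -> `|expR x - exp_trunc N x| <= exp_tail N r.
Proof.
move=> xr; have r0 : 0 <= r by exact: le_trans xr.
have H1 : `|series (exp_coeff x) M - exp_trunc N x| @[M --> \oo] -->
    `|expR x - exp_trunc N x|.
  by apply: cvg_norm; apply: cvgB; [exact: cvg_expR|exact: cvg_cst].
have H2 : series (exp_coeff r) M - exp_trunc N r @[M --> \oo] --> exp_tail N r.
  by apply: cvgB; [exact: cvg_expR|exact: cvg_cst].
apply: ler_cvg_to H1 H2 _.
exists N.+1 => // M /= NM; rewrite -!series_trunc.
rewrite !sub_series_geq//; apply: (le_trans (ler_norm_sum _ _ _)).
apply: ler_sum => i _; rewrite /exp_coeff/= normrM normrX [`|_^-1|]ger0_norm ?invr_ge0//.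
by rewrite ler_wpM2r ?invr_ge0// lerXn2r ?nnegrE.
Qed.

End ExpTail.

(** * Expansion of exponentials integrated over the simplex *)

Section SimplexExp.
Variable R : realType.
Variables (m : nat) (lam : R) (C : nat -> R).
Hypotheses (lam0 : 0 < lam) (C1 : forall j, `|C j| <= 1).
Let k := m.+1.
Let gam := k%:R * lam.
Let gam0 : 0 < gam. Proof. by rewrite mulr_gt0// ltr0n. Qed.

Let in_simplexP n s (l : seq R) : in_simplex n s l ->
  [/\ size l = n, (forall x, x \in l -> 0 < x) & \sum_(x <- l) x < s].
Proof.
elim: n s l => [|n IH] s [|x l] //=; first by rewrite big_nil.
move=> [/andP[x0 xs] /IH[sl pl Sl]]; split; first by rewrite sl.
  by move=> y; rewrite inE => /predU1P[->//|/pl].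
by rewrite big_cons addrC -ltrBrDr.
Qed.

Let cs : seq R := [seq C j.+1 | j <- iota 0 m].

Let size_cs : size cs = m. Proof. by rewrite size_map size_iota. Qed.

Let dform_tcoord l : size l = m ->
  dform cs (C 0) 1 l = \sum_(j < k) tcoord l j * C j.
Proof.
move=> sl; rewrite big_ord_recl/= /tcoord/= /dform addrC; congr (_ + _); first exact: mulrC.
rewrite /lincomb (big_nth (0, 0)) size_zip size_cs sl minnn big_mkord; apply: eq_bigr => i _.
by rewrite nth_zip ?size_cs// /cs (nth_map 0%N) ?size_iota// nth_iota//= mulrC.
Qed.

Let dweight_tcoord l : size l = m ->
  dweight lam 1 l = \prod_(j < k) tcoord l j `^ (lam - 1).
Proof.
move=> sl; rewrite big_ord_recl/= /tcoord/= /dweight mulrC; congr (_ * _).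
by rewrite (big_nth 0) sl big_mkord; apply: eq_bigr => i _.
Qed.

Let dform_le l : in_simplex m 1 l -> `|dform cs (C 0) 1 l| <= 1.
Proof.
move=> /in_simplexP[sl pl Sl]; rewrite dform_tcoord//.
have t0 (j : 'I_k) : 0 <= tcoord l j.
  rewrite /tcoord; case: j => -[|j] /= jk; first by rewrite subr_ge0 ltW.
  by rewrite ltW// pl// mem_nth// sl.
apply: (le_trans (ler_norm_sum _ _ _)).
apply: (@le_trans _ _ (\sum_(j < k) tcoord l j)).
  by apply: ler_sum => j _; rewrite normrM ger0_norm// ler_piMr.
rewrite big_ord_recl/= /tcoord/=.
by rewrite [X in _ + X <= _](_ : _ = \sum_(x <- l) x) ?subrK// (big_nth 0) sl big_mkord.
Qed.

Definition expC (rho : R) (t : seq R) : R :=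
  expR (rho * \sum_(j < k) tcoord t j * C j) * \prod_(j < k) tcoord t j `^ (lam - 1).

Lemma bser_prod : dser lam cs (C 0) = \prod_(j < k) bser lam (C j).
Proof.
rewrite /dser big_ord_recl mulrC; congr (_ * _); rewrite /cs big_map.
by rewrite -{1}[m]subn0 big_mkord.
Qed.

(** The linear form is a combination of numbers in [-1, 1] with nonnegative coefficients of sum 1,
    so the exponential is truncated with error at most [exp_tail N rho]. The normalizing constant is
    the inverse of the total mass of the weight, so the bound survives integration unchanged. *)
Lemma simplex_expC (rho : R) : 0 <= rho ->
  simplex_integrable m (expC rho) 1 /\
  forall N, `|Gamma gam / Gamma lam ^+ k * simplex_int m (expC rho) 1
     - \sum_(n < N.+1) rho ^+ n * fc (\prod_(j < k) bser lam (C j)) n / poch gam n|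
     <= exp_tail N rho.
Proof.
move=> rho0.
pose Fn N l := \sum_(n < N.+1) rho ^+ n * (dform cs (C 0) 1 l ^+ n / n`!%:R * dweight lam 1 l).
have DM n := dirichlet_moment lam0 cs (C 0) n ltr01.
rewrite size_cs in DM.
have SS N := @simplex_sum R m _ (index_enum 'I_N.+1)
  (fun n l => rho ^+ n * (dform cs (C 0) 1 l ^+ n / n`!%:R * dweight lam 1 l)) 1 ltr01
  (fun n => (simplexZ (rho ^+ n) (DM n).1).2).
have ga : Gamma lam != 0 by rewrite gt_eqF// Gamma_gt0.
have gg : Gamma gam != 0 by rewrite gt_eqF// Gamma_gt0.
have W1 l : in_simplex m 1 l -> dform cs (C 0) 1 l ^+ 0 / 0`!%:R * dweight lam 1 l = dweight lam 1 l.
  by rewrite expr0 divr1 mul1r.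
have [EW gW'] := eq_simplex ltr01 W1.
have gW := gW' (DM 0%N).1.
have sW : simplex_int m (dweight lam 1) 1 = Gamma lam ^+ k / Gamma gam.
  have [_ H] := DM 0%N; rewrite mulr0n addr0 powR1 mulr1 in H.
  rewrite (_ : fc _ 0 = 1) ?mulr1 in H; last first.
    rewrite bser_prod; elim/big_ind: _ => //.
    - by move=> f g f0 g0; rewrite fcM big_ord1 f0 g0 mulr1.
    - by move=> j _; rewrite /= expr0 /poch big_ord0 mulr1 divr1.
  by rewrite -EW.
have [] := @simplex_unif R m (expC rho) (dweight lam 1) Fn (fun N => exp_tail N rho) 1
   ltr01 (fun N => (SS N).2) gW _ (exp_tail_cvg rho).
  move=> N l hl; have [sl pl Sl] := in_simplexP hl.
  have W0 : 0 <= dweight lam 1 l.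
    by rewrite dweight_tcoord//; apply: prodr_ge0 => j _; exact: powR_ge0.
  have -> : Fn N l = exp_trunc N (rho * dform cs (C 0) 1 l) * dweight lam 1 l.
    rewrite /Fn /exp_trunc mulr_suml; apply: eq_bigr => n _.
    by rewrite exprMn !mulrA.
  rewrite /expC -dform_tcoord// -dweight_tcoord// -mulrBl normrM (ger0_norm W0).
  rewrite ler_wpM2r// exp_tail_norm// normrM (ger0_norm rho0) ler_piMr//.
  exact: dform_le.
move=> gF HF; split=> // N; have := HF N; rewrite (SS N).1 sW => H.
have c0 : 0 < Gamma gam / Gamma lam ^+ k by rewrite divr_gt0 ?exprn_gt0 ?Gamma_gt0.
have -> : \sum_(n < N.+1) rho ^+ n * fc (\prod_(j < k) bser lam (C j)) n / poch gam n =
  Gamma gam / Gamma lam ^+ k * \sum_(i <- index_enum 'I_N.+1)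
    simplex_int m (fun l => rho ^+ i * (dform cs (C 0) 1 l ^+ i / i`!%:R * dweight lam 1 l)) 1.
  rewrite mulr_sumr; apply: eq_bigr => n _.
  rewrite (simplexZ (rho ^+ n) (DM n).1).1 (DM n).2 powR1 mulr1 -/gam Gamma_poch// bser_prod.
  have : poch gam n != 0 by rewrite gt_eqF// poch_gt0.
  have : Gamma lam ^+ k != 0 by rewrite expf_neq0.
  move: (fc _ n) (poch gam n) (Gamma lam ^+ k) (Gamma gam) gg => A p G G' G0 G1 p0.
  by field; rewrite G0 G1 p0.
rewrite -mulrBr normrM (gtr0_norm c0).
rewrite -(ler_pM2l c0) in H; apply: (le_trans H).
rewrite mulrCA; set X := _ / _; set Y := _ / _.
have -> : X * Y = 1; last by rewrite mulr1.
by rewrite /X /Y mulrA divfK ?expf_neq0// divff.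
Qed.

Lemma isPow_bser (c : R) : isPow lam (fpsp (1 - c *: 'X)) (bser lam c).
Proof.
split; first by rewrite /= expr0 /poch big_ord0 mulr1 divr1.
have E n : fc (bser lam c) n.+1 *+ n.+1 = c * ((lam + n%:R) * fc (bser lam c) n).
  rewrite -[LHS]mulr_natl /= pochS factS natrM exprS.
  have : n`!%:R != 0 :> R by rewrite pnatr_eq0 -lt0n fact_gt0.
  have : n.+1%:R != 0 :> R by rewrite pnatr_eq0.
  move: (n`!%:R : R) (n.+1%:R : R) => F G G0 F0.
  by field; rewrite F0 G0.
have cX f n : fc (fpsp (c *: 'X) * f) n.+1 = c * fc f n.
  rewrite fcM (bigD1 (lift ord0 ord0))//= big1 ?addr0.
    by rewrite coefZ coefX/= mulr1 subSS subn0.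
  move=> i i1; rewrite coefZ coefX; case: eqP => [E'|_]; last by rewrite mulr0 mul0r.
  by move: i1; rewrite -val_eqE/= E'.
have tX : theta (fpsp (1 - c *: 'X)) = - fpsp (c *: 'X).
  apply: fpsP => n; rewrite fcN /= coefB coef1 coefZ coefX.
  by case: n => [|[|n]]; rewrite /= ?mulr0n ?mulr1 ?mulr0 ?sub0r ?oppr0 ?mul0rn ?mulr1n.
rewrite tX fpspB fpsp1 mulrBl mul1r mulrN mulNr opprK.
apply: fpsP => -[|n]; rewrite fcD fcN.
  rewrite -mulrA fcCM [fc (fpsp _ * _) 0]fcM [fc (fpsp _ * bser _ _) 0]fcM !big_ord1.
  by rewrite /= !(coefZ, coefX, mulr0, mulr0n, mul0r, subr0).
have th f i : fc (theta f) i = fc f i *+ i :> R by [].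
rewrite cX -mulrA fcCM cX !th E -[_ *+ n]mulr_natl; ring.
Qed.

End SimplexExp.

(** * Comparison of the expansions *)

Section Limits.
Variable R : realType.

Lemma eq_of_dist_cvg0 (x y : R) (e : nat -> R) :
  (forall N, `|x - y| <= e N) -> e n @[n --> \oo] --> 0 -> x = y.
Proof.
move=> H e0; apply/eqP; rewrite -subr_eq0 -normr_le0.
apply: ler_cvg_to (cvg_cst `|x - y|) e0 _.
by exists 0%N => // n _; exact: H.
Qed.

(** The measure has total mass 1, so a uniform error passes through the integral unchanged. *)
Lemma nu_unif (a : R) (f : R -> R) (q : nat -> {poly R}) (e : nat -> R) : 0 < a ->
  (forall n u, -1 < u < 1 -> `|f u - (q n).[u]| <= e n) -> e n @[n --> \oo] --> 0 ->
  forall n, `|nu_int a f - momL (nmom a) (q n)| <= e n.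
Proof.
move=> a0 H e0 n.
have mD : measurable (`]-1, 1[%classic : set (measurableTypeR R)) by [].
have [_ /(_ n)] := @rint_unif R `]-1, 1[ (fun u => f u * (1 - u ^+ 2) `^ (a - 1))
  (fun u => (1%:P : {poly R}).[u] * (1 - u ^+ 2) `^ (a - 1))
  (fun n u => (q n).[u] * (1 - u ^+ 2) `^ (a - 1)) e mD
  (fun n => rint_poly (q n) a0) (rint_poly 1%:P a0)
  (ltac:(move=> m u; rewrite /= in_itv/= => hu; rewrite hornerC mul1r -mulrBl normrM
          (ger0_norm (powR_ge0 _ _)) ler_wpM2r ?powR_ge0//; exact: H)) e0.
set X := Rintegral _ _ _; set Y := Rintegral _ _ _; set Z := Rintegral _ _ _ => HH.
pose c := Gamma (a + 2^-1) / (Num.sqrt pi * Gamma a).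
have c0 : 0 <= c by rewrite divr_ge0 ?mulr_ge0 ?sqrtr_ge0// ltW// Gamma_gt0// addr_gt0.
have EZ : c * Z = 1.
  by rewrite -(nmom0 a0) /nmom /nu_int -/c; congr (_ * _); apply: eq_Rintegral => u _; rewrite hornerC expr0.
rewrite -nu_int_poly// /nu_int -/c -/X -/Y -mulrBr normrM (ger0_norm c0).
by rewrite -[leRHS]mulr1 -EZ mulrCA ler_wpM2l.
Qed.

Lemma continuous_addf (f g : R -> R) :
  continuous f -> continuous g -> continuous (fun x => f x + g x).
Proof. by move=> cf cg x; exact: (continuousD (cf x) (cg x)). Qed.

Lemma continuous_mulf (f g : R -> R) :
  continuous f -> continuous g -> continuous (fun x => f x * g x).
Proof. by move=> cf cg x; exact: (continuousM (cf x) (cg x)). Qed.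

End Limits.

Section Assembly.
Variable R : realType.
Variables (k : nat) (a b : R).
Hypotheses (k0 : (0 < k)%N) (a0 : 0 < a) (b0 : 0 < b).
Let lam := a + b.
Let gam := k%:R * lam.
Let lam0 : 0 < lam. Proof. exact: addr_gt0. Qed.
Let gam0 : 0 < gam. Proof. by rewrite mulr_gt0// ltr0n. Qed.
Let kR : (k%:R : R) != 0. Proof. by rewrite pnatr_eq0 -lt0n. Qed.

Definition zpoly (n : nat) : {poly R} := fc (zeta k lam) n.

(** Each factor is the power [- lam] of one factor of [cpoly], so the product is the power of the
    whole, and uniqueness identifies it with [zeta] evaluated at [cos (k th)]. *)
Lemma prod_bser th n :
  fc (\prod_(j < k) bser lam (cos (angle k th j))) n = (zpoly n).[cos (k%:R * th)].
Proof.
have unitn i : (i.+1%:R : R) \is a GRing.unit by rewrite unitfE pnatr_eq0.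
have P0 : fc (fpsp (cpoly k th)) 0 = 1.
  rewrite /= -horner_coef0 /cpoly horner_prod big1// => i _.
  by rewrite !(hornerE, mulr0, subr0).
have H : isPow lam (fpsp (cpoly k th)) (\prod_(j < k) bser lam (cos (angle k th j))).
  rewrite /cpoly; elim/big_ind2: _.
  - rewrite fpsp1; split=> //; rewrite theta1 !mulr0 mul0r oppr0//.
  - by move=> p f q g Hp Hq; rewrite fpspM; exact: isPowM.
  - by move=> i _; exact: isPow_bser.
by rewrite (pow_unique unitn P0 H (zeta_eval k0 lam th)).
Qed.

Definition zev (n : nat) : {poly R} := 2^-1 *: (zpoly n + (zpoly n \Po (- 'X))).

Lemma zevE n x : (zev n).[x] = ((zpoly n).[x] + (zpoly n).[- x]) / 2.
Proof. by rewrite /zev hornerZ hornerD horner_comp !hornerE mulrC. Qed.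

Let inner_csum (r rho p1 p2 : R) (t : seq R) (th : nat -> R) :
  pinner (pt rho p2) (pmul (pt r p1) (csum k t th)) =
  rho * r * \sum_(j < k) tcoord t j * cos (p1 - p2 + th j).
Proof.
rewrite /pinner /pmul /csum /pt /pscale /pexpi /=.
under [in RHS]eq_bigr do rewrite cosD cosB sinB.
set S := \sum_(j < k) tcoord t j * cos _; set S' := \sum_(j < k) tcoord t j * sin _.
have -> : \sum_(j < k) tcoord t j * ((cos p1 * cos p2 + sin p1 * sin p2) * cos (th j) -
    (sin p1 * cos p2 - cos p1 * sin p2) * sin (th j)) =
  (cos p1 * cos p2 + sin p1 * sin p2) * S - (sin p1 * cos p2 - cos p1 * sin p2) * S'.
  by rewrite /S /S' !mulr_sumr -sumrB; apply: eq_bigr => j _; ring.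
ring.
Qed.

(** The nodes of the second exponential are offset by [pi / k], so [k] times the angle moves by pi
    and [xi] changes sign. The factor 2 in the denominator of [c_kappa] averages the two series,
    which leaves the even part [zev]. *)
Lemma Gfun_estimate r rho p1 p2 N : 0 <= r -> 0 <= rho ->
  `|Gfun k a b (pt r p1) (pt rho p2)
    - \sum_(n < N.+1) (rho * r) ^+ n * (zev n).[cos (k%:R * (p1 - p2))] / poch gam n|
  <= exp_tail N (rho * r).
Proof.
move=> r0 rho0; have rr0 : 0 <= rho * r by rewrite mulr_ge0.
pose C1 j := cos (angle k (p2 - p1) j).
pose C2 j := cos (angle k (p1 - p2 - pi / k%:R) j).
have [m Ek] : exists m, k = m.+1 by exists k.-1; rewrite prednK.
have EG : G_integrand k a b (pt r p1) (pt rho p2) =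
    (fun t => expC m lam C1 (rho * r) t + expC m lam C2 (rho * r) t).
  apply/funext => t; rewrite /G_integrand !inner_csum /expC -Ek mulrDl -/lam.
  congr (expR (_ * _) * _ + expR (_ * _) * _); apply: eq_bigr => j _; congr (_ * _).
    by rewrite /C1 -cosN; congr cos; rewrite /angle; ring.
  by rewrite /C2; congr cos; rewrite /angle; ring.
have [g1 e1] := @simplex_expC R m lam C1 lam0 (fun j => cos_max _) (rho * r) rr0.
have [g2 e2] := @simplex_expC R m lam C2 lam0 (fun j => cos_max _) (rho * r) rr0.
have := e1 N; have := e2 N; rewrite -Ek -/gam.
rewrite /Gfun EG.
have -> : k.-1 = m by rewrite Ek.
have [-> _] := simplexD g1 g2.
set X1 := simplex_int m (expC m lam C1 _) _; set X2 := simplex_int m (expC m lam C2 _) _.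
rewrite /c_kappa -/lam -/gam.
have E1 n : fc (\prod_(j < k) bser lam (C1 j)) n = (zpoly n).[cos (k%:R * (p1 - p2))].
  by rewrite prod_bser -cosN -mulrN opprB.
have E2 n : fc (\prod_(j < k) bser lam (C2 j)) n = (zpoly n).[- cos (k%:R * (p1 - p2))].
  rewrite prod_bser mulrBr mulrCA divff// mulr1; congr (_.[_]).
  by rewrite cosB cospi sinpi; ring.
under eq_bigr do rewrite E2.
move=> H2; under eq_bigr do rewrite E1.
move=> H1.
have -> : \sum_(n < N.+1) (rho * r) ^+ n * (zev n).[cos (k%:R * (p1 - p2))] / poch gam n =
  2^-1 * (\sum_(n < N.+1) (rho * r) ^+ n * (zpoly n).[cos (k%:R * (p1 - p2))] / poch gam n +
          \sum_(n < N.+1) (rho * r) ^+ n * (zpoly n).[- cos (k%:R * (p1 - p2))] / poch gam n).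
  rewrite -big_split/= mulr_sumr; apply: eq_bigr => n _; rewrite zevE.
  by move: (poch gam n)^-1 => p; field.
move: H1 H2.
set S1 := \sum_(n < _) _ * (zpoly _).[cos _] / _; set S2 := \sum_(n < _) _; set c := Gamma gam / _ => H1 H2.
have -> : Gamma gam / (2 * Gamma lam ^+ k) * (X1 + X2) - 2^-1 * (S1 + S2) =
   2^-1 * ((c * X1 - S1) + (c * X2 - S2)).
  by rewrite /c invfM; ring.
rewrite normrM ger0_norm// -ler_pdivlMl ?invr_gt0// invrK mulr2n mulrDl mul1r.
by apply: (le_trans (ler_normD _ _)); exact: lerD.
Qed.

(** [g] is read off from one representative pair, with product of moduli [rho] and [k] times the
    angle difference having cosine [xi]. *)
Definition gfun (rho xi : R) : R := Gfun k a b (pt rho 0) (pt 1 (acos xi / k%:R)).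

Lemma gfun_estimate rho xi N : 0 <= rho -> -1 <= xi <= 1 ->
  `|gfun rho xi - \sum_(n < N.+1) rho ^+ n * (zev n).[xi] / poch gam n| <= exp_tail N rho.
Proof.
move=> rho0 xi1; have := @Gfun_estimate rho 1 0 (acos xi / k%:R) N rho0 ler01.
by rewrite sub0r mulrN cosN mulrCA divff// mulr1 acosK ?in_itv// mul1r.
Qed.

Lemma Gfun_gfun r rho p1 p2 : 0 <= r -> 0 <= rho ->
  Gfun k a b (pt r p1) (pt rho p2) = gfun (rho * r) (cos (k%:R * (p1 - p2))).
Proof.
move=> r0 rho0; apply: (@eq_of_dist_cvg0 _ _ _ (fun N => exp_tail N (rho * r) + exp_tail N (rho * r))).
  move=> N; have H1 := Gfun_estimate p1 p2 N r0 rho0.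
  have H2 := @gfun_estimate (rho * r) (cos (k%:R * (p1 - p2))) N (mulr_ge0 rho0 r0)
    (ltac:(by rewrite cos_geN1 cos_le1)).
  rewrite distrC in H2.
  by apply: (le_trans (ler_distD _ _ _)); exact: (lerD H1 H2).
by rewrite -[0]addr0; apply: cvgD; exact: exp_tail_cvg.
Qed.

Definition jcoef (t B : R) n : R := mom2 a b (comp2 (zpoly n)
    (xip (cos (k%:R * t) * cos (k%:R * B)) (sin (k%:R * t) * sin (k%:R * B)))) / poch gam n.

Lemma nu_nu_estimate rho t B N : 0 <= rho ->
  `|nu_int b (fun v => nu_int a (fun u => gfun rho (xi_uv u v (k%:R * t) (k%:R * B))))
    - \sum_(n < N.+1) rho ^+ n * jcoef t B n| <= exp_tail N rho.
Proof.
move=> rho0.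
set cc := cos (k%:R * t) * cos (k%:R * B); set ss := sin (k%:R * t) * sin (k%:R * B).
pose p M : {poly {poly R}} := \sum_(n < M.+1)
  (rho ^+ n / poch gam n)%:P%:P * comp2 (zev n) (xip cc ss).
have pE M u v : (p M).[v%:P].[u] = \sum_(n < M.+1) rho ^+ n * (zev n).[v * cc + u * ss] / poch gam n.
  rewrite /p !horner_sum; apply: eq_bigr => n _.
  by rewrite !hornerM !hornerC comp2_eval; ring.
(* [gfun] is controlled only on [-1, 1]. Here [|cc| + |ss|] is the larger of [|cc + ss|] and
   [|cc - ss|], both of which are absolute values of cosines. *)
have xi1 u v : -1 < u < 1 -> -1 < v < 1 -> -1 <= v * cc + u * ss <= 1.
  move=> hu hv; rewrite -ler_norml.
  apply: (@le_trans _ _ (`|cc| + `|ss|)).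
    apply: (le_trans (ler_normD _ _)); rewrite !normrM.
    by apply: lerD; rewrite -!normrM normrM ler_piMl// ltW// ltr_norml.
  have h1 : cc + ss = cos (k%:R * t - k%:R * B) by rewrite cosB.
  have h2 : cc - ss = cos (k%:R * t + k%:R * B) by rewrite cosD.
  have := cos_max (k%:R * t - k%:R * B); have := cos_max (k%:R * t + k%:R * B).
  rewrite -h1 -h2 !ler_norml => /andP[q1 q2] /andP[q3 q4].
  by case: (ger0P cc) => c0; case: (ger0P ss) => s0; lra.
have H1 v : -1 < v < 1 -> forall M,
   `|nu_int a (fun u => gfun rho (xi_uv u v (k%:R * t) (k%:R * B)))
     - (map_poly (momL (nmom a)) (p M)).[v]| <= exp_tail M rho.
  move=> hv M; have [Hp _] := nu_int_poly2 (p M) a0 b0.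
  rewrite -Hp nu_int_poly//.
  apply: (@nu_unif R a _ (fun M => (p M).[v%:P]) (fun M => exp_tail M rho)) => //.
    move=> n u hu; rewrite pE.
    have -> : xi_uv u v (k%:R * t) (k%:R * B) = v * cc + u * ss.
      by rewrite /xi_uv /cc /ss; ring.
    by apply: gfun_estimate => //; exact: xi1.
  exact: exp_tail_cvg.
have -> : \sum_(n < N.+1) rho ^+ n * jcoef t B n = momL (nmom b) (map_poly (momL (nmom a)) (p N)).
  rewrite -/(mom2 a b (p N)) /p raddf_sum/=; apply: eq_bigr => n _.
  rewrite mom2C /jcoef -/cc -/ss /zev comp2Z comp2D mom2C raddfD/= LL_neg//.
  by move: (mom2 _ _ _) (poch gam n)^-1 => M P; field.
apply: (@nu_unif R b _ (fun M => map_poly (momL (nmom a)) (p M)) (fun M => exp_tail M rho)) => //.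
  by move=> n v hv; exact: H1.
exact: exp_tail_cvg.
Qed.

(** The extra factor [w] lets the induction on [q] go through: expanding one factor [xip] moves ['X]
    or ['X%:P] into it. *)
Lemma continuous_comp2 (q : {poly R}) (cc ss : R -> R) (w : {poly {poly R}}) :
  continuous cc -> continuous ss ->
  continuous (fun t => mom2 a b (comp2 q (xip (cc t) (ss t)) * w)).
Proof.
move=> ccc css; elim/poly_ind: q w => [|q c IH] w.
  rewrite (_ : (fun _ => _) = cst 0); first exact: cst_continuous.
  by apply/funext => t; rewrite /comp2 map_poly0 horner0 mul0r raddf0.
rewrite (_ : (fun _ => _) = (fun t =>
   cc t * mom2 a b (comp2 q (xip (cc t) (ss t)) * ('X * w)) +
   ss t * mom2 a b (comp2 q (xip (cc t) (ss t)) * ('X%:P * w)) + c * mom2 a b w)); last first.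
  apply/funext => t; rewrite comp2D comp2M comp2C comp2X {2}/xip -!mom2C -!raddfD/=.
  by congr (mom2 a b _); ring.
apply: continuous_addf; last exact: cst_continuous.
by apply: continuous_addf; apply: continuous_mulf => //; exact: IH.
Qed.

Lemma continuous_jcoef B n : continuous (fun t => jcoef t B n).
Proof.
rewrite /jcoef; apply: continuous_mulf; last exact: cst_continuous.
have := @continuous_comp2 (zpoly n) (fun t => cos (k%:R * t) * cos (k%:R * B))
  (fun t => sin (k%:R * t) * sin (k%:R * B)) 1.
have ck : continuous (fun t : R => k%:R * t).
  by apply: (@continuous_mulf R (cst k%:R) id); [exact: cst_continuous|move=> x; exact: cvg_id].
rewrite (_ : (fun t => mom2 a b _) = fun t => mom2 a b (comp2 (zpoly n)
    (xip (cos (k%:R * t) * cos (k%:R * B)) (sin (k%:R * t) * sin (k%:R * B))))).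
  2: by apply/funext => t; rewrite mulr1.
apply.
- apply: continuous_mulf; last exact: cst_continuous.
  by move=> x; apply: continuous_comp; [exact: ck|exact: continuous_cos].
- apply: continuous_mulf; last exact: cst_continuous.
  by move=> x; apply: continuous_comp; [exact: ck|exact: continuous_sin].
Qed.

Variable E : R * R -> R * R -> R.
Hypothesis HE : is_dunkl_kernel k a b E.

Let besselJ_pt r t rho B : besselJ k E (pt r t) (pt rho B) =
  (4 * k%:R)^-1 * (\sum_(j < 2 * k) E (pt r t) (pt rho (pang k false B j)) +
                   \sum_(j < 2 * k) E (pt r t) (pt rho (pang k true B j))).
Proof.
rewrite /besselJ; congr (_ * (_ + _)); apply: eq_bigr => j _; last by rewrite reflI_pt.
congr (E _ _); rewrite /rotI /pt /pmul /pscale /pexpi /pang /= cosD sinD.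
by congr (_, _); ring.
Qed.

Let jerr (rho r : R) N : R :=
  Num.sqrt (expR ((2 * rho + 1) * r) * (4 * k%:R)) * rho * ((rho * r) ^+ N / N`!%:R).

Let jerr_ge0 rho r N : 0 <= r -> 0 <= rho -> 0 <= jerr rho r N.
Proof.
by move=> r0 rho0; rewrite /jerr !mulr_ge0 ?sqrtr_ge0 ?invr_ge0// exprn_ge0// mulr_ge0.
Qed.

Let kernel_bound r t rho B N : 0 <= r -> 0 <= rho -> regular k t ->
  `|E (pt r t) (pt rho B) - \sum_(n < N.+1) Phi k a b n t B * (rho * r) ^+ n| <= jerr rho r N.
Proof.
move=> r0 rho0 rt; have [r1|r1] := ltP 0 r; last first.
  have -> : r = 0 by apply/eqP; rewrite eq_le r1 r0.
  have [E0 _] := HE (pt rho B).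
  rewrite {1}/pt /pscale !mul0r E0 big_ord_recl/= Phi0// expr0 mulr1 big1 ?addr0 ?subrr ?normr0.
    exact: jerr_ge0.
  by move=> i _; rewrite mulr0 expr0n mulr0.
have := @kernel_estimate_regular R k a b E k0 a0 b0 HE (fun n t => Phi k a b n t B) B
   (fun t => Phi0 k a0 b0 t B) (fun n t => Phi_rec k0 a0 b0 n t B)
   (fun n t => Phi_periodic k a b n t B)
   (fun n t => Phi_bound k0 a0 b0 n t B) rho r t N r1 rho0 rt.
set X := E _ _ - _ => H.
rewrite -ler_sqr ?nnegrE ?jerr_ge0// real_normK ?num_real//.
apply: (le_trans H); rewrite /jerr [leRHS]exprMn [in leRHS]exprMn sqr_sqrtr; last first.
  by rewrite mulr_ge0 ?expR_ge0// mulr_ge0.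
by rewrite [X in _ * (_ * X) <= _]exprMn !mulrA.
Qed.

Lemma bessel_estimate r t rho B N : 0 <= r -> 0 <= rho ->
  `|besselJ k E (pt r t) (pt rho B) - \sum_(n < N.+1) (rho * r) ^+ n * jcoef t B n|
  <= jerr rho r N.
Proof.
move=> r0 rho0.
have reg s : regular k s ->
  `|besselJ k E (pt r s) (pt rho B) - \sum_(n < N.+1) (rho * r) ^+ n * jcoef s B n| <= jerr rho r N.
  move=> rs.
  pose D e j := E (pt r s) (pt rho (pang k e B j))
     - \sum_(n < N.+1) Phi k a b n s (pang k e B j) * (rho * r) ^+ n.
  have -> : besselJ k E (pt r s) (pt rho B) - \sum_(n < N.+1) (rho * r) ^+ n * jcoef s B n =
     (4 * k%:R)^-1 * (\sum_(j < 2 * k) D false j + \sum_(j < 2 * k) D true j).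
    have -> : \sum_(n < N.+1) (rho * r) ^+ n * jcoef s B n =
      (4 * k%:R)^-1 * (\sum_(j < 2 * k) \sum_(n < N.+1) Phi k a b n s (pang k false B j) * (rho * r) ^+ n
       + \sum_(j < 2 * k) \sum_(n < N.+1) Phi k a b n s (pang k true B j) * (rho * r) ^+ n).
      rewrite ![\sum_(j < 2 * k) \sum_(n < _) _]exchange_big/= -big_split/= mulr_sumr.
      apply: eq_bigr => n _; rewrite /jcoef -Phi_total// mulrCA; congr (_ * _).
      by rewrite mulrDr !mulr_sumr; congr (_ + _); apply: eq_bigr => j _; rewrite mulrC.
    by rewrite besselJ_pt -mulrBr /D !sumrB [in RHS]addrACA -opprD.
  rewrite normrM ger0_norm ?invr_ge0 ?mulr_ge0//.
  rewrite mulrC ler_pdivrMr ?mulr_gt0 ?ltr0n//.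
  have S e : `|\sum_(j < 2 * k) D e j| <= (2 * k%:R) * jerr rho r N.
    apply: (le_trans (ler_norm_sum _ _ _)).
    rewrite -natrM -[(2 * k)%N]card_ord mulr_natl -sumr_const.
    by rewrite card_ord; apply: ler_sum => j _; exact: kernel_bound.
  apply: (le_trans (ler_normD _ _)).
  apply: (le_trans (lerD (S false) (S true))).
  by rewrite le_eqVlt; apply/orP; left; apply/eqP; ring.
(* The remaining angles lie on mirrors. A strict violation there would persist on a neighbourhood by
   continuity in the angle, which contains a regular angle. *)
rewrite leNgt; apply/negP => H.
pose h s := `|besselJ k E (pt r s) (pt rho B) - \sum_(n < N.+1) (rho * r) ^+ n * jcoef s B n|.
have c1 : continuous (fun s => besselJ k E (pt r s) (pt rho B)).
  under eq_fun do rewrite besselJ_pt.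
  apply: continuous_mulf; first exact: cst_continuous.
  by apply: continuous_addf; apply: continuous_bigsum => j; exact: continuous_circle.
have c2 : continuous (fun s => \sum_(n < N.+1) (rho * r) ^+ n * jcoef s B n).
  apply: continuous_bigsum => n; apply: continuous_mulf; first exact: cst_continuous.
  exact: continuous_jcoef.
have ch : {for t, continuous h}.
  apply: continuous_comp; last exact: norm_continuous.
  exact: (continuousB (c1 t) (c2 t)).
have /nbhs_ballP[d /= d0 hd] : \forall s \near t, jerr rho r N < h s.
  exact: (cvgr_gt (h t) ch).
have [s ts rs] : exists2 s, ball t d s & regular k s.
  have k20 : 0 < (2 * k)%:R :> R by rewrite ltr0n muln_gt0.
  have [st|st] := eqVneq (sin ((2 * k)%:R * t)) 0; last by exists t => //; exact: ballxx.
  (* The second bound keeps [2 k e] within (0, pi / 2], where the sine is positive. *)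
  pose e := Num.min (d / 2) (pi / (2 * (2 * k)%:R)).
  have e0 : 0 < e by rewrite lt_min divr_gt0// divr_gt0 ?pi_gt0// mulr_gt0.
  exists (t + e).
    rewrite /ball/= opprD addrA subrr sub0r normrN gtr0_norm// gt_min.
    by rewrite ltr_pdivrMr// ltr_pMr// ltr1n.
  rewrite /regular mulrDr sinD st mul0r add0r mulf_neq0//.
    by apply/eqP => c0; have := cos2Dsin2 ((2 * k)%:R * t);
      rewrite st c0 !expr0n addr0 => /eqP; rewrite eq_sym oner_eq0.
  rewrite gt_eqF// sin_gt0_pi// mulr_gt0//=.
  apply: (@le_lt_trans _ _ (pi / 2)); last by rewrite ltr_pdivrMr// ltr_pMr ?pi_gt0// ltr1n.
  rewrite -ler_pdivlMl// ge_min; apply/orP; right.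
  rewrite le_eqVlt; apply/orP; left; apply/eqP.
  by rewrite invfM; ring.
by have := hd s ts; rewrite ltNge => /negP; apply; exact: reg.
Qed.

Lemma jerr_cvg rho r : jerr rho r N @[N --> \oo] --> 0.
Proof.
rewrite /jerr -[X in _ --> X](mulr0 (Num.sqrt (expR ((2 * rho + 1) * r) * (4 * k%:R)) * rho)).
by apply: cvgMl_tmp; exact: cvg_exp_coeff.
Qed.

Lemma bessel_eq r t rho B : 0 <= r -> 0 <= rho ->
  besselJ k E (pt r t) (pt rho B) =
  nu_int b (fun v => nu_int a (fun u => gfun (rho * r) (xi_uv u v (k%:R * t) (k%:R * B)))).
Proof.
move=> r0 rho0; apply: (@eq_of_dist_cvg0 _ _ _ (fun N => jerr rho r N + exp_tail N (rho * r))).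
  move=> N; have H1 := bessel_estimate t B N r0 rho0.
  have H2 := nu_nu_estimate t B N (mulr_ge0 rho0 r0); rewrite distrC in H2.
  by apply: (le_trans (ler_distD _ _ _)); exact: (lerD H1 H2).
by rewrite -[0]addr0; apply: cvgD; [exact: jerr_cvg|exact: exp_tail_cvg].
Qed.

End Assembly.

Theorem mainTheorem9 (R : realType) (k : nat) (a b : R) (E : R * R -> R * R -> R) :
  (2 <= k)%N -> 0 < a -> 0 < b -> is_dunkl_kernel k a b E ->
  exists g : R -> R -> R,
    forall (z w : R * R) (phi1 phi2 : R),
      z = pscale (pnorm z) (pexpi phi1) -> w = pscale (pnorm w) (pexpi phi2) ->
      Gfun k a b z w = g (pnorm (pmul z w)) (xi_uv 1 1 (k%:R * phi1) (k%:R * phi2)) /\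
      besselJ k E z w =
        nu_int b (fun v => nu_int a (fun u =>
          g (pnorm (pmul z w)) (xi_uv u v (k%:R * phi1) (k%:R * phi2)))).
Proof.
move=> k2 a0 b0 HE; have k0 : (0 < k)%N by exact: ltn_trans k2.
exists (gfun k a b) => z w phi1 phi2 Ez Ew.
have z0 : 0 <= pnorm z by exact: sqrtr_ge0.
have w0 : 0 <= pnorm w by exact: sqrtr_ge0.
have Ezw : pnorm (pmul z w) = pnorm w * pnorm z.
  rewrite /pnorm -sqrtrM; last by rewrite addr_ge0 ?sqr_ge0 -?expr2.
  by congr Num.sqrt; rewrite /pinner /pmul /=; ring.
rewrite Ezw.
have -> : xi_uv 1 1 (k%:R * phi1) (k%:R * phi2) = cos (k%:R * (phi1 - phi2)).
  by rewrite /xi_uv !mul1r mulrBr cosB.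
by rewrite {1 3}Ez {1 3}Ew -/(pt _ _) -/(pt _ _) Gfun_gfun// (@bessel_eq R k a b).
Qed.
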